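(* Consider the one-dimensional vectorial Deffuant model with $F$ issues and confidence threshold $\theta$, started from the uniform product measure (the initial opinions $\eta_0(x)$, $x \in \mathbb{Z}$, independent and uniformly distributed on $\{0,1\}^F$), and assume $F \geq 4\theta - 1$. Then the system coexists: there is a random configuration $\eta_\infty : \mathbb{Z} \to \{0,1\}^F$ such that for every $x \in \mathbb{Z}$, almost surely $\eta_t(x) = \eta_\infty(x)$ for all sufficiently large $t$, and almost surely $\#\{\eta_\infty(x) : x \in \mathbb{Z}\} = 2^F$.
   Context: $F \geq 1$ and $\theta \geq 1$ are integers. The opinion set is $\Gamma = \{0,1\}^F$ with Hamming distance $H(u,v) = \#\{i : u_i \neq v_i\}$. The vectorial Deffuant model on $\mathbb{Z}$ is the continuous-time Markov process $(\eta_t)_{t \geq 0}$, $\eta_t : \mathbb{Z} \to \Gamma$: independently at rate one, each vertex $x$ chooses one of its two nearest neighbors $y \in \{x-1,x+1\}$ uniformly at random; if $1 \leq H(\eta(x),\eta(y)) \leq \theta$, an issue $i$ is chosen uniformly at random among those with $\eta(x)_i \neq \eta(y)_i$ and the $i$-th coordinate of $\eta(x)$ is set equal to $\eta(y)_i$; otherwise nothing happens. *)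

(* Defs.v *)
From HB Require Import structures.
From mathcomp Require Import all_boot all_order all_algebra.
From mathcomp Require Import all_classical all_reals all_analysis.
Set Implicit Arguments. Unset Strict Implicit. Unset Printing Implicit Defensive.
Import Order.TTheory GRing.Theory Num.Theory.
Local Open Scope classical_set_scope.
Local Open Scope ring_scope.

Definition opinion (F : nat) := {ffun 'I_F -> bool}.

Definition hamming (F : nat) (u v : opinion F) : nat := #|[set i | u i != v i]|.

Definition disagree (F : nat) (u v : opinion F) : seq 'I_F :=
  [seq i <- enum 'I_F | u i != v i].

(* Deffuant update of the opinion u of x interacting with the opinion v of y,
   the disagreeing issue being selected by r in [0,1): the
   (truncn (r * k))-th disagreeing issue, k = number of disagreements
   (uniform among disagreeing issues when r is uniform on [0,1]). *)
Definition deff_update (R : realType) (F theta : nat) (u v : opinion F) (r : R)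
  : opinion F :=
  let D := disagree u v in
  if (1 <= hamming u v <= theta)%N then
    match D with
    | [::] => u
    | i0 :: _ =>
        let i := nth i0 D (Num.truncn (r * (size D)%:R)) in
        [ffun j => if j == i then v i else u j]
    end
  else u.

(* Index set of the elementary random variables of the graphical
   (Harris) construction. *)
Inductive idx : Type :=
| Init of int & nat   (* Init x i : bit i of the initial opinion at x      *)
| Wait of int & nat   (* Wait x n : n-th interarrival time of x's clock    *)
| Dir  of int & nat   (* Dir x n  : neighbour chosen at x's n-th ring      *)
| Iss  of int & nat.  (* Iss x n  : issue chosen at x's n-th ring          *)

Definition iid_uniform (R : realType) (d : measure_display) (T : measurableType d)
  (P : probability T R) (U : idx -> T -> R) : Prop :=
  (forall j, measurable_fun setT (U j)) /\
  (forall j (a : R), 0 <= a <= 1 -> P [set w | U j w <= a] = a%:E) /\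
  (forall (k : nat) (f : 'I_k -> idx), injective f ->
     forall A : 'I_k -> set R, (forall j, measurable (A j)) ->
       P (\bigcap_(j in [set: 'I_k]) (U (f j) @^-1` A j)) =
       (\prod_(j < k) P (U (f j) @^-1` A j))%E).

(* n-th ring time (n = 0, 1, ...) of the rate-one exponential clock at x *)
Definition ring_time (R : realType) (u : idx -> R) (x : int) (n : nat) : R :=
  \sum_(m < n.+1) - ln (u (Wait x m)).

Definition ring_nbr (R : realType) (u : idx -> R) (x : int) (n : nat) : int :=
  if u (Dir x n) < 2^-1 then (x + 1)%R else (x - 1)%R.

Definition init_opinion (R : realType) (F : nat) (u : idx -> R) (x : int)
  : opinion F := [ffun i : 'I_F => u (Init x i) < 2^-1].

(* e : time -> Z -> Gamma is the vectorial Deffuant process driven by u: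
   correct initial condition; the opinion of x only changes at the ring
   times of x's clock; at each ring time of x, the new opinion of x is the
   Deffuant update of the opinions of x and of the chosen neighbour
   just before the ring. *)
Definition deffuant_path (R : realType) (F theta : nat) (u : idx -> R)
  (e : R -> int -> opinion F) : Prop :=
  (forall x, e 0 x = init_opinion F u x) /\
  (forall x (s t : R), 0 <= s <= t ->
     (forall n, ~ (s < ring_time u x n <= t)) -> e t x = e s x) /\
  (forall x n, exists2 eps : R, 0 < eps & forall s : R,
     ring_time u x n - eps < s < ring_time u x n ->
     e (ring_time u x n) x =
       deff_update theta (e s x) (e s (ring_nbr u x n)) (u (Iss x n))).

Arguments deffuant_path {R} F theta u e.

(* Main.v *)
Require Import Defs.
From HB Require Import structures.
From mathcomp Require Import all_boot all_order all_algebra.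
From mathcomp Require Import all_classical all_reals all_analysis.
From mathcomp Require Import measurable_realfun.
From mathcomp Require Import zify ring lra.
Set Implicit Arguments. Unset Strict Implicit. Unset Printing Implicit Defensive.
Import Order.TTheory GRing.Theory Num.Theory.
Local Open Scope classical_set_scope.
Local Open Scope ring_scope.

(* Let zeta be the number of disagreements across an edge. For g = |zeta - theta| and
   g = (theta - zeta)^+, the total of g over the two edges at a vertex never decreases when
   this vertex changes, so by stationarity the mean of g at an edge is nondecreasing in
   time, and each vertex sees finitely many strict gains. For the second g any change at an
   end of a blocked edge (zeta > theta) is such a gain: the ends of an edge blocked at
   arbitrarily late times fixate.

   If no vertex fixated, every initially blocked edge would be hit and the limit of the
   mean of |zeta - theta| would be at most theta. Flipping the same issues at all vertices
   to the right of a blocked edge preserves the law and, until the edge is hit, the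
   dynamics; hence the issue first changed is independent of the blocked set of
   disagreements. Counting the hits that add a disagreement (a gain of 2), and a local gain
   that settles the equality case F = 3, theta = 1, the mean of |zeta - theta| would exceed
   theta as soon as F >= 4 theta - 1.

   So a vertex fixates with positive probability; fixation a.s. propagates to neighbours,
   and a zero-one law makes it certain. Global flips make all limit opinions equally
   likely, and the zero-one law again shows that each of them occurs. *)

(** * The space of elementary variables *)

(** The statement concerns any process [eta] that obeys the update rules, on any probability space.
    Everything is therefore proved on the canonical space of configurations [idx -> R], for
    quantities computed from one configuration: the value of a site after its k-th ring. The
    obstacle is that infinitely many clocks ring in every time interval, so no ring comes first;
    far-away sites silent up to a given time make the relevant past of each ring well-founded, which
    carries existence, uniqueness and every pathwise induction. The threshold comes from counting.
    At time 0 the mean of |zeta - theta| is at least F/2 - theta, enough once F >= 4 theta. For F =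
    4 theta - 1 one half is missing: a hit that adds a disagreement gains 2, and for theta >= 2 at
    least a quarter of all differences are blocked and lack a given issue, which supplies 2 * 1/4.
    Fixation is passed to a neighbour by repeated trials: each time an edge with a settled end
    becomes active, that end changes with a probability bounded below. *)

Lemma exists_nat_gt (R : realType) (a : R) : exists n : nat, a < n%:R.
Proof. by exists (Num.truncn a).+1; exact: truncnS_gt. Qed.

Definition idx_code (j : idx) : (int * nat + int * nat) + (int * nat + int * nat) :=
  match j with
  | Init x n => inl (inl (x, n)) | Wait x n => inl (inr (x, n))
  | Dir x n => inr (inl (x, n)) | Iss x n => inr (inr (x, n))
  end.

Definition idx_decode (c : (int * nat + int * nat) + (int * nat + int * nat)) : idx :=
  match c with
  | inl (inl p) => Init p.1 p.2 | inl (inr p) => Wait p.1 p.2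
  | inr (inl p) => Dir p.1 p.2 | inr (inr p) => Iss p.1 p.2
  end.

Lemma idx_codeK : cancel idx_code idx_decode.
Proof. by case. Qed.

HB.instance Definition _ := Countable.copy idx (can_type idx_codeK).

Section Space.
Variable R : realType.

Definition cfg := idx -> R.

HB.instance Definition _ := gen_eqMixin cfg.
HB.instance Definition _ := gen_choiceMixin cfg.
HB.instance Definition _ := isPointed.Build cfg (fun=> 0).

(** Finite-dimensional lower orthants: closed under intersection and generating the product
    sigma-algebra, with explicit measure under independence. Only the values of [a] on [s] count. *)
Definition ray (s : seq idx) (a : idx -> R) : set cfg :=
  [set u | forall j, j \in s -> u j <= a j].

Definition rays : set (set cfg) := [set B | exists s a, B = ray s a].

Definition space := g_sigma_algebraType rays.

Lemma rays_setI : setI_closed rays.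
Proof.
move=> _ _ [s [a ->]] [s' [a' ->]].
exists (s ++ s'), (fun j => if j \in s then
   (if j \in s' then Order.min (a j) (a' j) else a j) else a' j).
apply/seteqP; split=> u /=.
  move=> [H1 H2] j; rewrite mem_cat; case: (boolP (j \in s)) => js; case: (boolP (j \in s')) => js' //= _.
  - by rewrite le_min H1// H2.
  - exact: H1.
  - exact: H2.
move=> H; split=> j js; have := H j; rewrite mem_cat js ?orbT => /(_ isT).
  by case: ifP => // _; rewrite le_min => /andP[].
by case: ifP => // _; rewrite le_min => /andP[].
Qed.

Lemma measurable_coord j : measurable_fun [set: space] (fun u : space => u j).
Proof.
apply: (measurability _ (@RGenCInfty.measurableE R)) => _ [_ [x ->] <-].
rewrite setTI.
have -> : (fun u : space => u j) @^-1` `[x, +oo[%classic =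
   ~` (\bigcup_n ray [:: j] (fun=> x - n.+1%:R^-1)).
  apply/seteqP; split=> u /=.
    rewrite in_itv/= andbT => xu [n _] /(_ j); rewrite mem_head => /(_ isT).
    apply/negP; rewrite -ltNge; apply: lt_le_trans xu.
    by rewrite ltrBlDr ltrDl invr_gt0.
  rewrite in_itv/= andbT => H; rewrite leNgt; apply/negP => ux; apply: H.
  have e0 : 0 < x - u j by rewrite subr_gt0.
  have [n nlt] : exists n, n.+1%:R^-1 < x - u j.
    by exists (Num.truncn (x - u j)^-1); rewrite invf_plt ?posrE// truncnS_gt.
  exists n => // k; rewrite inE => /eqP ->.
  by rewrite lerBrDl -lerBrDr ltW.
apply: measurableC; apply: bigcup_measurable => n _.
by apply: sub_sigma_algebra; exists [:: j], (fun=> x - n.+1%:R^-1).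
Qed.

Lemma measurable_space d (T : measurableType d) (f : T -> space) :
  (forall j, measurable_fun setT (fun t => f t j)) -> measurable_fun setT f.
Proof.
move=> mf; apply: (@measurability _ _ T space setT f rays) => //.
move=> _ [_ [s [a ->]] <-]; rewrite setTI.
have -> : f @^-1` ray s a = \bigcap_(j in [set` s]) ((fun t => f t j) @^-1` `]-oo, a j]%classic).
  apply/seteqP; split=> t /= H j js.
      by rewrite /= in_itv /=; exact: H.
    by have := H j js; rewrite /= in_itv.
apply: fin_bigcap_measurable => // j _.
by rewrite -[X in measurable X]setTI; apply: mf => //; exact: measurable_itv.
Qed.

(** Uniqueness of a measure given on a generating pi-system. Lists without repetition suffice, since
    [undup] leaves a ray unchanged; finite measures rather than probabilities are allowed for the
    sake of [scale_law]. *)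
Lemma law_unique (m1 m2 : {measure set space -> \bar R}) :
  (forall s a, uniq s -> m1 (ray s a) = m2 (ray s a)) ->
  (m1 setT < +oo)%E ->
  forall B, measurable B -> m1 B = m2 B.
Proof.
move=> H fin B mB.
have rT : ray [::] (fun=> 0) = setT by apply/seteqP; split=> u.
apply: (@measure_unique _ R space rays (fun=> setT)) => //.
- exact: rays_setI.
- by move=> _; exists [::], (fun=> 0).
- by apply/seteqP; split=> // u _; exists 0%N.
- move=> _ [s [a ->]].
  have -> : ray s a = ray (undup s) a.
    by apply/seteqP; split=> u H' j jin; apply: H'; move: jin; rewrite mem_undup.
  by rewrite H// undup_uniq.
Qed.

End Space.

(** * Measurable predicates and maps into countable types *)

Section Measurability.
Context d (S : measurableType d).

Definition mP (Q : S -> Prop) : Prop := measurable [set u | Q u].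

(** Measurability for maps into types without a sigma-algebra, such as [nat], [int] or opinions. On
    a countable target measurable fibres are enough, and nested dependencies (the value at a random
    neighbour after a random number of rings) are handled by [mfib_bind]. *)
Definition mfib (T : Type) (f : S -> T) : Prop := forall t, mP (fun u => f u = t).

Lemma mP_ext Q Q' : (forall u, Q u <-> Q' u) -> mP Q -> mP Q'.
Proof.
move=> H; rewrite /mP (_ : [set u | Q' u] = [set u | Q u])//.
by apply/seteqP; split=> u /H.
Qed.

Lemma mP_const (A : Prop) : mP (fun=> A).
Proof.
have [a|na] := pselect A.
  by rewrite /mP (_ : [set u | A] = setT)//; apply/seteqP; split.
by rewrite /mP (_ : [set u | A] = set0)//; apply/seteqP; split.
Qed.

Lemma mP_not Q : mP Q -> mP (fun u => ~ Q u).
Proof. by move=> mQ; exact: measurableC. Qed.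

Lemma mP_and Q Q' : mP Q -> mP Q' -> mP (fun u => Q u /\ Q' u).
Proof. by move=> mQ mQ'; exact: measurableI. Qed.

Lemma mP_andb (b c : S -> bool) : mP b -> mP c -> mP (fun u => b u && c u).
Proof. by move=> mb mc; apply: mP_ext (mP_and mb mc) => u; split=> /andP. Qed.

Lemma mP_or Q Q' : mP Q -> mP Q' -> mP (fun u => Q u \/ Q' u).
Proof. by move=> mQ mQ'; exact: measurableU. Qed.

Lemma mP_imp Q Q' : mP Q -> mP Q' -> mP (fun u => Q u -> Q' u).
Proof.
move=> mQ mQ'; apply: (@mP_ext (fun u => ~ Q u \/ Q' u)).
  by move=> u; split=> [[nq q|//]|H]; [|have [q|] := pselect (Q u); [right; exact: H|left]].
by apply: mP_or => //; exact: mP_not.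
Qed.

Lemma mP_ex (I : countType) (Q : I -> S -> Prop) :
  (forall i, mP (Q i)) -> mP (fun u => exists i, Q i u).
Proof.
move=> mQ.
have : measurable (\bigcup_n (if unpickle n is Some i then [set u | Q i u] else set0)).
  by apply: bigcup_measurable => n _; case: unpickle => // i; exact: mQ.
congr measurable; apply/seteqP; split=> u.
  by move=> [n _]; case: unpickle => // i ?; exists i.
by move=> [i Hi]; exists (pickle i) => //; rewrite pickleK.
Qed.

Lemma mP_all (I : countType) (Q : I -> S -> Prop) :
  (forall i, mP (Q i)) -> mP (fun u => forall i, Q i u).
Proof.
move=> mQ; apply: (@mP_ext (fun u => ~ exists i, ~ Q i u)).
  move=> u; split=> [H i|H [i]]; last by apply.
  by apply: contrapT => nQ; apply: H; exists i.
by apply: mP_not; apply: mP_ex => i; exact: mP_not.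
Qed.

Lemma mP_fib (I : countType) (f : S -> I) (Q : I -> S -> Prop) :
  mfib f -> (forall i, mP (Q i)) -> mP (fun u => Q (f u) u).
Proof.
move=> mf mQ; apply: (@mP_ext (fun u => exists i, f u = i /\ Q i u)).
  by move=> u; split=> [[i [<-]]//|H]; exists (f u).
by apply: mP_ex => i; apply: mP_and.
Qed.

Lemma mP_pred (I : countType) (Q : I -> Prop) (f : S -> I) : mfib f -> mP (fun u => Q (f u)).
Proof. by move=> mf; apply: (mP_fib (Q := fun i _ => Q i)) => // i; exact: mP_const. Qed.

Lemma mP_pred2 (I J : countType) (Q : I -> J -> Prop) (f : S -> I) (h : S -> J) :
  mfib f -> mfib h -> mP (fun u => Q (f u) (h u)).
Proof.
move=> mf mh; apply: (mP_fib (Q := fun i u => Q i (h u))) => // i.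
exact: (mP_pred (Q i)).
Qed.

Lemma mfib_bind (I : countType) T (f : S -> I) (h : I -> S -> T) :
  mfib f -> (forall i, mfib (h i)) -> mfib (fun u => h (f u) u).
Proof. by move=> mf mh t; apply: (mP_fib (Q := fun i u => h i u = t)) => // i; exact: mh. Qed.

Lemma mfib_const T (t : T) : mfib (fun=> t).
Proof. by move=> t'; exact: mP_const. Qed.

Lemma mfib_comp (I : countType) T (g : I -> T) f : mfib f -> mfib (fun u => g (f u)).
Proof. move=> mf; apply: (mfib_bind (h := fun i _ => g i)) => // i; exact: mfib_const. Qed.

Lemma mfib_bool (b : S -> bool) : mP (fun u => b u) -> mfib b.
Proof.
move=> mb [|]; first exact: mP_ext mb.
by apply: mP_ext (mP_not mb) => u; split=> [/negP/negbTE|->].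
Qed.

Variable R : realType.

Lemma mP_lt (f g : S -> R) : measurable_fun setT f -> measurable_fun setT g ->
  mP (fun u => f u < g u).
Proof.
move=> mf mg; have := measurable_fun_ltr mf mg.
move=> /(_ measurableT [set true] Logic.I); rewrite setTI.
by rewrite /mP; congr measurable; apply/seteqP; split=> u.
Qed.

Lemma mP_le (f g : S -> R) : measurable_fun setT f -> measurable_fun setT g ->
  mP (fun u => f u <= g u).
Proof.
move=> mf mg; apply: mP_ext (mP_not (mP_lt mg mf)) => u.
by rewrite leNgt; split=> /negP.
Qed.

Lemma mP_eq (f g : S -> R) : measurable_fun setT f -> measurable_fun setT g ->
  mP (fun u => f u = g u).
Proof.
move=> mf mg; apply: mP_ext (mP_and (mP_le mf mg) (mP_le mg mf)) => u.
by split=> [[fg gf]|->//]; apply/eqP; rewrite eq_le fg.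
Qed.

End Measurability.

(** * Probabilities as real numbers *)

Section RealProbability.
Context d (S : measurableType d) (R : realType) (P : probability S R).

Definition Pr (A : set S) : R := fine (P A).

Lemma PrE A : measurable A -> P A = (Pr A)%:E.
Proof. by move=> mA; rewrite /Pr fineK// fin_num_measure. Qed.

Lemma Pr_ge0 A : 0 <= Pr A.
Proof. by rewrite /Pr fine_ge0. Qed.

Lemma Pr_le A B : measurable A -> measurable B -> A `<=` B -> Pr A <= Pr B.
Proof.
move=> mA mB AB; rewrite -lee_fin -!PrE//; apply: le_measure => //; exact/mem_set.
Qed.

Lemma Pr_le1 A : measurable A -> Pr A <= 1.
Proof. by move=> mA; rewrite -lee_fin -PrE//; exact: probability_le1. Qed.

Lemma PrT : Pr setT = 1.
Proof. by rewrite /Pr probability_setT. Qed.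

Lemma Pr0 : Pr set0 = 0.
Proof. by rewrite /Pr measure0. Qed.

Lemma PrC A : measurable A -> Pr (~` A) = 1 - Pr A.
Proof. by move=> mA; rewrite /Pr probability_setC// PrE. Qed.

Lemma PrU A B : measurable A -> measurable B -> A `&` B `<=` set0 ->
  Pr (A `|` B) = Pr A + Pr B.
Proof.
move=> mA mB AB; have mAB := measurableU _ _ mA mB.
apply: EFin_inj; rewrite EFinD -!PrE// measureU//.
by apply/seteqP; split.
Qed.

Lemma Pr_leU A B : measurable A -> measurable B -> Pr (A `|` B) <= Pr A + Pr B.
Proof.
move=> mA mB; have mAB := measurableU _ _ mA mB.
by rewrite -lee_fin EFinD -!PrE//; exact: measureU2.
Qed.

Lemma Pr_split A B : measurable A -> measurable B ->
  Pr A = Pr (A `&` B) + Pr (A `\` B).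
Proof.
move=> mA mB; rewrite -PrU ?setUIDK//; first exact: measurableI.
  exact: measurableD.
by move=> u [[_ ?] []].
Qed.

Lemma Pr_incr (F : nat -> set S) : (forall n, measurable (F n)) ->
  (forall n, F n `<=` F n.+1) -> forall e, 0 < e ->
  exists n, Pr (\bigcup_n F n) <= Pr (F n) + e.
Proof.
move=> mF iF e e0.
have mU : measurable (\bigcup_n F n) by exact: bigcupT_measurable.
have nd : nondecreasing_seq F.
  by apply/nondecreasing_seqP => n; apply/subsetPset; exact: iF.
have /fine_cvgP[_] : (P \o F) @ \oo --> (Pr (\bigcup_n F n))%:E.
  by rewrite -PrE//; exact: nondecreasing_cvg_mu.
move=> /cvgrPdist_le /(_ e e0) [n _ /(_ n (leqnn n))]/=.
rewrite ler_norml => /andP[_]; rewrite lerBlDl addrC -/(Pr (F n)) => ?.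
by exists n; rewrite addrC.
Qed.

Lemma Pr_decr (F : nat -> set S) : (forall n, measurable (F n)) ->
  (forall n, F n.+1 `<=` F n) -> forall e, 0 < e ->
  exists n, Pr (F n) <= Pr (\bigcap_n F n) + e.
Proof.
move=> mF dF e e0.
have mC n : measurable (~` F n) by exact: measurableC.
have mI : measurable (\bigcap_n F n) by exact: bigcapT_measurable.
have [|n] := Pr_incr mC _ e0.
  by move=> n; exact: subsetC.
rewrite -setC_bigcap !PrC// => H; exists n; lra.
Qed.

Lemma Pr_bigcup0 (F : nat -> set S) : (forall n, measurable (F n)) ->
  (forall n, Pr (F n) = 0) -> Pr (\bigcup_n F n) = 0.
Proof.
move=> mF F0; rewrite /Pr.
suff -> : P (\bigcup_n F n) = 0%E by [].
apply/negligibleP; first exact: bigcupT_measurable.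
apply: negligible_bigcup => n; apply/negligibleP => //.
by have := PrE (mF n); rewrite F0.
Qed.

Lemma Pr_le_ae A B G : measurable A -> measurable B -> measurable G -> Pr G = 1 ->
  (forall u, G u -> A u -> B u) -> Pr A <= Pr B.
Proof.
move=> mA mB mG G1 AB.
have mGc : measurable (~` G) by exact: measurableC.
have : Pr A <= Pr (B `|` ~` G).
  apply: Pr_le => //; first exact: measurableU.
  by move=> u Au; have [Gu|] := pselect (G u); [left; exact: AB|right].
move=> /le_trans; apply; apply: le_trans (Pr_leU _ _) _ => //.
by rewrite PrC// G1 subrr addr0.
Qed.

Lemma Pr_eq_ae A B G : measurable A -> measurable B -> measurable G -> Pr G = 1 ->
  (forall u, G u -> (A u <-> B u)) -> Pr A = Pr B.
Proof.
move=> mA mB mG G1 AB; apply/eqP; rewrite eq_le; apply/andP; split.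
  by apply: (Pr_le_ae _ _ mG) => // u Gu /(AB u Gu).
by apply: (Pr_le_ae _ _ mG) => // u Gu /(AB u Gu).
Qed.

Lemma Pr1_sub A G : measurable A -> measurable G -> Pr G = 1 -> G `<=` A -> Pr A = 1.
Proof.
move=> mA mG G1 GA; apply/eqP; rewrite eq_le Pr_le1//= -G1; exact: Pr_le.
Qed.

Lemma Pr1_I A B : measurable A -> measurable B -> Pr A = 1 -> Pr B = 1 -> Pr (A `&` B) = 1.
Proof.
move=> mA mB A1 B1; have := Pr_split mA mB; rewrite A1 => ->.
have mBc : measurable (~` B) by exact: measurableC.
suff -> : Pr (A `\` B) = 0 by rewrite addr0.
apply/eqP; rewrite eq_le Pr_ge0 andbT.
have <- : Pr (~` B) = 0 by rewrite PrC// B1 subrr.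
by apply: Pr_le => [||u []]//; exact: measurableD.
Qed.

Lemma Pr1_bigcap (F : nat -> set S) : (forall n, measurable (F n)) ->
  (forall n, Pr (F n) = 1) -> Pr (\bigcap_n F n) = 1.
Proof.
move=> mF F1; have mU : measurable (\bigcup_n ~` F n).
  by apply: bigcupT_measurable => n; exact: measurableC.
rewrite -[\bigcap_n F n]setCK setC_bigcap PrC// Pr_bigcup0 ?subr0//.
  by move=> n; exact: measurableC.
by move=> n; rewrite PrC// F1 subrr.
Qed.

Lemma Pr1_all (I : countType) (Q : I -> S -> Prop) : (forall i, mP (Q i)) ->
  (forall i, Pr [set u | Q i u] = 1) -> Pr [set u | forall i, Q i u] = 1.
Proof.
move=> mQ Q1.
rewrite (_ : [set u | forall i, Q i u] =
  \bigcap_n (if unpickle n is Some i then [set u | Q i u] else setT)).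
  by apply: Pr1_bigcap => n; case: unpickle => [i|]//; [exact: mQ|exact: PrT].
apply/seteqP; split=> u.
  by move=> H n _; case: unpickle.
by move=> H i; have := H (pickle i) Logic.I; rewrite pickleK.
Qed.

Lemma Pr_sum_seq (I : eqType) (F : I -> set S) (s : seq I) : uniq s ->
  (forall i, measurable (F i)) -> (forall i j u, F i u -> F j u -> i = j) ->
  Pr [set u | exists2 i, i \in s & F i u] = \sum_(i <- s) Pr (F i) /\
  measurable [set u | exists2 i, i \in s & F i u].
Proof.
move=> + mF dF; elim: s => [_|i s IH /= /andP[nis us]].
  rewrite big_nil (_ : [set u | _] = set0) ?Pr0//.
  by apply/seteqP; split=> u [].
have [IH1 IH2] := IH us.
have -> : [set u | exists2 k, k \in i :: s & F k u] =
    F i `|` [set u | exists2 k, k \in s & F k u].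
  apply/seteqP; split=> u /=.
    by move=> [k]; rewrite inE => /orP[/eqP->|ks]; [left|right; exists k].
  by move=> [Fi|[k ks Fk]]; [exists i; rewrite ?mem_head|exists k; rewrite // inE ks orbT].
split; last exact: measurableU.
rewrite PrU ?big_cons ?IH1// => u [Fi [k ks Fk]].
by move: nis; rewrite (dF _ _ _ Fi Fk) ks.
Qed.

Lemma Pr_sum (I : finType) (F : I -> set S) :
  (forall i, measurable (F i)) -> (forall i j u, F i u -> F j u -> i = j) ->
  Pr [set u | exists i, F i u] = \sum_i Pr (F i).
Proof.
move=> mF dF; have [<- _] := Pr_sum_seq (index_enum_uniq I) mF dF.
congr Pr; apply/seteqP; split=> u [i]; last by move=> _ Fi; exists i.
by exists i; rewrite ?mem_index_enum.
Qed.

Lemma Pr1_ae A : measurable A -> Pr A = 1 -> {ae P, forall u, A u}.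
Proof.
move=> mA A1; exists (~` A); split; [exact: measurableC| |by []].
by rewrite PrE; [rewrite PrC// A1 subrr|exact: measurableC].
Qed.

End RealProbability.

(** * Uniform laws *)

Section Laws.
Variable R : realType.
Implicit Types (mu : probability (space R) R) (B : set (space R)).

(** The form that [iid_uniform] takes for the coordinate process; lists without repetition replace
    injections from ordinals, so that products can be split and filtered. *)
Definition uniform_law mu : Prop :=
  (forall j (a : R), 0 <= a <= 1 -> mu [set u : space R | u j <= a] = a%:E) /\
  (forall s (A : idx -> set R), uniq s -> (forall j, measurable (A j)) ->
     mu [set u : space R | forall j, j \in s -> A j (u j)] =
     (\prod_(j <- s) mu [set u : space R | A j (u j)])%E).

Lemma mcoord j (A : set R) : measurable A -> measurable [set u : space R | A (u j)].
Proof. by move=> mA; rewrite -[X in measurable X]setTI; exact: measurable_coord. Qed.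

Lemma measurable_ray s (a : idx -> R) : measurable (ray s a : set (space R)).
Proof. by apply: sub_sigma_algebra; exists s, a. Qed.

Lemma map_law d (T : measurableType d) (P : {measure set T -> \bar R})
    (f : T -> space R) mu : measurable_fun setT f -> P setT = 1%E ->
  (forall s a, uniq s -> P (f @^-1` ray s a) = mu (ray s a)) ->
  forall B, measurable B -> P (f @^-1` B) = mu B.
Proof.
move=> mf PT H B mB.
pose X : {mfun T >-> space R} := HB.pack f (isMeasurableFun.Build _ _ _ _ f mf).
pose m1 : {measure set space R -> \bar R} := HB.pack (pushforward P X)
  (isMeasure.Build _ _ _ (pushforward P X) (measure0 _) (fun A => measure_ge0 _ A)
     (@measure_semi_sigma_additive _ _ _ _)).
apply: (@law_unique R (m1 mf) mu) => //.
by rewrite /= /pushforward preimage_setT PT ltry.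
Qed.

Variable mu : probability (space R) R.
Hypothesis Hmu : uniform_law mu.

Lemma law_cyl s (A : idx -> set R) : uniq s -> (forall j, measurable (A j)) ->
  Pr mu [set u | forall j, j \in s -> A j (u j)] =
  \prod_(j <- s) Pr mu [set u | A j (u j)].
Proof.
move=> us mA; rewrite /Pr Hmu.2//.
rewrite (eq_bigr (fun j => (Pr mu [set u | A j (u j)])%:E)) ?prodEFin//.
by move=> j _; rewrite PrE//; exact: mcoord.
Qed.

Lemma law_coord j (a : R) : Pr mu [set u | u j <= a] = Order.max 0 (Order.min 1 a).
Proof.
have [a0|a0] := ltP a 0.
  rewrite [RHS]max_l; last by rewrite ge_min (ltW a0) orbT.
  apply/eqP; rewrite eq_le Pr_ge0 andbT.
  have <- : Pr mu [set u | u j <= 0] = 0.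
    by rewrite /Pr Hmu.1// lexx ler01.
  apply: Pr_le; try exact: (mcoord (measurable_itv `]-oo, _])).
  - have := mcoord j (measurable_itv `]-oo, a]).
    by under eq_set do rewrite /= in_itv/=.
  - have := mcoord j (measurable_itv `]-oo, (0 : R)]).
    by under eq_set do rewrite /= in_itv/=.
  - by move=> u /= /le_trans; apply; exact: ltW.
have [a1|a1] := leP a 1.
  by rewrite max_r// /Pr Hmu.1// a0.
rewrite max_r ?ler01//.
apply/eqP; rewrite eq_le; apply/andP; split.
  apply: Pr_le1.
  have := mcoord j (measurable_itv `]-oo, a]).
  by under eq_set do rewrite /= in_itv/=.
have {1}<- : Pr mu [set u | u j <= 1] = 1.
  by rewrite /Pr Hmu.1// ler01 lexx.
apply: Pr_le.
- have := mcoord j (measurable_itv `]-oo, (1 : R)]).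
  by under eq_set do rewrite /= in_itv/=.
- have := mcoord j (measurable_itv `]-oo, a]).
  by under eq_set do rewrite /= in_itv/=.
- by move=> u /= /le_trans; apply; exact: ltW.
Qed.

Lemma mle j (a : R) : measurable [set u : space R | u j <= a].
Proof.
have := mcoord j (measurable_itv `]-oo, a]).
by under eq_set do rewrite /= in_itv/=.
Qed.

Lemma mlt j (a : R) : measurable [set u : space R | u j < a].
Proof.
have := mcoord j (measurable_itv `]-oo, a[).
by under eq_set do rewrite /= in_itv/=.
Qed.

Lemma law_ray s a : uniq s ->
  Pr mu (ray s a) = \prod_(j <- s) Pr mu [set u : space R | u j <= a j].
Proof.
move=> us.
exact: (@law_cyl s (fun j => `]-oo, a j]%classic) us (fun=> measurable_itv _)).
Qed.

(** Common form of all changes of randomness below: translation of the lattice ([sg]), rescaling of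
    one waiting variable and reflection of initial bits ([phi]). *)
Definition coordmap (sg : idx -> idx) (phi : idx -> R -> R) (u : space R) : space R :=
  fun j => phi j (u (sg j)).

Lemma measurable_coordmap sg phi : (forall j, measurable_fun setT (phi j)) ->
  measurable_fun setT (coordmap sg phi).
Proof.
move=> mphi; apply: measurable_space => j.
by apply: (measurableT_comp (mphi j)); exact: measurable_coord.
Qed.

Lemma coordmap_law (sg : idx -> idx) (phi : idx -> R -> R) : injective sg -> (forall j, measurable_fun setT (phi j)) ->
  (forall j a, Pr mu [set u : space R | phi j (u (sg j)) <= a] = Pr mu [set u | u j <= a]) ->
  forall B, measurable B -> Pr mu (coordmap sg phi @^-1` B) = Pr mu B.
Proof.
move=> isg mphi H B mB; rewrite /Pr.
rewrite (@map_law _ _ mu (coordmap sg phi) mu)//.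
- exact: measurable_coordmap.
- exact: probability_setT.
move=> s a us.
have mray : measurable (ray s a : set (space R)) by exact: measurable_ray.
have mpre : measurable (coordmap sg phi @^-1` (ray s a : set (space R))).
  rewrite -[X in measurable X]setTI.
  by apply: (measurable_coordmap sg mphi).
apply: etrans (PrE mu mpre) _; apply: etrans (esym (PrE mu mray)).
congr EFin.
pose A j := `]-oo, a j]%classic.
have mA j : measurable (A j) by exact: measurable_itv.
have mA' j : measurable (phi j @^-1` A j) by rewrite -[X in measurable X]setTI; exact: mphi.
rewrite law_ray//.
(* The constraint on coordinate [j] is carried to coordinate [sg j]: at [i] a preimage in [s] is
   looked for, unique by injectivity, and nothing is imposed if there is none. *)
pose A2 i := if [pick j : seq_sub s | sg (val j) == i] is Some j
  then phi (val j) @^-1` A (val j) else setT.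
have A2E j : j \in s -> A2 (sg j) = phi j @^-1` A j.
  move=> js; rewrite /A2; case: pickP => [k /eqP/isg ->//|/(_ (SeqSub js))/=].
  by rewrite eqxx.
have mA2 j : measurable (A2 j) by rewrite /A2; case: pickP.
have -> : coordmap sg phi @^-1` ray s a =
    [set u | forall j, j \in map sg s -> A2 j (u j)].
  apply/seteqP; split=> u /= K j.
    by case/mapP => i js ->; rewrite A2E//= /A/= in_itv/=; exact: K.
  move=> js; have := K (sg j) (map_f sg js).
  by rewrite A2E//= /A/= in_itv.
rewrite law_cyl ?map_inj_uniq// big_map.
apply: eq_big_seq => j js; rewrite -H; congr (Pr mu _).
by apply/seteqP; split=> u; rewrite /= A2E//= /A/= in_itv.
Qed.

Definition mix (I : pred idx) (u v : space R) : space R :=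
  fun j => if I j then u j else v j.

Lemma measurable_mix I : measurable_fun setT (fun p : space R * space R => mix I p.1 p.2).
Proof.
apply: measurable_space => j; rewrite /mix; case: (I j).
  by apply: (measurableT_comp (measurable_coord j)); exact: measurable_fst.
by apply: (measurableT_comp (measurable_coord j)); exact: measurable_snd.
Qed.

Lemma prod_law A B : measurable A -> measurable B ->
  ((mu \x mu) (A `*` B) = (Pr mu A * Pr mu B)%:E)%E.
Proof. by move=> mA mB; rewrite EFinM -!PrE//; exact: product_measure1E. Qed.

Lemma mix_law I B : measurable B ->
  ((mu \x mu) [set p : space R * space R | B (mix I p.1 p.2)] = mu B)%E.
Proof.
move=> mB; rewrite (@map_law _ _ (mu \x mu)%E (fun p => mix I p.1 p.2) mu)//.
- exact: measurable_mix.
- by have := prod_law measurableT measurableT; rewrite setXTT PrT mulr1; apply.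
move=> s a us.
have -> : (fun p => mix I p.1 p.2) @^-1` ray s a =
    ray [seq x <- s | I x] a `*` ray [seq x <- s | ~~ I x] a.
  apply/seteqP; split=> -[u v]/=.
    move=> K; split=> j; rewrite mem_filter => /andP[/= Ij js];
    by have := K j js; rewrite /mix/= ?Ij// (negbTE Ij).
  move=> [K1 K2] j js; rewrite /mix/=; case: ifP => Ij.
    by apply: K1; rewrite mem_filter Ij.
  by apply: K2; rewrite mem_filter /= Ij.
apply: etrans (prod_law (measurable_ray _ _) (measurable_ray _ _)) _.
rewrite PrE; last exact: measurable_ray.
rewrite !law_ray ?filter_uniq//; congr EFin.
by rewrite !big_filter [RHS](bigID I).
Qed.

Definition depends (I : pred idx) (B : set (space R)) : Prop :=
  forall u v, (forall j, I j -> u j = v j) -> B u -> B v.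

(* The law of [mix I u v], for independent [u] and [v], is that of a single
   configuration, which turns the independence of coordinates into that of the
   factors of a product space. *)
Lemma indep (I : pred idx) (G B C : set (space R)) :
  measurable G -> measurable B -> measurable C -> Pr mu G = 1 ->
  (forall u v, G u -> G v -> (forall j, I j -> u j = v j) -> B u -> B v) ->
  depends (predC I) C ->
  Pr mu (B `&` C) = Pr mu B * Pr mu C.
Proof.
move=> mG mB mC G1 dB dC.
have mBC := measurableI _ _ mB mC.
apply: EFin_inj; rewrite -prod_law// -PrE// -(mix_law I mBC).
(* Null set of the pairs for which the mixture or its first component leaves [G]; off it [dB]
   applies both ways between [mix I u v] and [u]. *)
pose N : set (space R * space R) := (fun p => mix I p.1 p.2) @^-1` (~` G) `|` (~` G `*` setT).
have mGc : measurable (~` G) by exact: measurableC.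
have mm (D : set (space R)) : measurable D -> measurable ((fun p => mix I p.1 p.2) @^-1` D).
  by move=> mD; rewrite -[X in measurable X]setTI; exact: measurable_mix.
have mN : measurable N.
  by apply: measurableU; [exact: mm|exact: measurableX].
have muGc : mu (~` G) = 0%E by rewrite PrE// PrC// G1 subrr.
have h1 : ((mu \x mu) ((fun p => mix I p.1 p.2) @^-1` (~` G)) <= 0)%E.
  by have := mix_law I mGc; rewrite muGc => <-.
have h2 : ((mu \x mu) (~` G `*` setT) <= 0)%E.
  by rewrite prod_law// PrC// G1 subrr mul0r.
have N0 : ((mu \x mu) N = 0)%E.
  apply/eqP; rewrite eq_le measure_ge0 andbT.
  apply: le_trans (measureU2 _ _ _) _ => //; first exact: mm.
    exact: measurableX.
  by rewrite -(adde0 0%E); apply: leeD; [exact: h1|exact: h2].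
have key (u v : space R) : ~ N (u, v) ->
   ((B `&` C) (mix I u v) <-> (B `*` C) (u, v)).
  move=> nN.
  have Gm : G (mix I u v) by apply: contrapT => ?; apply: nN; left.
  have Gu : G u by apply: contrapT => ?; apply: nN; right.
  split=> -[Hb Hc]; split => /=.
  - by apply: (dB _ _ Gm Gu) Hb => j Ij; rewrite /mix Ij.
  - by apply: dC Hc => j /= /negbTE Ij; rewrite /mix Ij.
  - by apply: (dB _ _ Gu Gm) Hb => j Ij; rewrite /mix Ij.
  - by apply: dC Hc => j /= /negbTE Ij; rewrite /mix Ij.
have le (X Y : set (space R * space R)) : measurable X -> measurable Y -> X `<=` Y `|` N ->
   ((mu \x mu) X <= (mu \x mu) Y)%E.
  move=> mX mY XY; apply: (@le_trans _ _ ((mu \x mu) (Y `|` N))%E).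
    by apply: le_measure => //; apply/mem_set => //; exact: measurableU.
  apply: le_trans (measureU2 _ _ _) _ => //.
  by rewrite -[leRHS]adde0; apply: leeD => //; rewrite -[leRHS]N0.
apply/eqP; rewrite eq_le; apply/andP; split; apply: le.
- exact: (mm _ mBC).
- exact: measurableX.
- by move=> [u v] H; have [?|nN] := pselect (N (u, v)); [right|left; apply/key].
- exact: measurableX.
- exact: (mm _ mBC).
- by move=> [u v] H; have [?|nN] := pselect (N (u, v)); [right|left; apply/key].
Qed.

(* Conditioned on [u j <= c], the coordinate [u j] is distributed as [c * u j]. *)
Lemma scale_law (j : idx) (c : R) B : 0 < c <= 1 -> measurable B ->
  c * Pr mu [set u | B (coordmap id (fun i r => if i == j then c * r else r) u)] =
  Pr mu (B `&` [set u | 0 <= u j <= c]).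
Proof.
Proof.
move=> c01 mB; have /andP[c0 c1] := c01.
have nz := gt_eqF c0.
pose phi i (r : R) := if i == j then c * r else r.
rewrite -/(coordmap id phi _).
have mphi i : measurable_fun setT (phi i).
  by rewrite /phi; case: (i == j); [exact: mulrl_measurable|exact: measurable_id].
have mT := measurable_coordmap id mphi.
have mpre D : measurable D -> measurable (coordmap id phi @^-1` D).
  by move=> mD; rewrite -[X in measurable X]setTI; exact: mT.
pose X : {mfun space R >-> space R} :=
  HB.pack (coordmap id phi) (isMeasurableFun.Build _ _ _ _ (coordmap id phi) mT).
have mD : measurable [set u : space R | 0 <= u j <= c].
  have := mcoord j (measurable_itv `[0, c]).
  by under eq_set do rewrite /= in_itv/=.
have mXB := mpre _ mB.
(* Both sides become finite measures of [B], not probabilities in general, and it suffices to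
   compare them on rays. *)
suff : mscale (NngNum (ltW c0)) (distribution mu X) B = mrestr mu mD B.
  rewrite /mscale /= /distribution /pushforward /mrestr PrE// -EFinM => H.
  by apply: EFin_inj; rewrite -PrE//; exact: measurableI.
apply: law_unique => //; last first.
  change (c%:E * distribution mu X setT < +oo)%E.
  by rewrite probability_setT mule1 ltry.
move=> s a us.
have mray : measurable (ray s a : set (space R)) by exact: measurable_ray.
have mXr := mpre _ mray.
change (c%:E * mu (coordmap id phi @^-1` ray s a) =
  mu (ray s a `&` [set u : space R | (0 <= u j <= c)%R]))%E.
apply: etrans (congr1 (mule c%:E) (PrE mu mXr)) _.
apply: etrans (esym (PrE mu (measurableI _ _ mray mD))).
rewrite -EFinM; congr EFin.
(* [j] heads the list whether or not it belongs to [s], so that its factor can be compared alone;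
   membership survives as a condition inside [A1] and [A2]. *)
pose t := [seq i <- s | i != j].
have ut : uniq (j :: t) by rewrite /= mem_filter eqxx/= filter_uniq.
pose A1 i : set R := if i == j then [set r | j \in s -> c * r <= a j] else `]-oo, a i]%classic.
pose A2 i : set R := if i == j then [set r | 0 <= r <= c /\ (j \in s -> r <= a j)]
  else `]-oo, a i]%classic.
have mA1 i : measurable (A1 i).
  rewrite /A1; case: ifP => // _.
  change (mP (fun r : R => j \in s -> c * r <= a j)); apply: mP_imp; first exact: mP_const.
  by apply: mP_le; [exact: mulrl_measurable|exact: measurable_cst].
have mA2 i : measurable (A2 i).
  rewrite /A2; case: ifP => // _.
  change (mP (fun r : R => (0 <= r <= c) /\ (j \in s -> r <= a j))); apply: mP_and.
    have := measurable_itv `[(0 : R), c].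
    by rewrite /mP; congr measurable; apply/seteqP; split=> r /=; rewrite in_itv.
  apply: mP_imp; first exact: mP_const.
  by apply: mP_le; [exact: measurable_id|exact: measurable_cst].
have tE i : i \in t = (i \in s) && (i != j) by rewrite mem_filter andbC.
have -> : coordmap id phi @^-1` ray s a = [set u : space R | forall i, i \in j :: t -> A1 i (u i)].
  apply/seteqP; split=> u /= K i.
    rewrite inE tE /A1 => /orP[/eqP->|/andP[js /negbTE ij]]; rewrite ?eqxx ?ij/=.
      by move=> /K; rewrite /coordmap /phi eqxx.
    by have := K i js; rewrite /coordmap /phi ij in_itv.
  move=> js; have := K i; rewrite inE tE js /coordmap /phi /A1.
  by case: (eqVneq i j) js => [->|ne] js /= /(_ isT); [exact|rewrite in_itv].
have -> : ray s a `&` [set u | 0 <= u j <= c] =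
    [set u : space R | forall i, i \in j :: t -> A2 i (u i)].
  apply/seteqP; split=> u /=.
    move=> [K Kc] i.
    rewrite inE tE /A2 => /orP[/eqP->|/andP[js /negbTE ij]]; rewrite ?eqxx ?ij/=.
      by split=> // /K.
    by have := K i js; rewrite in_itv.
  move=> K; split=> [i js|]; last first.
    by have := K j; rewrite inE eqxx /A2 eqxx => /(_ isT)[].
  have := K i; rewrite inE tE js /A2.
  by case: (eqVneq i j) js => [->|ne] js /= /(_ isT); [case=> _; exact|rewrite in_itv].
rewrite !law_cyl// !big_cons mulrA; congr (_ * _); last first.
  by apply: eq_big_seq => i; rewrite tE /A1 /A2 => /andP[_ /negbTE ->].
rewrite /A1 /A2 eqxx.
have nonneg b : Pr mu [set u : space R | 0 <= u j <= b] = Pr mu [set u | u j <= b].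
  have m1 : measurable [set u : space R | 0 <= u j <= b].
    have := mcoord j (measurable_itv `[0, b]).
    by under eq_set do rewrite /= in_itv/=.
  apply/eqP; rewrite eq_le; apply/andP; split.
    by apply: Pr_le => //; [exact: mle|move=> u /= /andP[]].
  apply: (@le_trans _ _ (Pr mu ([set u | 0 <= u j <= b] `|` [set u | u j <= 0]))).
    apply: Pr_le; [exact: mle|apply: measurableU => //; exact: mle|].
    by move=> u /= ub; have [u0|/ltW u0] := leP 0 (u j); [left; rewrite ub|right].
  apply: le_trans (Pr_leU _ _ _) _ => //; first exact: mle.
  by rewrite law_coord min_r ?ler01// maxxx addr0.
case: (boolP (j \in s)) => js; last first.
  rewrite (_ : [set u | _] = setT) ?PrT; last by apply/seteqP; split.
  rewrite (_ : [set u | _] = [set u : space R | 0 <= u j <= c]).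
    by rewrite nonneg law_coord mulr1 min_r// max_r// ltW.
  by apply/seteqP; split=> u /=; [case|].
rewrite (_ : [set u | _] = [set u : space R | u j <= a j / c]); last first.
  apply/seteqP; split=> u /=; rewrite ler_pdivlMr// mulrC; first exact.
  by move=> + _.
rewrite (_ : [set u | _ /\ _] = [set u : space R | 0 <= u j <= Order.min c (a j)]); last first.
  apply/seteqP; split=> u /=; rewrite le_min.
    by move=> [/andP[-> ->] /(_ isT) ->].
  by move=> /and3P[-> -> ->].
rewrite nonneg !law_coord.
have [a0|a0] := leP (a j) 0.
  rewrite [LHS](_ : _ = 0).
    by rewrite max_l// ge_min ge_min a0 !orbT.
  by rewrite max_l ?mulr0// ge_min pmulr_lle0 ?invr_gt0// a0 orbT.
have [ac|ac] := leP (a j) c.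
  rewrite (min_r (_ : a j / c <= 1)) ?ler_pdivrMr ?mul1r//.
  rewrite max_r ?divr_ge0 ?ltW// mulrC divfK ?nz//.
  by rewrite min_r ?(le_trans ac)// max_r// ltW.
rewrite (min_l (_ : 1 <= a j / c)) ?ler_pdivlMr ?mul1r ?ltW//.
by rewrite max_r ?ler01// mulr1 min_r// max_r// ltW.
Qed.

End Laws.

(** * The graphical construction *)

Section Update.
Variable F : nat.
Implicit Types u v w : opinion F.

Definition flip (i : 'I_F) u : opinion F := [ffun j => if j == i then ~~ u j else u j].

Definition xor w u : opinion F := [ffun j => w j (+) u j].

Definition xor0 : opinion F := [ffun=> false].

Lemma hammingE u v : hamming u v = #|[set i | u i != v i]%SET|.
Proof.
by apply: eq_card => i; rewrite finset.inE; apply/idP/idP => [/set_mem|?]//; exact/mem_set.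
Qed.

Lemma hammingC u v : hamming u v = hamming v u.
Proof. by rewrite !hammingE; apply: eq_card => i; rewrite !finset.inE eq_sym. Qed.

Lemma hamming_eq0 u v : (hamming u v == 0%N) = (u == v).
Proof.
rewrite hammingE cards_eq0; apply/eqP/eqP => [H|->].
  apply/ffunP => i; apply/eqP/negPn/negP => ne.
  by have := finset.in_set0 i; rewrite -H finset.inE ne.
by apply/setP => i; rewrite !finset.inE eqxx.
Qed.

Lemma hamming_le u v : (hamming u v <= F)%N.
Proof. by rewrite hammingE -[X in (_ <= X)%N]card_ord max_card. Qed.

Lemma hamming_xor w u v : hamming (xor w u) (xor w v) = hamming u v.
Proof. by rewrite !hammingE; apply: eq_card => i; rewrite !finset.inE !ffunE (inj_eq (@addbI _)). Qed.

Lemma hamming_flip i u v : hamming (flip i u) v =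
  if u i != v i then (hamming u v).-1 else (hamming u v).+1.
Proof.
rewrite !hammingE; case: ifP => uv.
  rewrite (cardsD1 i [set j | u j != v j]%SET) finset.inE uv add1n /=.
  apply: eq_card => j; rewrite !finset.inE ffunE.
  case: (eqVneq j i) => [->|//]; move: uv.
  by case: (u i); case: (v i).
rewrite (cardsD1 i [set j | flip i u j != v j]%SET) finset.inE ffunE eqxx.
have -> : (~~ u i != v i) by move: uv; case: (u i); case: (v i).
rewrite add1n; congr S; apply: eq_card => j; rewrite !finset.inE ffunE.
by case: (eqVneq j i) => [->|//]; rewrite uv.
Qed.

Lemma flip_neq i u : flip i u != u.
Proof. by rewrite -hamming_eq0 hamming_flip eqxx. Qed.

Lemma flip_xor i w u : flip i (xor w u) = xor w (flip i u).
Proof. by apply/ffunP => j; rewrite !ffunE; case: eqP => // _; rewrite addbN. Qed.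

Lemma xorK w : involutive (xor w).
Proof. by move=> u; apply/ffunP => j; rewrite !ffunE addbA addbb. Qed.

Lemma xor0E u : xor xor0 u = u.
Proof. by apply/ffunP => j; rewrite !ffunE. Qed.

Variables (R : realType) (theta : nat).
Implicit Types r : R.

Lemma size_disagree u v : size (disagree u v) = hamming u v.
Proof. rewrite hammingE /disagree size_filter -sum1_card -sum1_count big_enum_cond /=.
by apply: eq_bigl => i; rewrite finset.inE. Qed.

Lemma deff_update_id u v r : ~~ (1 <= hamming u v <= theta)%N ->
  deff_update theta u v r = u.
Proof. by rewrite /deff_update => /negbTE ->. Qed.

Lemma deff_update_flip u v r : (1 <= hamming u v <= theta)%N ->
  exists2 i, u i != v i & deff_update theta u v r = flip i u.
Proof.
move=> H; rewrite /deff_update H.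
have := size_disagree u v; case E : (disagree u v) => [|i0 D] /= sz.
  by move: H; rewrite -sz.
(* The default of [nth] is the first disagreeing issue, so an index out of range still selects a
   disagreement and the claim holds for every real [r]. *)
set i := nth _ _ _.
have : i \in disagree u v.
  rewrite E /i; set n := Num.truncn _.
  have [lt|ge] := ltnP n (size (i0 :: D)); first exact: mem_nth.
  by rewrite nth_default// mem_head.
rewrite mem_filter => /andP[ne _]; exists i => //.
apply/ffunP => j; rewrite !ffunE; case: eqP => // ->.
by move: ne; case: (u i); case: (v i).
Qed.

(** The list of disagreements is unchanged by a common flip, so the same [r] selects the same issue:
    the symmetry behind every coupling below. *)
Lemma deff_update_xor w u v r :
  deff_update theta (xor w u) (xor w v) r = xor w (deff_update theta u v r).
Proof.
have DE : disagree (xor w u) (xor w v) = disagree u v.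
  by apply: eq_filter => i; rewrite !ffunE (inj_eq (@addbI _)).
rewrite /deff_update hamming_xor DE; case: ifP => // _.
case: (disagree u v) => // i0 D; apply/ffunP => j; rewrite !ffunE.
by case: eqP => // ->.
Qed.

End Update.

(** * Ring times, well-founded past and values after each ring *)

Section Rings.
Variable R : realType.
Implicit Types (u : idx -> R) (x y z : int) (k l m n : nat).

(** Pathwise regularity that makes the infinite system computable. The last two fields provide, on
    either side of each site, a site silent up to time [T]; no influence crosses it before [T]. *)
Record good u : Prop := Good {
  good_wait : forall x n, 0 < u (Wait x n) < 1;
  good_inf : forall x (T : nat), exists n, T%:R < ring_time u x n;
  good_neq : forall x y m n, x != y -> ring_time u x m != ring_time u y n;
  good_silR : forall x (T : nat), exists n : nat, T%:R < ring_time u (x + n%:Z) 0;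
  good_silL : forall x (T : nat), exists n : nat, T%:R < ring_time u (x - n%:Z) 0 }.

Lemma ring_timeS u x n : ring_time u x n.+1 = ring_time u x n + - ln (u (Wait x n.+1)).
Proof. by rewrite /ring_time big_ord_recr. Qed.

Lemma ring_time0 u x : ring_time u x 0 = - ln (u (Wait x 0)).
Proof. by rewrite /ring_time big_ord_recr /= big_ord0 add0r. Qed.

(** Index of the first ring at or after [s], hence the number of rings strictly before [s] on good
    configurations ([nringsP]). The default 0 keeps it total, and [nrings_fiber] records it so that
    measurability holds on the whole space. *)
Definition nrings u x (s : R) : nat :=
  xget 0%N [set n | s <= ring_time u x n /\ forall m, (m < n)%N -> ring_time u x m < s].

Lemma nrings_fiber u x (s : R) n : nrings u x s = n <->
  (s <= ring_time u x n /\ forall m, (m < n)%N -> ring_time u x m < s) \/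
  (n = 0%N /\ forall n', ~ (s <= ring_time u x n' /\ forall m, (m < n')%N -> ring_time u x m < s)).
Proof.
rewrite /nrings; case: xgetP => [k _ Hk|nH].
  split=> [<-|[Hn|[_ /(_ k)//]]]; first by left.
  case: Hk Hn => a b [c e]; case: (ltngtP k n) => // kn.
    by have := lt_le_trans (e _ kn) a; rewrite ltxx.
  by have := lt_le_trans (b _ kn) c; rewrite ltxx.
split=> [<-|[Hn|[->//]]]; first by right.
by case: (nH n).
Qed.

(** One step of the influence relation between pairs of a site and a ring index: the outcome of a
    ring depends only on earlier rings at the same or an adjacent site. *)
Definition before u (e f : int * nat) : Prop :=
  ring_time u e.1 e.2 < ring_time u f.1 f.2 /\
  (e.1 = f.1 \/ e.1 = f.1 + 1 \/ e.1 = f.1 - 1).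

Section Good.
Variable u : idx -> R.
Hypothesis gu : good u.

Lemma wait_gt0 x n : 0 < - ln (u (Wait x n)).
Proof. by rewrite oppr_gt0 ln_lt0// good_wait. Qed.

Lemma ring_time_lt x m n : (m < n)%N -> ring_time u x m < ring_time u x n.
Proof.
elim: n => // n IH; rewrite ltnS leq_eqVlt ring_timeS => /orP[/eqP->|/IH H].
  by rewrite ltrDl wait_gt0.
by apply: lt_trans H _; rewrite ltrDl wait_gt0.
Qed.

Lemma ring_time_le x m n : (m <= n)%N -> ring_time u x m <= ring_time u x n.
Proof.
by rewrite leq_eqVlt => /orP[/eqP->//|mn]; exact/ltW/ring_time_lt.
Qed.

Lemma ring_time_gt0 x n : 0 < ring_time u x n.
Proof.
apply: lt_le_trans (ring_time_le x (leq0n n)).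
by rewrite ring_time0 wait_gt0.
Qed.

Lemma nringsP x (s : R) n : (n < nrings u x s)%N = (ring_time u x n < s).
Proof.
have [Tn sT] := exists_nat_gt (s).
have [k Hk] := good_inf gu x Tn.
have ex : exists n, s <= ring_time u x n.
  by exists k; exact: ltW (lt_trans sT Hk).
have [j sj jmin] := ex_minnP ex.
have -> : nrings u x s = j.
  apply/nrings_fiber; left; split=> // m mj; rewrite ltNge; apply/negP => /jmin.
  by rewrite leqNgt mj.
apply/idP/idP => [nj|]; last first.
  apply: contraTltn => jn; rewrite -leNgt; apply: le_trans sj _; exact: ring_time_le.
by rewrite ltNge; apply/negP => /jmin; rewrite leqNgt nj.
Qed.

Lemma nrings_mono x (s t : R) : s <= t -> (nrings u x s <= nrings u x t)%N.
Proof.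
move=> st; rewrite leqNgt; apply/negP; rewrite nringsP => /lt_le_trans/(_ st).
by rewrite -nringsP ltnn.
Qed.

Lemma nrings_ring x n : nrings u x (ring_time u x n) = n.
Proof.
apply/eqP; rewrite eqn_leq; apply/andP; split; rewrite leqNgt; apply/negP.
  by rewrite nringsP ltxx.
by move=> /(ring_time_lt x); rewrite -nringsP ltnn.
Qed.

Lemma nrings0 x : nrings u x 0 = 0%N.
Proof.
apply/eqP; rewrite -leqn0 leqNgt nringsP -leNgt; exact/ltW/ring_time_gt0.
Qed.

(** A descending chain from [(x, k)] stays before time [T], hence strictly between two sites silent
    up to [T]. The number [M] of rings of this finite block before the current ring drops strictly
    at each step, because the later ring counts the earlier one. *)
Lemma before_wf : well_founded (before u).
Proof.
move=> [x k].
have [T tT] := exists_nat_gt (ring_time u x k).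
have [n1 s1] := good_silL gu x T; have [n2 s2] := good_silR gu x T.
have n1p : (0 < n1)%N.
  rewrite lt0n; apply/negP => /eqP n0; move: s1; rewrite n0 subr0 => /(lt_trans tT).
  by rewrite ltNge ring_time_le.
have n2p : (0 < n2)%N.
  rewrite lt0n; apply/negP => /eqP n0; move: s2; rewrite n0 addr0 => /(lt_trans tT).
  by rewrite ltNge ring_time_le.
pose M (s : R) := (\sum_(i < n1 + n2) nrings u (x - n1%:Z + i%:Z) s)%N.
suff H c i l : (i < n1 + n2)%N -> (0 < i)%N ->
    ring_time u (x - n1%:Z + i%:Z) l < T%:R ->
    (M (ring_time u (x - n1%:Z + i%:Z) l) < c)%N ->
    Acc (before u) (x - n1%:Z + i%:Z, l).
  have := H (M (ring_time u x k)).+1 n1 k; rewrite subrK; apply=> //.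
  by rewrite -[X in (X < _)%N]addn0 ltn_add2l.
elim: c i l => [i l _ _ _|c IH i l iN i0 lT Mc]; first by rewrite ltn0.
constructor => -[z l'] [/= zt zi].
have zT := lt_trans zt lT.
have [i' zE] : exists i' : nat, z = x - n1%:Z + i'%:Z.
  by case: zi => [|[]] ->; [exists i|exists i.+1|exists i.-1]; lia.
subst z.
have i'0 : (0 < i')%N.
  rewrite lt0n; apply/negP => /eqP i'0; move: zT; rewrite i'0 addr0 => /(fun h => lt_trans h s1).
  by rewrite ltNge ring_time_le.
have i'N : (i' < n1 + n2)%N.
  rewrite ltnNge; apply/negP => i'N.
  have {}i'N : i' = (n1 + n2)%N by lia.
  move: zT; rewrite i'N; have -> : x - n1%:Z + (n1 + n2)%N%:Z = x + n2%:Z by lia.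
  by move=> /(fun h => lt_trans h s2); rewrite ltNge ring_time_le.
apply: IH => //; rewrite -ltnS; apply: leq_trans Mc; rewrite ltnS /M.
rewrite (bigD1 (Ordinal i'N))//= [X in (_ < X)%N](bigD1 (Ordinal i'N))//=.
rewrite -addSn; apply: leq_add; last by apply: leq_sum => j _; exact/nrings_mono/ltW.
by rewrite nrings_ring nringsP.
Qed.

Lemma ring_ind (Q : int -> nat -> Prop) :
  (forall x k, (forall z l, ring_time u z l < ring_time u x k ->
     z = x \/ z = x + 1 \/ z = x - 1 -> Q z l) -> Q x k) ->
  forall x k, Q x k.
Proof.
move=> H x k.
suff : Acc (before u) (x, k) -> Q (x, k).1 (x, k).2 by apply; exact: before_wf.
elim=> -[{}x {}k] _ IH; apply: H => z l zl zx.
by apply: (IH (z, l)); split.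
Qed.

Lemma nbrP x n : ring_nbr u x n = x + 1 \/ ring_nbr u x n = x - 1.
Proof. by rewrite /ring_nbr; case: ifP; [left|right]. Qed.

End Good.

Section Values.
Variables (F theta : nat).

(* Value of [x] after its [k]-th ring, unfolding the past up to depth [m]. *)
Fixpoint ev m u x k : opinion F :=
  match m, k with
  | m'.+1, k'.+1 =>
      deff_update theta (ev m' u x k')
        (ev m' u (ring_nbr u x k') (nrings u (ring_nbr u x k') (ring_time u x k')))
        (u (Iss x k'))
  | _, _ => init_opinion F u x
  end.

Definition stable u x k v := exists m0, forall m, (m0 <= m)%N -> ev m u x k = v.

(** Eventual value of [ev] in its depth, which exists on good configurations ([stable_val]). The
    default only makes it total, and [val_fiber] accounts for it in the measurability proof. *)
Definition val_at u x k : opinion F := xget (xor0 F) [set v | stable u x k v].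

Lemma stable_uniq u x k v w : stable u x k v -> stable u x k w -> v = w.
Proof.
move=> [m Hm] [m' Hm'].
by rewrite -(Hm (maxn m m')) ?leq_maxl// (Hm' (maxn m m')) ?leq_maxr.
Qed.

Lemma stableE u x k v : stable u x k v -> val_at u x k = v.
Proof.
move=> H; apply: xget_unique => // w Hw; exact: stable_uniq Hw H.
Qed.

Lemma val_fiber u x k v : val_at u x k = v <->
  stable u x k v \/ (v = xor0 F /\ forall w, ~ stable u x k w).
Proof.
rewrite /val_at; case: xgetP => [w _ Hw|nH].
  by split=> [<-|[/(stable_uniq Hw)//|[_ /(_ w)]//]]; left.
split=> [<-|[Hv|[->//]]]; first by right.
by case: (nH v).
Qed.

Lemma stable0 u x : stable u x 0 (init_opinion F u x).
Proof. by exists 0%N => -[]. Qed.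

Lemma val0 u x : val_at u x 0 = init_opinion F u x.
Proof. exact/stableE/stable0. Qed.

(** Left limit at time [s], since [nrings] counts the rings strictly before [s]. *)
Definition left_state u (s : R) x : opinion F := val_at u x (nrings u x s).

Section GoodValues.
Variable u : idx -> R.
Hypothesis gu : good u.

Lemma stable_val x k : stable u x k (val_at u x k).
Proof.
suff H : forall x k, exists v, stable u x k.+1 v.
  case: k => [|k]; first by rewrite val0; exact: stable0.
  by have [v Hv] := H x k; rewrite (stableE Hv).
apply: (ring_ind gu) => {}x {}k IH.
have [v [m Hm]] : exists v, stable u x k v.
  case: k IH => [|k] IH; first by exists (init_opinion F u x); exact: stable0.
  by apply: IH; [exact: ring_time_lt|left].
set y := ring_nbr u x k; set n := nrings u y (ring_time u x k).
have [v' [m' Hm']] : exists v, stable u y n v.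
  case E : n => [|n']; first by exists (init_opinion F u y); exact: stable0.
  apply: IH; first by rewrite -nringsP// -/n E.
  by case: (nbrP u x k) => <-; right; [left|right].
exists (deff_update theta v v' (u (Iss x k))), (maxn m m').+1 => -[//|j].
by rewrite ltnS geq_max => /andP[/Hm mj /Hm' mj'] /=; rewrite mj mj'.
Qed.

Lemma valS x k : val_at u x k.+1 =
  deff_update theta (val_at u x k) (left_state u (ring_time u x k) (ring_nbr u x k))
    (u (Iss x k)).
Proof.
apply: stableE; have [m Hm] := stable_val x k.
have [m' Hm'] := stable_val (ring_nbr u x k) (nrings u (ring_nbr u x k) (ring_time u x k)).
exists (maxn m m').+1 => -[//|j].
by rewrite ltnS geq_max => /andP[/Hm mj /Hm' mj'] /=; rewrite mj mj'.
Qed.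

Lemma left_state_ring x k : left_state u (ring_time u x k) x = val_at u x k.
Proof. by rewrite /left_state nrings_ring. Qed.

(** Uniqueness of the process. Between two rings of [x] the path is constant, so only ring times
    matter, by induction on [before]. There the jump clause has to be read at a time just before the
    ring at which the induction hypothesis already describes both [x] and its neighbour. *)
Lemma path_val (e : R -> int -> opinion F) : deffuant_path F theta u e ->
  forall x k (s : R), 0 <= s -> (forall l, (l < k)%N -> ring_time u x l <= s) ->
    s < ring_time u x k -> e s x = val_at u x k.
Proof.
move=> [e0 [econst ejump]].
pose Q x k := e (ring_time u x k) x = val_at u x k.+1.
have step x k (s : R) : (forall l, (l < k)%N -> Q x l) -> 0 <= s ->
    (forall l, (l < k)%N -> ring_time u x l <= s) -> s < ring_time u x k ->
    e s x = val_at u x k.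
  move=> HQ s0 sk ks.
  have nor (t : R) : (forall l, (l < k)%N -> ring_time u x l <= t) ->
      forall n, ~ (t < ring_time u x n <= s).
    move=> tl n /andP[tn ns].
    have [nk|kn] := ltnP n k; first by have := tl n nk; rewrite leNgt tn.
    by have := lt_le_trans ks (ring_time_le gu x kn); rewrite ltNge ns.
  case: k HQ sk ks nor => [|k] HQ sk ks nor.
    by rewrite val0 -e0; apply: econst; [rewrite lexx|exact: nor].
  rewrite -HQ//; apply: econst; last by apply: nor => l; rewrite ltnS; exact: ring_time_le.
  by rewrite sk// (ltW (ring_time_gt0 gu _ _)).
suff HQ : forall x k, Q x k by move=> x k s; apply: step.
apply: (ring_ind gu) => x k IH; rewrite /Q.
have [eps eps0 Heps] := ejump x k.
set y := ring_nbr u x k in Heps *; set t := ring_time u x k in Heps *.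
set n := nrings u y t.
pose bx := if k is k'.+1 then ring_time u x k' else 0.
pose by_ := if n is n'.+1 then ring_time u y n' else 0.
(* Any [s] strictly between [a] and [t] lies in the window of the jump clause and after the previous
   rings of [x] and of [y]; 0 replaces a missing previous ring. *)
pose a := Order.max (Order.max 0 (t - eps)) (Order.max bx by_).
have t0 : 0 < t by exact: ring_time_gt0.
have bxt : bx < t by rewrite /bx /t; case: (k) => [|k']; [exact: ring_time_gt0|exact: ring_time_lt].
have byt : by_ < t.
  by rewrite /by_; case E : n => [//|n']; rewrite -nringsP// -/n E.
have at_ : a < t.
  by rewrite /a !gt_max t0 bxt byt ltrBlDr ltrDl eps0.
pose s := (a + t) / 2.
have as_ : a < s by rewrite /s; lra.
have st : s < t by rewrite /s; lra.
have : [&& 0 < s, t - eps < s, bx < s & by_ < s].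
  by move: as_; rewrite {1}/a !gt_max -!andbA.
move=> /and4P[s0 es bxs bys].
rewrite (Heps s) ?es// valS -/y -/t; congr deff_update.
  apply: step => //; first by move=> l lk; apply: IH; [exact: ring_time_lt|left].
    exact: ltW.
  move=> l; move: bxs; rewrite /bx; case: (k) => // k' bxs.
  by rewrite ltnS => lk'; apply: le_trans (ring_time_le gu x lk') (ltW bxs).
rewrite /left_state -/n; apply: step; last 1 first.
- apply: lt_le_trans st _; rewrite leNgt -nringsP// -/n ltnn//.
- move=> l ln; apply: IH; first by rewrite -/t -nringsP.
  by rewrite /y; case: (nbrP u x k) => ->; right; [left|right].
- exact: ltW.
- move=> l; move: bys; rewrite /by_; case: (n) => // n' bys.
  by rewrite ltnS => ln'; apply: le_trans (ring_time_le gu y ln') (ltW bys).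
Qed.

Lemma path_fixed (e : R -> int -> opinion F) x v K : deffuant_path F theta u e ->
  (forall k, (K <= k)%N -> val_at u x k = v) ->
  exists t0 : R, forall t, t0 <= t -> e t x = v.
Proof.
move=> pe HK; exists (ring_time u x K) => t tK.
have [T tT] := exists_nat_gt (t).
have [j jT] := good_inf gu x T.
have ex : exists n, t < ring_time u x n by exists j; exact: lt_trans jT.
have [n tn nmin] := ex_minnP ex.
rewrite (path_val pe (k := n))//; first 1 last.
- exact: le_trans (ltW (ring_time_gt0 gu x K)) tK.
- by move=> l ln; rewrite leNgt; apply/negP => /nmin; rewrite leqNgt ln.
apply: HK; rewrite leqNgt; apply/negP => nK.
have := lt_trans tn (ring_time_lt gu x nK); rewrite ltNge tK //.
Qed.

End GoodValues.
End Values.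
End Rings.

(** * Coupling *)

Section Coupling.
Variables (R : realType) (F theta : nat) (u u' : idx -> R) (s : R) (w : int -> opinion F).
Hypotheses (gu : good u) (gu' : good u').

Hypothesis same_rings : forall z j,
  ring_time u z j <= s \/ ring_time u' z j <= s ->
  [/\ ring_time u' z j = ring_time u z j, ring_nbr u' z j = ring_nbr u z j &
      u' (Iss z j) = u (Iss z j)].

Hypothesis same_init : forall z, init_opinion F u' z = xor (w z) (init_opinion F u z).

Let V x k := val_at F theta u x k.
Let L t x := left_state F theta u t x.

Hypothesis blocked : forall z j, ring_time u z j <= s ->
  w z = w (ring_nbr u z j) \/
  (~~ (1 <= hamming (V z j) (L (ring_time u z j) (ring_nbr u z j)) <= theta)%N /\
   ~~ (1 <= hamming (xor (w z) (V z j))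
        (xor (w (ring_nbr u z j)) (L (ring_time u z j) (ring_nbr u z j))) <= theta)%N).

Lemma coupling_nrings z t : t <= s -> nrings u' z t = nrings u z t.
Proof.
move=> ts; apply/eqP; rewrite eqn_leq; apply/andP; split; rewrite leqNgt; apply/negP.
  rewrite nringsP// => zt.
  have [e _ _] := same_rings (or_intror (le_trans (ltW zt) ts)).
  by move: zt; rewrite e -nringsP// ltnn.
rewrite nringsP// => zt.
have [e _ _] := same_rings (or_introl (le_trans (ltW zt) ts)).
by move: zt; rewrite -e -nringsP// ltnn.
Qed.

(** Each ring preserves the relation: with equal twists at both sites by [deff_update_xor],
    otherwise because the pair is inactive in both systems. With [w] zero it says that the past
    depends only on past randomness; a constant [w] is a global flip; a step function [w] flips one
    side of a blocked edge. *)
Lemma coupling_val z j : ring_time u z j <= s ->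
  val_at F theta u' z j.+1 = xor (w z) (V z j.+1).
Proof.
move: z j; apply: (ring_ind gu) => z j IH zs.
have [e1 e2 e3] := same_rings (or_introl zs).
have val k : (k <= j)%N -> val_at F theta u' z k = xor (w z) (V z k).
  case: k => [_|k kj]; first by rewrite /V !val0.
  apply: IH; [exact: ring_time_lt|by left|].
  by apply: le_trans zs; exact/ltW/ring_time_lt.
rewrite valS// e1 e2 e3 val// /V valS// -/(V z j).
set y := ring_nbr u z j; set t := ring_time u z j.
have -> : left_state F theta u' t y = xor (w y) (L t y).
  rewrite /left_state coupling_nrings// /L /left_state.
  case E : (nrings u y t) => [|n]; first by rewrite !val0.
  have yt : ring_time u y n < t by rewrite -nringsP// E.
  apply: IH => //; last exact: le_trans (ltW yt) zs.
  by rewrite /y; case: (nbrP u z j) => ->; right; [left|right].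
have [wE|[b1 b2]] := blocked zs; first by rewrite -/y -wE deff_update_xor.
by rewrite !deff_update_id.
Qed.

Lemma coupling_left z t : t <= s ->
  left_state F theta u' t z = xor (w z) (L t z).
Proof.
move=> ts; rewrite /L /left_state coupling_nrings//.
case E : (nrings u z t) => [|n]; first by rewrite !val0.
have zt : ring_time u z n < t by rewrite -nringsP// E.
by apply: coupling_val; exact: le_trans (ltW zt) ts.
Qed.

End Coupling.

(** * Measurability of ring times and values *)

Lemma measurable_ring (R : realType) x n :
  measurable_fun setT (fun u : space R => ring_time u x n).
Proof.
apply: measurable_sum => i; apply: measurable_funN.
exact: (measurableT_comp (@measurable_ln R) (measurable_coord _)).
Qed.

Ltac measfun := first [ assumption | exact: measurable_cst | exact: measurable_coord
  | exact: measurable_ring | apply: measurable_funD; measfun ].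

Ltac meas := first [ assumption | exact: mP_const
  | apply: mP_and; meas | apply: mP_andb; meas | apply: mP_or; meas
  | apply: mP_lt; measfun | apply: mP_le; measfun | apply: mP_eq; measfun
  | apply: mP_not; meas | apply: mP_imp; meas
  | apply: mP_all => ?; meas | apply: mP_ex => ?; meas
  | match goal with |- measurable ?A => change (mP A); rewrite /mkset; meas end ].

Section MeasurableValues.
Variable R : realType.
Let S : measurableType _ := space R.

Lemma mfib_nrings y (f : S -> R) : measurable_fun setT f ->
  mfib (fun u : S => nrings u y (f u)).
Proof.
move=> mf n.
apply: (mP_ext (fun u : S => iff_sym (nrings_fiber u y (f u) n))).
by meas.
Qed.

Lemma mfib_nbr x k : mfib (fun u : S => ring_nbr u x k).
Proof.
apply: (mfib_comp (fun b : bool => if b then x + 1 else x - 1)).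
apply: mfib_bool; apply: mP_lt; [exact: measurable_coord|exact: measurable_cst].
Qed.

Lemma mfib_init F x : mfib (fun u : S => init_opinion F u x).
Proof.
move=> v; apply: (@mP_ext _ _ (fun u : S => forall i : 'I_F, (u (Init x i) < 2^-1) = v i)).
  move=> u; split=> [H|<- i]; last by rewrite ffunE.
  by apply/ffunP => i; rewrite ffunE.
apply: mP_all => i; apply: mfib_bool.
apply: mP_lt; [exact: measurable_coord|exact: measurable_cst].
Qed.

Lemma mfib_truncn d (T : measurableType d) (f : T -> R) : measurable_fun setT f ->
  mfib (fun t => Num.truncn (f t)).
Proof.
move=> mf n.
apply: (@mP_ext _ _ (fun t => (f t < 0 /\ n = 0%N) \/ (0 <= f t /\ (n%:R <= f t /\ f t < n.+1%:R)))).
  move=> t; split=> [[[f0 ->]|[f0 [nf fn]]]|<-].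
  - by rewrite truncn_floor (lt_geF f0).
  - by apply/eqP; rewrite truncn_eq// nf fn.
  - have [f0|f0] := ltP (f t) 0.
      by left; split=> //; rewrite truncn_floor (lt_geF f0).
    by right; have /andP[? ?] := truncn_itv f0.
by meas.
Qed.

Lemma mfib_deff F theta (a b : opinion F) j :
  mfib (fun u : S => deff_update theta a b (u j)).
Proof.
rewrite /deff_update; case E0 : (1 <= hamming a b <= theta)%N; last exact: mfib_const.
case E : (disagree a b) => [|i0 D]; first exact: mfib_const.
pose h (n : nat) : opinion F := [ffun j => if j == nth i0 (i0 :: D) n then b (nth i0 (i0 :: D) n) else a j].
apply: (mfib_comp (f := fun u : S => Num.truncn (u j * (size (i0 :: D))%:R)) h).
apply: mfib_truncn; apply: measurable_funM; [exact: measurable_coord|exact: measurable_cst].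
Qed.

Variables (F theta : nat).

Lemma mfib_ev m x k : mfib (fun u : S => ev F theta m u x k).
Proof.
elim: m x k => [|m IH] x [|k] /=; try exact: mfib_init.
apply: (mfib_bind (f := fun u : S => ring_nbr u x k)
  (h := fun y u => deff_update theta (ev F theta m u x k)
     (ev F theta m u y (nrings u y (ring_time u x k))) (u (Iss x k)))); first exact: mfib_nbr.
move=> y.
apply: (mfib_bind (f := fun u : S => nrings u y (ring_time u x k))
  (h := fun n u => deff_update theta (ev F theta m u x k)
     (ev F theta m u y n) (u (Iss x k)))).
  by apply: mfib_nrings; exact: measurable_ring.
move=> n.
apply: (mfib_bind (f := fun u : S => ev F theta m u x k)
  (h := fun a u => deff_update theta a (ev F theta m u y n) (u (Iss x k)))); first exact: IH.
move=> a; apply: (mfib_bind (f := fun u : S => ev F theta m u y n)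
  (h := fun b u => deff_update theta a b (u (Iss x k)))); first exact: IH.
by move=> b; exact: mfib_deff.
Qed.

Lemma mfib_val x k : mfib (fun u : S => val_at F theta u x k).
Proof.
have mst (v : opinion F) : mP (fun u : S => stable theta u x k v).
  apply: mP_ex => m0; apply: mP_all => m; apply: mP_imp; first exact: mP_const.
  exact: mfib_ev.
move=> v; apply: (mP_ext (fun u : S => iff_sym (val_fiber theta u x k v))).
apply: mP_or => //; apply: mP_and; first exact: mP_const.
by apply: mP_all => m; apply: mP_not.
Qed.

Lemma mP_val_eq x x' k k' : mP (fun u : S => val_at F theta u x k = val_at F theta u x' k').
Proof. by apply: (mP_pred2 (fun a b => a = b)); exact: mfib_val. Qed.

Lemma mfib_left (f : S -> R) x : measurable_fun setT f ->
  mfib (fun u : S => left_state F theta u (f u) x).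
Proof.
move=> mf; apply: (mfib_bind (f := fun u : S => nrings u x (f u))
  (h := fun n u => val_at F theta u x n)); first exact: mfib_nrings.
by move=> n; exact: mfib_val.
Qed.

Lemma mP_good : mP (fun u : S => good u).
Proof.
apply: (@mP_ext _ _ (fun u : S =>
  (forall x n, 0 < u (Wait x n) /\ u (Wait x n) < 1) /\
  ((forall x (T : nat), exists n, T%:R < ring_time u x n) /\
  ((forall x y m n, x != y -> ~ ring_time u x m = ring_time u y n) /\
  ((forall x (T : nat), exists n : nat, T%:R < ring_time u (x + n%:Z) 0) /\
  (forall x (T : nat), exists n : nat, T%:R < ring_time u (x - n%:Z) 0)))))).
  move=> u; split=> [[H1 [H2 [H3 [H4 H5]]]]|[H1 H2 H3 H4 H5]].
    split=> // [x n|x y m n xy]; first by apply/andP; exact: H1.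
    by apply/eqP; exact: H3.
  split; [move=> x n; exact/andP|split=> //; split=> //].
  by move=> x y m n xy; exact/eqP/H3.
by meas.
Qed.

Lemma measurable_good : measurable [set u : S | good u].
Proof. exact: mP_good. Qed.

End MeasurableValues.

Arguments measurable_good R : clear implicits.

(** * Almost sure regularity of the clocks *)

Section GoodAlmostSurely.
Variables (R : realType) (mu : probability (space R) R).
Hypothesis Hmu : uniform_law mu.
Let S : measurableType _ := space R.

Lemma coord_in01 j : Pr mu [set u : S | 0 < u j /\ u j < 1] = 1.
Proof.
have mA : measurable [set u : S | 0 < u j /\ u j < 1].
  by meas.
apply/eqP; rewrite eq_le Pr_le1//=; apply/ler_addgt0Pr => e e0.
pose e' := Order.min e 1.
have e'0 : 0 < e' by rewrite lt_min e0 ltr01.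
have e'1 : e' <= 1 by rewrite ge_min lexx orbT.
apply: (@le_trans _ _ (Pr mu [set u : S | 0 < u j /\ u j < 1] + e')); last first.
  by rewrite lerD2l ge_min lexx.
have le0 : Pr mu [set u : S | u j <= 0] = 0 by rewrite law_coord// min_r ?ler01// maxxx.
have : Pr mu [set u : S | u j <= 1 - e'] = 1 - e'.
  by rewrite law_coord// min_r ?max_r; lra.
have : Pr mu [set u : S | u j <= 1 - e'] <= Pr mu ([set u : S | 0 < u j /\ u j < 1] `|` [set u : S | u j <= 0]).
  apply: Pr_le; [exact: mle|apply: measurableU => //; exact: mle|].
  move=> u /= ue; have [u0|u0] := leP (u j) 0; [by right|left; split=> //].
  by apply: le_lt_trans ue _; lra.
have := Pr_leU mu mA (mle j 0); rewrite le0 addr0; lra.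
Qed.

Lemma ge_forever0 (f : nat -> idx) (a : R) : injective f -> 0 < a <= 1 ->
  Pr mu [set u : S | forall i, a <= u (f i)] = 0.
Proof.
move=> injf /andP[a0 a1].
have mA : measurable [set u : S | forall i, a <= u (f i)].
  by meas.
(* Halving the threshold passes from events with [<=], whose law is known, to complements: [a <= u]
   excludes [u <= a / 2]. *)
have q0 : 0 <= 1 - a / 2 by lra.
have q1 : `|1 - a / 2| < 1 by rewrite ger0_norm//; lra.
apply/eqP; rewrite eq_le Pr_ge0 andbT; apply/ler_addgt0Pr => e e0; rewrite add0r.
have /cvgrPdist_lt /(_ e e0) [n _ /(_ n (leqnn n))]/= := cvg_expr q1.
rewrite sub0r normrN ger0_norm ?exprn_ge0// => /ltW; apply: le_trans.
apply: (@le_trans _ _ (Pr mu [set u : S | forall j, j \in map f (iota 0 n) -> `[a, +oo[%classic (u j)])).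
  apply: Pr_le => //.
    change (mP (fun u : S => forall j, j \in map f (iota 0 n) -> `[a, +oo[%classic (u j))).
    apply: mP_all => j; apply: mP_imp; first exact: mP_const.
    by apply: (mcoord j (measurable_itv `[a, +oo[)).
  by move=> u /= H j /mapP[i _ ->]; rewrite in_itv/= H.
rewrite (law_cyl Hmu (A := fun=> `[a, +oo[%classic)); last 2 first.
- by rewrite map_inj_uniq// iota_uniq.
- by move=> j; exact: measurable_itv.
rewrite big_map -[X in _ ^+ X](size_iota 0 n).
elim: (iota 0 n) => [|i s IH]; first by rewrite big_nil expr0.
rewrite big_cons exprS; apply: ler_pM => //; [exact: Pr_ge0|by apply: prodr_ge0 => *; exact: Pr_ge0|].
have := PrC mu (mle (f i) (a / 2)); rewrite law_coord// => H.
apply: (@le_trans _ _ (Pr mu (~` [set u : S | u (f i) <= a / 2]))).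
  apply: Pr_le.
  - exact: (mcoord (f i) (measurable_itv `[a, +oo[)).
  - by apply: measurableC; exact: mle.
  - by move=> u /=; rewrite in_itv/= andbT => au; apply/negP; rewrite -ltNge; lra.
rewrite H min_r ?max_r//; lra.
Qed.

Lemma wait_in01 : Pr mu [set u : S | forall x n, 0 < u (Wait x n) /\ u (Wait x n) < 1] = 1.
Proof.
apply: Pr1_all => x; first by meas.
apply: Pr1_all => n; first by meas.
exact: coord_in01.
Qed.

Let mW : mP (fun u : S => forall x n, 0 < u (Wait x n) /\ u (Wait x n) < 1).
Proof. by meas. Qed.

Lemma expT (T : nat) : 0 < expR (- T%:R : R) <= 1.
Proof. by rewrite expR_gt0/= -expR0 ler_expR oppr_le0. Qed.

Lemma ring_time_ge_wait (u : idx -> R) x n m : (forall x n, 0 < u (Wait x n) /\ u (Wait x n) < 1) ->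
  (m <= n)%N -> - ln (u (Wait x m)) <= ring_time u x n.
Proof.
move=> H mn; have w0 k : 0 <= - ln (u (Wait x k)).
  by rewrite oppr_ge0 ln_le0// ltW// (H x k).2.
rewrite /ring_time (bigD1 (Ordinal (mn : (m < n.+1)%N)))//= lerDl.
by apply: sumr_ge0 => i _.
Qed.

(** If all rings of [x] stay below [T], so does each of its waiting times, which means that
    infinitely many independent uniforms are at least exp(-T). *)
Lemma unbounded_rings x (T : nat) : Pr mu [set u : S | exists n, T%:R < ring_time u x n] = 1.
Proof.
have mE : mP (fun u : S => exists n, T%:R < ring_time u x n).
  by meas.
rewrite -[[set u | _]]setCK PrC; last exact: measurableC.
apply/eqP; rewrite subr_eq addrC -subr_eq subrr eq_sym; apply/eqP.
apply/eqP; rewrite eq_le Pr_ge0 andbT.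
have <- : Pr mu [set u : S | forall i, expR (- T%:R) <= u (Wait x i)] = 0.
  by apply: ge_forever0; [by move=> i j []|exact: expT].
apply: (Pr_le_ae _ _ mW wait_in01); first exact: measurableC.
  by meas.
move=> u Wu nH i; rewrite leNgt; apply/negP => lt; apply: nH; exists i.
apply: lt_le_trans (ring_time_ge_wait x Wu (leqnn i)).
by rewrite ltrNr -[X in _ < X]expRK ltr_ln ?posrE ?expR_gt0// (Wu x i).1.
Qed.

Lemma silent_sites (f : nat -> int) (T : nat) : injective f ->
  Pr mu [set u : S | exists n : nat, T%:R < ring_time u (f n) 0] = 1.
Proof.
move=> injf; have mE : mP (fun u : S => exists n, T%:R < ring_time u (f n) 0).
  by meas.
rewrite -[[set u | _]]setCK PrC; last exact: measurableC.
apply/eqP; rewrite subr_eq addrC -subr_eq subrr eq_sym; apply/eqP.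
apply/eqP; rewrite eq_le Pr_ge0 andbT.
have <- : Pr mu [set u : S | forall i, expR (- T%:R) <= u (Wait (f i) 0)] = 0.
  by apply: ge_forever0; [by move=> i j [/injf]|exact: expT].
apply: (Pr_le_ae _ _ mW wait_in01); first exact: measurableC.
  by meas.
move=> u Wu nH i; rewrite leNgt; apply/negP => lt; apply: nH; exists i.
rewrite ring_time0.
by rewrite ltrNr -[X in _ < X]expRK ltr_ln ?posrE ?expR_gt0// (Wu (f i) 0%N).1.
Qed.

(* Scaling one waiting variable by distinct factors [c] carries the coincidence
   event into disjoint events, each of probability at least [c] times its own. *)
Lemma no_coincidence x y m n : x != y ->
  Pr mu [set u : S | ~ ring_time u x m = ring_time u y n] = 1.
Proof.
move=> xy; have mE : mP (fun u : S => ring_time u x m = ring_time u y n) by meas.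
rewrite (_ : [set u | _] = ~` [set u : S | ring_time u x m = ring_time u y n])//.
rewrite PrC//; set p := Pr mu _.
suff -> : p = 0 by rewrite subr0.
pose j := Wait x m.
pose W : set S := [set u | 0 < u j /\ u j < 1].
(* Infinitely many distinct factors, all in [1/2, 1], so that each of the disjoint events has
   probability at least [p / 2]. *)
pose c (i : nat) : R := (1 + i.+1%:R^-1) / 2.
have i0 i : 0 < i.+1%:R^-1 :> R by rewrite invr_gt0.
have c01 i : 0 < c i <= 1.
  have : i.+1%:R^-1 <= 1 :> R by rewrite invf_le1// ler1n.
  rewrite /c; move: (i0 i); set a := (i.+1%:R^-1 : R) => *.
  apply/andP; split; lra.
have chalf i : 1 / 2 <= c i by rewrite /c; move: (i0 i); set a := (i.+1%:R^-1 : R) => *; lra.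
have cinj i i' : c i = c i' -> i = i'.
  rewrite /c => H; have : i.+1%:R^-1 = i'.+1%:R^-1 :> R.
    by move: H; set a := (i.+1%:R^-1 : R); set b := (i'.+1%:R^-1 : R) => ?; lra.
  by move=> /invr_inj /eqP; rewrite eqr_nat => /eqP[].
pose B i : set S := [set u | 0 < u j /\ ring_time u x m + ln (c i) = ring_time u y n].
have mB i : measurable (B i).
  by meas.
have dB i i' u : B i u -> B i' u -> i = i'.
  move=> [_ e1] [_ e2]; apply: cinj.
  have /andP[? _] := c01 i; have /andP[? _] := c01 i'.
  by apply: ln_inj; rewrite ?posrE//; lra.
have pB i : p / 2 <= Pr mu (B i).
  have /andP[ci0 _] := c01 i.
  apply: (@le_trans _ _ (c i * p)).
    by rewrite mulrC; apply: ler_wpM2r; [exact: Pr_ge0|rewrite -div1r].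
  have := scale_law Hmu j (c01 i) (mB i).
  move=> H; apply: (@le_trans _ _ (Pr mu (B i `&` [set u : S | 0 <= u j <= c i]))); last first.
    apply: Pr_le; [|exact: mB|by move=> u []].
    by apply: measurableI; [exact: mB|meas].
  rewrite -H; apply: ler_wpM2l; first exact: ltW.
  apply: (Pr_le_ae mE _ (G := W)).
  - have mT : measurable_fun setT (coordmap id (fun i0 r => if i0 == j then c i * r else r) : S -> S).
      apply: measurable_coordmap => k; case: (k == j); [exact: mulrl_measurable|exact: measurable_id].
    by rewrite -[X in measurable X]setTI; exact: mT.
  - by meas.
  - exact: coord_in01.
  move=> u [u0 u1] /= e; split; first by rewrite /coordmap eqxx mulr_gt0.
  have -> : ring_time (coordmap id (fun i0 r => if i0 == j then c i * r else r) u) y n =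
      ring_time u y n.
    apply: eq_bigr => k _; rewrite /coordmap; case: eqP => // -[yx _].
    by move: xy; rewrite yx eqxx.
  rewrite -e /ring_time !big_ord_recr /= /coordmap eqxx -/j.
  rewrite lnM ?posrE// opprD.
  rewrite (eq_bigr (fun k : 'I_m => - ln (u (Wait x k)))); first by ring.
  by move=> k _; case: eqP => // -[km]; have := ltn_ord k; rewrite km ltnn.
apply/eqP; rewrite eq_le Pr_ge0 andbT leNgt; apply/negP => p0.
have [N HN] := exists_nat_gt (2 / p).
have mB' (i : 'I_N) : measurable (B i) by [].
have := Pr_sum mu mB' (fun i i' u b b' => val_inj (dB _ _ u b b')).
have mU : measurable [set u : S | exists i : 'I_N, B i u].
  by apply: (@mP_ex _ S _ (fun (i : 'I_N) u => B i u)) => i; exact: mB.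
have := Pr_le1 mu mU => + E; rewrite {}E.
apply/negP; rewrite -ltNge.
apply: (@lt_le_trans _ _ (\sum_(i < N) p / 2)); last exact: ler_sum.
rewrite sumr_const card_ord -mulr_natl.
by move: HN; rewrite ltr_pdivrMr// => HN; lra.
Qed.

Lemma good_as : Pr mu [set u : S | good u] = 1.
Proof.
have mN x y m n : mP (fun u : S => ~ ring_time u x m = ring_time u y n).
  by meas.
pose G2 : set S := [set u | forall x (T : nat), exists n, T%:R < ring_time u x n].
pose G3 : set S := [set u | forall x y m n, x != y -> ~ ring_time u x m = ring_time u y n].
pose G4 : set S := [set u | forall x (T : nat), exists n : nat, T%:R < ring_time u (x + n%:Z) 0].
pose G5 : set S := [set u | forall x (T : nat), exists n : nat, T%:R < ring_time u (x - n%:Z) 0].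
have m2 : measurable G2 by meas.
have m3 : measurable G3 by meas.
have m4 : measurable G4 by meas.
have m5 : measurable G5 by meas.
have P2 : Pr mu G2 = 1.
  apply: Pr1_all => x; first by meas.
  apply: Pr1_all => T; first by meas.
  exact: unbounded_rings.
have P3 : Pr mu G3 = 1.
  apply: Pr1_all => x; first by meas.
  apply: Pr1_all => y; first by meas.
  apply: Pr1_all => m; first by meas.
  apply: Pr1_all => n; first by meas.
  case: (eqVneq x y) => xy.
    by rewrite (_ : [set u | _] = setT) ?PrT//; apply/seteqP; split.
  rewrite -[RHS](no_coincidence m n xy); congr (Pr mu _).
  by apply/seteqP; split=> u /=; [apply|move=> H _].
have P4 : Pr mu G4 = 1.
  apply: Pr1_all => x; first by meas.
  apply: Pr1_all => T; first by meas.
  by apply: silent_sites => i k; lia.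
have P5 : Pr mu G5 = 1.
  apply: Pr1_all => x; first by meas.
  apply: Pr1_all => T; first by meas.
  by apply: silent_sites => i k; lia.
have m45 := measurableI _ _ m4 m5; have m345 := measurableI _ _ m3 m45.
have m2345 := measurableI _ _ m2 m345; have mall := measurableI _ _ mW m2345.
have mg : measurable [set u : S | good u] by exact: mP_good.
have P1 : Pr mu [set u : S | forall x n, 0 < u (Wait x n) /\ u (Wait x n) < 1] = 1 by exact: wait_in01.
have P45 := Pr1_I m4 m5 P4 P5; have P345 := Pr1_I m3 m45 P3 P45.
have P2345 := Pr1_I m2 m345 P2 P345; have Pall := Pr1_I mW m2345 P1 P2345.
apply: (Pr1_sub mg mall Pall).
move=> u [H1 [H2 [H3 [H4 H5]]]]; split=> // [x n|x y m n xy]; first by apply/andP; exact: H1.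
by apply/eqP; exact: H3.
Qed.

End GoodAlmostSurely.

(** * Potentials *)

Section Potential.
Variables (R : realType) (F theta : nat) (g : nat -> nat).

(** The first clause makes the edge along which an interaction takes place gain exactly 1; the
    second, a Lipschitz bound, lets the other edge of the same vertex lose at most 1. Together the
    sum over both edges cannot drop. *)
Definition potential : Prop :=
  (forall j, (1 <= j <= theta)%N -> g j.-1 = (g j).+1) /\
  (forall j, (g j <= (g j.+1).+1)%N /\ (g j.+1 <= (g j).+1)%N).

Hypothesis pg : potential.

Let H := @hamming F.

Lemma deff_update_dist u v r (z : opinion F) :
  (g (H u z) <= (g (H (deff_update theta (R := R) u v r) z)).+1)%N.
Proof.
case: (boolP (1 <= hamming u v <= theta)%N) => uv; last by rewrite deff_update_id.
have [i _ ->] := deff_update_flip r uv.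
rewrite /H hamming_flip; case: ifP => ui; last by have [_] := pg.2 (hamming u z); case: (pg.2 (hamming u z)).
case E : (hamming u z) => [|j]; last by case: (pg.2 j).
by move/eqP : E; rewrite hamming_eq0 => /eqP uz; rewrite uz eqxx in ui.
Qed.

Lemma deff_update_gain u v z r :
  (g (H u v) + g (H u z) <= g (H (deff_update theta (R := R) u v r) v) +
     g (H (deff_update theta u v r) z))%N.
Proof.
case: (boolP (1 <= hamming u v <= theta)%N) => uv; last by rewrite deff_update_id.
have := deff_update_dist u v r z.
have [i iuv ->] := deff_update_flip r uv.
by rewrite [X in _ -> (_ <= g X + _)%N]hamming_flip iuv pg.1// /H; lia.
Qed.

Variable u : idx -> R.
Hypothesis gu : good u.

Let V x k := val_at F theta u x k.
Let L t x := left_state F theta u t x.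

(** The truncated difference is an exact one on good configurations, by [gainE]. *)
Definition gain x k : nat :=
  (g (H (L (ring_time u x k) (x - 1)) (V x k.+1)) + g (H (V x k.+1) (L (ring_time u x k) (x + 1))))
  - (g (H (L (ring_time u x k) (x - 1)) (V x k)) + g (H (V x k) (L (ring_time u x k) (x + 1)))).

Lemma gainE x k :
  (g (H (L (ring_time u x k) (x - 1)) (V x k)) + g (H (V x k) (L (ring_time u x k) (x + 1))) + gain x k =
  g (H (L (ring_time u x k) (x - 1)) (V x k.+1)) + g (H (V x k.+1) (L (ring_time u x k) (x + 1))))%N.
Proof.
rewrite /gain subnKC//.
rewrite /H !(hammingC (L _ (x - 1))) /V valS// -/(V x k).
case: (nbrP u x k) => ->; last exact: deff_update_gain.
by rewrite addnC [X in (_ <= X)%N]addnC; exact: deff_update_gain.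
Qed.

(** Only the two edges at site [i.+1] are affected; terms are moved across the equality to stay
    within natural numbers. *)
Lemma window_step n (S S' : nat -> opinion F) i : (i.+1 < n)%N ->
  (forall j, j != i.+1 -> S' j = S j) ->
  (\sum_(j < n) g (H (S' j) (S' j.+1)) + (g (H (S i) (S i.+1)) + g (H (S i.+1) (S i.+2))) =
   \sum_(j < n) g (H (S j) (S j.+1)) + (g (H (S' i) (S' i.+1)) + g (H (S' i.+1) (S' i.+2))))%N.
Proof.
move=> lin SS.
pose a := Ordinal (ltnW lin); pose b := Ordinal lin.
rewrite (bigD1 a)//= (bigD1 b)//=; last by rewrite -val_eqE /= neq_ltn ltnSn orbT.
rewrite [in RHS](bigD1 a)//= [in RHS](bigD1 b)//=; last by rewrite -val_eqE /= neq_ltn ltnSn orbT.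
rewrite (eq_bigr (fun j : 'I_n => g (H (S j) (S j.+1)))); first by lia.
move=> j /andP[]; rewrite -!val_eqE /= => ja jb.
by rewrite !SS// eqSS.
Qed.

Lemma window_stepL n (S S' : nat -> opinion F) : (forall j, j != 0%N -> S' j = S j) ->
  (forall z, g (H (S 0%N) z) <= (g (H (S' 0%N) z)).+1)%N ->
  (\sum_(j < n) g (H (S j) (S j.+1)) <= (\sum_(j < n) g (H (S' j) (S' j.+1))).+1)%N.
Proof.
move=> SS Hz; case: n => [|n]; first by rewrite !big_ord0.
rewrite !big_ord_recl /= /bump /= -addSn; apply: leq_add; first by rewrite (SS 1%N).
by apply: leq_sum => j _; rewrite !SS.
Qed.

Lemma window_stepR n (S S' : nat -> opinion F) : (forall j, j != n -> S' j = S j) ->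
  (forall z, g (H (S n) z) <= (g (H (S' n) z)).+1)%N ->
  (\sum_(j < n) g (H (S j) (S j.+1)) <= (\sum_(j < n) g (H (S' j) (S' j.+1))).+1)%N.
Proof.
move=> SS Hz; case: n SS Hz => [|n] SS Hz; first by rewrite !big_ord0.
rewrite !big_ord_recr /= -addnS; apply: leq_add.
  apply: leq_sum => j _; rewrite !SS// neq_ltn; apply/orP; left.
    by rewrite ltnS ltn_ord.
  exact: leqW.
by rewrite (SS n) ?neq_ltn ?ltnSn// ![H (S n) _]hammingC.
Qed.

Definition gains x t : nat := (\sum_(k < nrings u x t) gain x k)%N.

(** Induction on the number of rings in the window before [t], undoing the latest one. An interior
    ring changes two edges of the window and its gain is exact; a ring at an end site changes a
    single edge of the window, which may lose 1, whence the ring counts of the two ends on the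
    right. *)
Lemma window_bound (y : int) n (t : R) : (0 < n)%N ->
  (\sum_(j < n) g (H (L 0 (y + j%:Z)) (L 0 (y + j.+1%:Z))) + \sum_(j < n.-1) gains (y + j.+1%:Z) t <=
   \sum_(j < n) g (H (L t (y + j%:Z)) (L t (y + j.+1%:Z))) +
     (nrings u y t + nrings u (y + n%:Z) t))%N.
Proof.
move=> n0.
pose c t := (\sum_(j < n.+1) nrings u (y + j%:Z) t)%N.
move: {2}(c t) (leqnn (c t)) => m; elim: m t => [|m IH] t ctm.
  have N0 j : (j <= n)%N -> nrings u (y + j%:Z) t = 0%N.
    move=> jn; apply/eqP; rewrite -leqn0; apply: leq_trans ctm.
    by rewrite /c (bigD1 (Ordinal (jn : (j < n.+1)%N)))//= leq_addr.
  rewrite [X in (_ + X <= _)%N]big1 ?addn0.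
    apply: leq_trans (leq_addr _ _).
    apply: leq_sum => j _; have jn := ltn_ord j.
    by rewrite /L /left_state !N0 ?nrings0// ltnW.
  move=> j _; rewrite /gains N0 ?big_ord0//.
  by have := ltn_ord j; lia.
have [c0|c0] := posnP (c t).
  by apply: IH; rewrite c0.
have [i0 i0P] : exists i : 'I_n.+1, (0 < nrings u (y + i%:Z) t)%N.
  apply/existsP; move: c0; apply: contraTT; rewrite negb_exists => /forallP Hn.
  rewrite lt0n negbK; apply/eqP; apply: big1 => i _.
  by have := Hn i; rewrite lt0n negbK => /eqP.
pose last i := ring_time u (y + i%:Z) (nrings u (y + i%:Z) t).-1.
have [i iP imax] : exists2 i : 'I_n.+1, (0 < nrings u (y + i%:Z) t)%N &
    forall j : 'I_n.+1, (0 < nrings u (y + j%:Z) t)%N -> last j <= last i.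
  have := @arg_maxP _ _ _ i0 (fun i => (0 < nrings u (y + i%:Z) t)%N) (fun i => last i) i0P.
  by case=> i iP imax; exists i.
pose k := (nrings u (y + i%:Z) t).-1.
have kE : nrings u (y + i%:Z) t = k.+1 by rewrite prednK.
pose s := ring_time u (y + i%:Z) k.
have st : s < t by rewrite /s -nringsP// kE.
have Ni : nrings u (y + i%:Z) s = k by exact: nrings_ring.
have Nj (j : nat) : (j <= n)%N -> j != i -> nrings u (y + j%:Z) s = nrings u (y + j%:Z) t.
  move=> jn ji; apply/eqP; rewrite eqn_leq nrings_mono ?(ltW st)//=.
  case E : (nrings u (y + j%:Z) t) => [//|l].
  rewrite nringsP// lt_neqAle; apply/andP; split.
    by apply: good_neq => //; apply: contra ji => /eqP/addrI[->].
  have := imax (Ordinal (jn : (j < n.+1)%N)); rewrite /last /= E => /(_ isT) //.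
have cs : (c s <= m)%N.
  rewrite -ltnS; apply: leq_trans ctm; rewrite /c.
  rewrite (bigD1 i)//= [X in (_ < X)%N](bigD1 i)//= Ni kE -addSn leq_add2l.
  by apply: leq_sum => j ji; rewrite Nj// -ltnS ltn_ord.
have {}IH := IH s cs.
pose S j := L s (y + j%:Z); pose S' j := L t (y + j%:Z).
have SS (j : nat) : (j <= n)%N -> j != i -> S' j = S j.
  by move=> jn ji; rewrite /S' /S /L /left_state Nj.
have Si : S i = V (y + i%:Z) k by rewrite /S /L /left_state Ni.
have S'i : S' i = V (y + i%:Z) k.+1 by rewrite /S' /L /left_state kE.
have gainsE (j : nat) : (j <= n)%N -> gains (y + j%:Z) t =
    (gains (y + j%:Z) s + if j == i then gain (y + i%:Z) k else 0)%N.
  move=> jn; case: (eqVneq j i) => [->|ji]; last by rewrite /gains Nj// addn0.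
  by rewrite /gains Ni kE big_ord_recr.
have Hz z : (g (H (S i) z) <= (g (H (S' i) z)).+1)%N.
  rewrite Si S'i /V valS//; exact: deff_update_dist.
(* Cut off beyond the window, where sites may change between [s] and [t], so that a single index
   differs. *)
pose Sx j := if (j <= n)%N then S j else xor0 F.
pose Sx' j := if (j <= n)%N then S' j else xor0 F.
have SSx (j : nat) : j != i -> Sx' j = Sx j.
  by rewrite /Sx /Sx'; case: ifP => // jn /(SS _ jn).
have sumE : (\sum_(j < n) g (H (L s (y + j%:Z)) (L s (y + j.+1%:Z))) = \sum_(j < n) g (H (Sx j) (Sx j.+1)))%N.
  by apply: eq_bigr => j _; rewrite /Sx ltnW//= ltn_ord.
have sumE' : (\sum_(j < n) g (H (L t (y + j%:Z)) (L t (y + j.+1%:Z))) = \sum_(j < n) g (H (Sx' j) (Sx' j.+1)))%N.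
  by apply: eq_bigr => j _; rewrite /Sx' ltnW//= ltn_ord.
have iN : (i <= n)%N by rewrite -ltnS ltn_ord.
have N0 : nrings u y s = nrings u (y + 0%:Z) s by rewrite addr0.
have N0' : nrings u y t = nrings u (y + 0%:Z) t by rewrite addr0.
have gsum : (\sum_(j < n.-1) gains (y + j.+1%:Z) t = \sum_(j < n.-1) gains (y + j.+1%:Z) s +
    if (0 < i < n)%N then gain (y + i%:Z) k else 0)%N.
  transitivity (\sum_(j < n.-1) (gains (y + j.+1%:Z) s + if j.+1 == i then gain (y + i%:Z) k else 0))%N.
    by apply: eq_bigr => j _; rewrite gainsE//; have := ltn_ord j; lia.
  rewrite big_split /=; congr addn; case: ifP => iin.
    have i1 : (i.-1 < n.-1)%N by lia.
    rewrite (bigD1 (Ordinal i1))//= prednK; last by lia.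
    rewrite eqxx big1 ?addn0// => j; rewrite -val_eqE /= => ji; case: eqP => // e.
    by move: ji; rewrite -e eqxx.
  apply: big1 => j _; case: eqP => // e; move: iin; rewrite -e /=.
  by have := ltn_ord j; lia.
rewrite {}gsum {}sumE'; rewrite {}sumE in IH.
have [i0'|i0'] := posnP i.
  rewrite i0' /= addn0 N0'.
  have kE0 : nrings u (y + 0%:Z) t = (nrings u (y + 0%:Z) s).+1 by rewrite -i0' kE Ni.
  have Nn : nrings u (y + n%:Z) s = nrings u (y + n%:Z) t by apply: Nj => //; lia.
  have SS0 j : j != 0%N -> Sx' j = Sx j by rewrite -i0'; exact: SSx.
  have Hz0 z : (g (H (Sx 0%N) z) <= (g (H (Sx' 0%N) z)).+1)%N.
    by have := Hz z; rewrite /Sx /Sx' i0'.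
  have step := window_stepL n SS0 Hz0.
  rewrite kE0 -Nn -N0; apply: leq_trans IH _.
  by rewrite addSn addnS -addSn leq_add2r.
have [iltn|igen] := ltnP i n; last first.
  have iEn : i = n :> nat by lia.
  rewrite iEn andbF addn0.
  have kE0 : nrings u (y + n%:Z) t = (nrings u (y + n%:Z) s).+1 by rewrite -iEn kE Ni.
  have Nn : nrings u y s = nrings u y t by rewrite N0 N0'; apply: Nj => //; lia.
  have SS0 j : j != n -> Sx' j = Sx j by rewrite -{1}iEn; exact: SSx.
  have Hz0 z : (g (H (Sx n) z) <= (g (H (Sx' n) z)).+1)%N.
    by have := Hz z; rewrite /Sx /Sx' iEn leqnn.
  have step := window_stepR SS0 Hz0.
  rewrite kE0 -Nn; apply: leq_trans IH _.
  by rewrite !addnS -addSn leq_add2r.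
rewrite /=.
have Nn : nrings u (y + n%:Z) s = nrings u (y + n%:Z) t by apply: Nj => //; lia.
have N00 : nrings u y s = nrings u y t by rewrite N0 N0'; apply: Nj => //; lia.
have iE : i = i.-1.+1 :> nat by lia.
have ar A B ga P P' NN a b a' b' : (P' + (a + b) = P + (a' + b') ->
    a + b + ga = a' + b' -> A + B <= P + NN -> A + (B + ga) <= P' + NN)%N by lia.
have SS1 j : j != i.-1.+1 -> Sx' j = Sx j by rewrite -iE; exact: SSx.
have lin : (i.-1.+1 < n)%N by rewrite -iE.
have := window_step lin SS1; rewrite (SS1 i.-1) ?neq_ltn ?ltnSn// (SS1 i.-1.+2) ?neq_ltn ?ltnSn ?orbT//.
rewrite -iE /Sx /Sx' iN iltn (_ : (i.-1 <= n)%N = true) -/Sx -/Sx'; last by lia.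
rewrite Si S'i -Nn -N00 => step; apply: ar step _ IH.
have := gainE (y + i%:Z) k; rewrite -/s.
have -> : y + i%:Z - 1 = y + i.-1%:Z by lia.
by have -> : y + i%:Z + 1 = y + i.+1%:Z by lia.
Qed.

End Potential.

(** * Stationarity *)

Lemma leq_sum_ord (X : nat -> nat) n m : (n <= m)%N ->
  (\sum_(k < n) X k <= \sum_(k < m) X k)%N.
Proof.
elim: m => [|m IH]; first by rewrite leqn0 => /eqP ->.
rewrite leq_eqVlt => /orP[/eqP->//|/IH /leq_trans]; apply.
by rewrite big_ord_recr leq_addr.
Qed.

(** * Expectations of bounded natural-valued variables *)

Section Expectation.
Context d (S : measurableType d) (R : realType) (P : probability S R).
Implicit Types (X Y : S -> nat) (b c : nat).

Definition bdd b X : Prop := mfib X /\ forall u, (X u <= b)%N.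

Definition Ex X : R := fine (\int[P]_u ((X u)%:R)%:E).

Let f X (u : S) : \bar R := ((X u)%:R)%:E.

Lemma measurable_nat X : mfib X -> measurable_fun setT (f X).
Proof.
move=> mX _ B mB; rewrite setTI.
exact: (mP_pred (fun n => B (n%:R)%:E) mX).
Qed.

Lemma ExE b X : bdd b X -> (\int[P]_u f X u = (Ex X)%:E)%E.
Proof.
move=> [mX Xb]; rewrite /Ex fineK// ge0_fin_numE; last first.
  by apply: integral_ge0 => u _; rewrite lee_fin.
apply: (@le_lt_trans _ _ (\int[P]_u cst (b%:R)%:E u)%E).
  apply: ge0_le_integral => //; first exact: measurable_nat.
  by move=> u _; rewrite lee_fin ler_nat.
by rewrite (integral_cst P measurableT) [X in (_ * X)%E]probability_setT mule1 ltry.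
Qed.

Lemma bdd_add b c X Y : bdd b X -> bdd c Y -> bdd (b + c) (fun u => X u + Y u)%N.
Proof.
move=> [mX Xb] [mY Yb]; split; last by move=> u; exact: leq_add.
apply: (mfib_bind (h := fun n u => (n + Y u)%N)) => // n.
exact: (mfib_comp (fun k => (n + k)%N)).
Qed.

Lemma bdd_cst c : bdd c (fun=> c).
Proof. by split=> //; exact: mfib_const. Qed.

Lemma bdd_sum n b (X : nat -> S -> nat) : (forall i, (i < n)%N -> bdd b (X i)) ->
  bdd (n * b) (fun u => \sum_(i < n) X i u)%N.
Proof.
elim: n => [|n IH] H.
  split=> [|u]; last by rewrite big_ord0.
  by have := mfib_const S 0%N; congr mfib; apply/funext => u; rewrite big_ord0.
have := bdd_add (IH (fun i h => H i (ltnW h))) (H n (ltnSn n)).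
by rewrite mulSn addnC; congr bdd; apply/funext => u; rewrite big_ord_recr.
Qed.

Lemma bdd_ind (Q : S -> Prop) : mP Q -> bdd 1 (fun u => nat_of_bool `[< Q u >]).
Proof.
move=> mQ; split; last by move=> u; case: asboolP.
apply: (mfib_comp nat_of_bool); apply: mfib_bool.
by apply: mP_ext mQ => u; split=> /asboolP.
Qed.

Lemma Ex_add b c X Y : bdd b X -> bdd c Y ->
  Ex (fun u => X u + Y u)%N = Ex X + Ex Y.
Proof.
move=> bX bY; apply: EFin_inj; rewrite -(ExE (bdd_add bX bY)) EFinD -(ExE bX) -(ExE bY).
rewrite -ge0_integralD//; first last.
- exact: measurable_nat bY.1.
- by move=> u _; rewrite lee_fin.
- exact: measurable_nat bX.1.
- by move=> u _; rewrite lee_fin.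
by apply: eq_integral => u _; rewrite /f natrD.
Qed.

Lemma Ex_cst c : Ex (fun=> c) = c%:R.
Proof.
apply: EFin_inj; rewrite -(ExE (bdd_cst c)) (integral_cst P measurableT).
by rewrite [X in (_ * X)%E]probability_setT mule1.
Qed.

Lemma Ex_ge0 X : 0 <= Ex X.
Proof. by apply: fine_ge0; apply: integral_ge0 => u _; rewrite lee_fin. Qed.

Lemma Ex_le b c X Y (G : set S) : bdd b X -> bdd c Y -> measurable G -> Pr P G = 1 ->
  (forall u, G u -> (X u <= Y u)%N) -> Ex X <= Ex Y.
Proof.
move=> bX bY mG G1 XY; rewrite -lee_fin -(ExE bX) -(ExE bY).
apply: ae_ge0_le_integral => //.
- by move=> u _; rewrite lee_fin.
- exact: measurable_nat bX.1.
- by move=> u _; rewrite lee_fin.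
- exact: measurable_nat bY.1.
have := Pr1_ae mG G1; apply: filterS => u Gu _.
by rewrite lee_fin ler_nat XY.
Qed.

Lemma Ex_sum n b (X : nat -> S -> nat) : (forall i, (i < n)%N -> bdd b (X i)) ->
  Ex (fun u => \sum_(i < n) X i u)%N = \sum_(i < n) Ex (X i).
Proof.
elim: n => [|n IH] H.
  rewrite big_ord0 (_ : (fun _ => _) = (fun=> 0%N)) ?Ex_cst//.
  by apply/funext => u; rewrite big_ord0.
have Hn i : (i < n)%N -> bdd b (X i) by move=> h; exact/H/ltnW.
rewrite big_ord_recr/= -IH// -(Ex_add (bdd_sum Hn) (H n (ltnSn n))).
by congr Ex; apply/funext => u; rewrite big_ord_recr.
Qed.

Lemma Ex_ind (Q : S -> Prop) : mP Q -> Ex (fun u => nat_of_bool `[< Q u >]) = Pr P [set u | Q u].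
Proof.
move=> mQ; apply: EFin_inj; rewrite -(ExE (bdd_ind mQ)) -PrE//.
rewrite (eq_integral (fun u => (\1_[set u | Q u] u)%:E)); last first.
  move=> u _; rewrite /f indicE.
  by have [Qu|nQu] := pselect (Q u); [rewrite asboolT// mem_set|rewrite asboolF// memNset].
by rewrite (integral_indic P measurableT mQ) setIT.
Qed.

(** Layer-cake formula: it turns invariance of probabilities under shifts into invariance of
    expectations. *)
Lemma Ex_layer b X : bdd b X -> Ex X = \sum_(m < b) Pr P [set u | (m < X u)%N].
Proof.
move=> [mX Xb].
have mm m : mP (fun u => (m < X u)%N).
  exact: (mP_pred (fun n => (m < n)%N) mX).
transitivity (Ex (fun u => \sum_(m < b) nat_of_bool `[< (m < X u)%N >])%N).
  congr Ex; apply/funext => u.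
  rewrite (eq_bigr (fun m : 'I_b => nat_of_bool (m < X u)%N)); last first.
    by move=> m _; case: asboolP => [->|/negP/negbTE ->].
  have -> c : (\sum_(m < c) (m < X u) = minn (X u) c)%N.
    by elim: c => [|c IH]; [rewrite big_ord0 minn0|rewrite big_ord_recr /= IH; lia].
  by rewrite (minn_idPl (Xb u)).
rewrite (@Ex_sum b 1 (fun m u => nat_of_bool `[< (m < X u)%N >])).
  by apply: eq_bigr => m _; rewrite Ex_ind.
by move=> m _; exact: bdd_ind.
Qed.

End Expectation.

Section Shift.
Variable R : realType.

Definition shift_idx (m : int) (j : idx) : idx :=
  match j with
  | Init x n => Init (x + m) n | Wait x n => Wait (x + m) n
  | Dir x n => Dir (x + m) n | Iss x n => Iss (x + m) n
  end.

Definition shift (m : int) : space R -> space R := coordmap (shift_idx m) (fun _ r => r).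

Lemma shift_idx_inj m : injective (shift_idx m).
Proof. by move=> [x n|x n|x n|x n] [y k|y k|y k|y k] //= [/addIr -> ->]. Qed.

Lemma measurable_shift m : measurable_fun setT (shift m).
Proof. by apply: measurable_coordmap => j; exact: measurable_id. Qed.

Lemma shift_law (mu : probability (space R) R) m B : uniform_law mu -> measurable B ->
  Pr mu (shift m @^-1` B) = Pr mu B.
Proof.
move=> Hmu mB; apply: coordmap_law => //; first exact: shift_idx_inj.
by move=> j a; rewrite !law_coord.
Qed.

Variables (u : space R) (m : int).

Lemma ring_time_shift x n : ring_time (shift m u) x n = ring_time u (x + m) n.
Proof. by []. Qed.

Lemma nrings_shift x s : nrings (shift m u) x s = nrings u (x + m) s.
Proof. by []. Qed.

Lemma ring_nbr_shift x n : ring_nbr (shift m u) x n + m = ring_nbr u (x + m) n.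
Proof.
rewrite /ring_nbr /shift /coordmap /=; case: ifP => _; first by rewrite addrAC.
by rewrite addrAC.
Qed.

Lemma ev_shift F theta n x k : ev F theta n (shift m u) x k = ev F theta n u (x + m) k.
Proof.
elim: n x k => [|n IH] x [|k] //=.
by rewrite !IH nrings_shift ring_nbr_shift ring_time_shift.
Qed.

Lemma val_shift F theta x k : val_at F theta (shift m u) x k = val_at F theta u (x + m) k.
Proof.
rewrite /val_at; congr xget; apply/seteqP; split=> v [m0 H]; exists m0 => j /H.
  by rewrite ev_shift.
by rewrite ev_shift.
Qed.

Lemma left_shift F theta t x :
  left_state F theta (shift m u) t x = left_state F theta u t (x + m).
Proof. by rewrite /left_state val_shift. Qed.

Lemma gain_shift F theta g x k :
  gain F theta g (shift m u) x k = gain F theta g u (x + m) k.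
Proof. by rewrite /gain !left_shift !val_shift !ring_time_shift addrAC [x + 1 + m]addrAC. Qed.

Lemma gains_shift F theta g x t :
  gains F theta g (shift m u) x t = gains F theta g u (x + m) t.
Proof. by rewrite /gains; apply: eq_bigr => k _; rewrite gain_shift. Qed.

End Shift.

(** * Mean inequality and finiteness of the gains *)

Section MeanInequality.
Variables (R : realType) (mu : probability (space R) R).
Hypothesis Hmu : uniform_law mu.
Let S : measurableType _ := space R.
Variables (F theta : nat) (g : nat -> nat) (B : nat).
Hypothesis pg : potential theta g.
Hypothesis gB : forall j, (j <= F)%N -> (g j <= B)%N.

Definition edge_size (u : S) (t : R) (x : int) : nat :=
  hamming (left_state F theta u t x) (left_state F theta u t (x + 1)).

Lemma mP_shift m (Q : S -> Prop) : mP Q -> mP (fun u => Q (shift m u)).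
Proof. by move=> mQ; rewrite /mP -[X in measurable X]setTI; exact: measurable_shift. Qed.

Lemma Ex_shift m b (X : S -> nat) : bdd b X -> Ex mu (fun u => X (shift m u)) = Ex mu X.
Proof.
move=> bX; have [mX Xb] := bX.
have bX' : bdd b (fun u => X (shift m u)).
  by split=> // n; exact: (mP_shift m (mX n)).
rewrite (Ex_layer mu bX) (Ex_layer mu bX'); apply: eq_bigr => n _.
rewrite -[RHS](shift_law m Hmu)//.
exact: (mP_pred (fun k => (n < k)%N) mX).
Qed.

Lemma mfib_edge t x : mfib (fun u : S => edge_size u t x).
Proof.
apply: (mfib_bind (f := fun u : S => left_state F theta u t x)
  (h := fun a u => hamming a (left_state F theta u t (x + 1)))).
  by apply: mfib_left; exact: measurable_cst.
move=> a; apply: (mfib_comp (hamming a)).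
by apply: mfib_left; exact: measurable_cst.
Qed.

Lemma mfib_gain x k : mfib (fun u : S => gain F theta g u x k).
Proof.
pose h (a b c b' : opinion F) := ((g (hamming a b') + g (hamming b' c)) -
  (g (hamming a b) + g (hamming b c)))%N.
have ml y : mfib (fun u : S => left_state F theta u (ring_time u x k) y).
  by apply: mfib_left; exact: measurable_ring.
apply: (mfib_bind (f := fun u : S => left_state F theta u (ring_time u x k) (x - 1))
  (h := fun a u => h a (val_at F theta u x k) (left_state F theta u (ring_time u x k) (x + 1)) (val_at F theta u x k.+1))) => // a.
apply: (mfib_bind (f := fun u : S => val_at F theta u x k)
  (h := fun b u => h a b (left_state F theta u (ring_time u x k) (x + 1)) (val_at F theta u x k.+1))) => [|b].
  exact: mfib_val.
apply: (mfib_bind (f := fun u : S => left_state F theta u (ring_time u x k) (x + 1))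
  (h := fun c u => h a b c (val_at F theta u x k.+1))) => // c.
by apply: (mfib_comp (h a b c)); exact: mfib_val.
Qed.

Lemma mfib_sum n (X : nat -> S -> nat) : (forall i, mfib (X i)) ->
  mfib (fun u => \sum_(i < n) X i u)%N.
Proof.
move=> mX; elim: n => [|n IH].
  by have := mfib_const S 0%N; congr mfib; apply/funext => u; rewrite big_ord0.
rewrite (_ : (fun _ => _) = (fun u => \sum_(i < n) X i u + X n u)%N); last first.
  by apply/funext => u; rewrite big_ord_recr.
apply: (mfib_bind (h := fun k u => (k + X n u)%N)) => // k.
exact: (mfib_comp (addn k)).
Qed.

Lemma mfib_gains x t : mfib (fun u : S => gains F theta g u x t).
Proof.
apply: (mfib_bind (f := fun u : S => nrings u x t)
  (h := fun n u => (\sum_(k < n) gain F theta g u x k)%N)).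
  by apply: mfib_nrings; exact: measurable_cst.
move=> n; apply: (mfib_sum n (X := fun i (u : S) => gain F theta g u x i)) => i.
exact: mfib_gain.
Qed.

(** Counts are finite, so their tail vanishes at one site; translation invariance makes [M] serve
    for every site, in particular for both ends of windows of any length. *)
Lemma nrings_tail t e : 0 < e -> exists M : nat,
  forall x, Pr mu [set u : S | (M < nrings u x t)%N] <= e.
Proof.
move=> e0.
have mN x M : measurable [set u : S | (M < nrings u x t)%N].
  change (mP (fun u : S => (M < nrings u x t)%N)).
  apply: (mP_pred (fun k => (M < k)%N)).
  by apply: mfib_nrings; exact: measurable_cst.
have [|M HM] := Pr_decr mu (mN 0) _ e0.
  by move=> M u /=; exact: ltnW.
exists M => x; rewrite -[x]add0r.
have := shift_law x Hmu (mN 0 M).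
rewrite /preimage /= => H.
have -> : [set u : S | (M < nrings u (0 + x) t)%N] = [set u : S | (M < nrings (shift x u) 0 t)%N] by [].
rewrite [X in X <= _]H; apply: le_trans HM _.
rewrite (_ : \bigcap_n _ = set0) ?Pr0 ?add0r//.
by apply/seteqP; split=> u // /(_ (nrings u 0 t) Logic.I) /=; rewrite ltnn.
Qed.

(** Average [window_bound] over [n] edges, alike by translation invariance, and divide by [n]. The
    ring counts of the two ends are at most [2 * M] outside an event of small probability, where the
    crude bound [n * (B + K)] is used; for this the gains are truncated at [K]. *)
Lemma mean_ineq t K : 0 <= t ->
  Ex mu (fun u => g (edge_size u 0 0)) + Ex mu (fun u => minn (gains F theta g u 0 t) K) <=
  Ex mu (fun u => g (edge_size u t 0)).
Proof.
move=> t0.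
have bE s x : bdd B (fun u : S => g (edge_size u s x)).
  split; last by move=> u; apply: gB; exact: hamming_le.
  by apply: (mfib_comp g); exact: mfib_edge.
have bG x : bdd K (fun u : S => minn (gains F theta g u x t) K).
  split; last by move=> u; exact: geq_minr.
  by apply: (mfib_comp (fun n => minn n K)); exact: mfib_gains.
have mQ x M : mP (fun u : S => (M < nrings u x t)%N).
  apply: (mP_pred (fun k => (M < k)%N)).
  by apply: mfib_nrings; exact: measurable_cst.
have exE s (j : int) : Ex mu (fun u => g (edge_size u s j)) = Ex mu (fun u => g (edge_size u s 0)).
  apply: etrans (Ex_shift j (bE s 0)); congr Ex; apply/funext => u.
  by rewrite /edge_size !left_shift add0r addrC.
have exG (j : int) : Ex mu (fun u => minn (gains F theta g u j t) K) =
    Ex mu (fun u => minn (gains F theta g u 0 t) K).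
  apply: etrans (Ex_shift j (bG 0)); congr Ex; apply/funext => u.
  by rewrite gains_shift add0r.
set A := Ex mu _; set C := Ex mu _; set D := Ex mu _.
have key n M : (0 < n)%N ->
    n%:R * A + n.-1%:R * C <= n%:R * D + (2 * M)%:R +
     (n * (B + K))%:R * (Pr mu [set u : S | (M < nrings u 0 t)%N] +
       Pr mu [set u : S | (M < nrings u n%:Z t)%N]).
  move=> n0.
  pose X0 (u : S) := (\sum_(j < n) g (edge_size u 0 j%:Z))%N.
  pose X1 (u : S) := (\sum_(j < n.-1) minn (gains F theta g u j.+1%:Z t) K)%N.
  pose X2 (u : S) := (\sum_(j < n) g (edge_size u t j%:Z))%N.
  pose I x (u : S) := nat_of_bool `[< (M < nrings u x t)%N >].
  pose X3 (u : S) := (\sum_(j < n * (B + K)) (I 0 u + I n%:Z u))%N.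
  have bI x : bdd 1 (I x) by exact: bdd_ind.
  have bI2 := bdd_add (bI 0) (bI n%:Z).
  have b0 : bdd (n * B) X0 by apply: (bdd_sum (X := fun i (u : S) => g (edge_size u 0 i%:Z))).
  have b1 : bdd (n.-1 * K) X1 by apply: (bdd_sum (X := fun i (u : S) => minn (gains F theta g u i.+1%:Z t) K)).
  have b2 : bdd (n * B) X2 by apply: (bdd_sum (X := fun i (u : S) => g (edge_size u t i%:Z))).
  have b3 : bdd (n * (B + K) * (1 + 1)) X3 by apply: (bdd_sum (X := fun _ (u : S) => (I 0 u + I n%:Z u)%N)).
  have b2M := bdd_add b2 (bdd_cst S (2 * M)).
  have E0 : Ex mu X0 = n%:R * A.
    rewrite (Ex_sum (n := n) (X := fun i (u : S) => g (edge_size u 0 i%:Z)) mu (fun i _ => bE 0 i%:Z)).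
    rewrite (eq_bigr (fun=> A)) => [|j _]; last exact: exE.
    by rewrite sumr_const card_ord mulr_natl.
  have E1 : Ex mu X1 = n.-1%:R * C.
    rewrite (Ex_sum (n := n.-1) (X := fun i (u : S) => minn (gains F theta g u i.+1%:Z t) K) mu (fun i _ => bG i.+1%:Z)).
    rewrite (eq_bigr (fun=> C)) => [|j _]; last exact: exG.
    by rewrite sumr_const card_ord mulr_natl.
  have E2 : Ex mu X2 = n%:R * D.
    rewrite (Ex_sum (n := n) (X := fun i (u : S) => g (edge_size u t i%:Z)) mu (fun i _ => bE t i%:Z)).
    rewrite (eq_bigr (fun=> D)) => [|j _]; last exact: exE.
    by rewrite sumr_const card_ord mulr_natl.
  have E3 : Ex mu X3 = (n * (B + K))%:R * (Pr mu [set u : S | (M < nrings u 0 t)%N] +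
       Pr mu [set u : S | (M < nrings u n%:Z t)%N]).
    rewrite (Ex_sum (n := n * (B + K)) (X := fun _ (u : S) => (I 0 u + I n%:Z u)%N) mu (fun _ _ => bI2)).
    by rewrite (Ex_add mu (bI 0) (bI n%:Z)) (Ex_ind mu (mQ 0 M)) (Ex_ind mu (mQ n%:Z M))
      sumr_const card_ord mulr_natl.
  have := Ex_le (bdd_add b0 b1) (bdd_add b2M b3) (measurable_good R) (good_as Hmu).
  rewrite (Ex_add mu b0 b1) (Ex_add mu b2M b3) (Ex_add mu b2 (bdd_cst S _)) Ex_cst.
  rewrite E0 E1 E2 E3; apply=> u gu.
  rewrite /X0 /X1 /X2 /X3 sum_nat_const card_ord.
  have e0B s : (\sum_(j < n) g (edge_size u s j%:Z) <= n * B)%N.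
    rewrite -[X in (_ <= X * _)%N]card_ord -sum_nat_const; apply: leq_sum => j _.
    by apply: gB; exact: hamming_le.
  have e1K : (\sum_(j < n.-1) minn (gains F theta g u j.+1%:Z t) K <= n * K)%N.
    apply: (@leq_trans (n.-1 * K)); last by rewrite leq_mul2r leq_pred orbT.
    by rewrite -[X in (_ <= X * _)%N]card_ord -sum_nat_const; apply: leq_sum => j _; exact: geq_minr.
  rewrite /I; case: asboolP => N1.
    apply: (@leq_trans (n * (B + K))); first by rewrite mulnDr; exact: leq_add.
    by rewrite [X in (_ <= _ + X)%N]mulnDr muln1 addnCA leq_addr.
  case: asboolP => N2.
    apply: (@leq_trans (n * (B + K))); first by rewrite mulnDr; exact: leq_add.
    by rewrite add0n muln1 leq_addl.
  rewrite addn0 muln0 addn0.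
  have := @window_bound R F theta g pg u gu 0 n t n0; rewrite !add0r.
  have -> : (\sum_(j < n) g (hamming (left_state F theta u 0 (0 + j%:Z)) (left_state F theta u 0 (0 + j.+1%:Z))))%N =
     (\sum_(j < n) g (edge_size u 0 j%:Z))%N.
    by apply: eq_bigr => j _; rewrite /edge_size !add0r -addn1.
  have -> : (\sum_(j < n) g (hamming (left_state F theta u t (0 + j%:Z)) (left_state F theta u t (0 + j.+1%:Z))))%N =
     (\sum_(j < n) g (edge_size u t j%:Z))%N.
    by apply: eq_bigr => j _; rewrite /edge_size !add0r -addn1.
  move=> W; apply: (@leq_trans (\sum_(j < n) g (edge_size u 0 j%:Z) + \sum_(j < n.-1) gains F theta g u (0 + j.+1%:Z) t)).
    by rewrite leq_add2l; apply: leq_sum => j _; rewrite add0r geq_minl.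
  apply: leq_trans W _; rewrite leq_add2l mul2n -addnn; apply: leq_add.
    by move/negP: N1; rewrite -leqNgt.
  by move/negP: N2; rewrite -leqNgt.
rewrite leNgt; apply/negP => lt.
pose del := A + C - D; have del0 : 0 < del by rewrite /del; lra.
(* Chosen so that the two exceptional events cost at most half of the supposed defect [del] per
   edge; [n] then makes the boundary terms [C + 2 M] smaller than the other half. *)
pose e := del / (4 * (B + K).+1%:R).
have BK0 : 0 < (B + K).+1%:R :> R by rewrite ltr0n.
have e0 : 0 < e by rewrite /e divr_gt0// mulr_gt0.
have [M HM] := nrings_tail t e0.
have [n nb] := exists_nat_gt ((C + (2 * M)%:R) / (del / 2)).
have n0 : (0 < n)%N.
  rewrite -(ltr_nat R); apply: le_lt_trans nb.
  by rewrite divr_ge0 ?addr_ge0 ?Ex_ge0//; lra.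
have := key n M n0.
have h1 := HM 0; have h2 := HM n%:Z.
have : (n * (B + K))%:R * (Pr mu [set u : S | (M < nrings u 0 t)%N] +
       Pr mu [set u : S | (M < nrings u n%:Z t)%N]) <= n%:R * (del / 2).
  rewrite natrM -mulrA; apply: ler_wpM2l => //.
  apply: (@le_trans _ _ ((B + K).+1%:R * (e + e))).
    apply: ler_pM => //; first by rewrite addr_ge0// Pr_ge0.
      by rewrite ler_nat.
    exact: lerD.
  suff -> : (B + K).+1%:R * (e + e) = del / 2 by [].
  rewrite /e; move: BK0; move: ((B + K).+1%:R : R) => z z0.
  by field; rewrite lt0r_neq0.
have -> : n.-1%:R = n%:R - 1 :> R by rewrite -{2}(prednK n0) -natr1 addrK.
move: nb; rewrite ltr_pdivrMr; last by lra.
rewrite /del; set x := n%:R : R; set y := (2 * M)%:R : R; set z := _%:R * (_ + _) : R.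
by move=> *; nra.
Qed.

(** Markov's inequality with the gains truncated at [m]: reaching [m] has probability at most
    [B / m]. Gains are natural numbers, so a finite total leaves finitely many nonzero ones. *)
Lemma gains_finite :
  Pr mu [set u : S | exists K, forall k, (K <= k)%N -> gain F theta g u 0 k = 0%N] = 1.
Proof.
have mG m (T : nat) : mP (fun u : S => (m <= gains F theta g u 0 T%:R)%N).
  by apply: (mP_pred (fun k => (m <= k)%N)); exact: mfib_gains.
pose Fm m : set S := \bigcup_T [set u : S | (m <= gains F theta g u 0 T%:R)%N].
have mFm m : measurable (Fm m) by apply: bigcup_measurable => T _; exact: mG.
have bound m : m%:R * Pr mu (Fm m) <= B%:R.
  apply/ler_addgt0Pr => e e0.
  have e'0 : 0 < e / m.+1%:R by rewrite divr_gt0// ltr0n.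
  have incr (T : nat) : [set u : S | (m <= gains F theta g u 0 T%:R)%N] `&` [set u : S | good u] `<=`
     [set u : S | (m <= gains F theta g u 0 T.+1%:R)%N] `&` [set u : S | good u].
    move=> u [/= mg gu]; split=> //; apply: leq_trans mg _; rewrite /gains.
    have le : (nrings u 0 T%:R <= nrings u 0 T.+1%:R)%N by apply: nrings_mono => //; rewrite ler_nat.
    exact: (leq_sum_ord (gain F theta g u 0) le).
  have mFg T : measurable ([set u : S | (m <= gains F theta g u 0 T%:R)%N] `&` [set u : S | good u]).
    by apply: measurableI; [exact: mG|exact: measurable_good].
  have [T HT] := Pr_incr mu mFg incr e'0.
  have PF : Pr mu (Fm m) = Pr mu (\bigcup_T ([set u : S | (m <= gains F theta g u 0 T%:R)%N] `&` [set u : S | good u])).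
    apply: (Pr_eq_ae (mFm m) _ (measurable_good R) (good_as Hmu)).
      exact: bigcupT_measurable.
    move=> u gu; split=> [[n _ H]|[n _ [H _]]]; by exists n.
  have bm : bdd m (fun u : S => minn (gains F theta g u 0 T%:R) m).
    split; last by move=> u; exact: geq_minr.
    by apply: (mfib_comp (fun n => minn n m)); exact: mfib_gains.
  have step : m%:R * Pr mu [set u : S | (m <= gains F theta g u 0 T%:R)%N] <= B%:R.
    apply: (@le_trans _ _ (Ex mu (fun u => minn (gains F theta g u 0 T%:R) m))).
      rewrite -(Ex_ind mu (mG m T)).
      have bI := bdd_ind (mG m T).
      have := Ex_sum (n := m) mu (fun _ _ => bI); rewrite sumr_const card_ord -[_ *+ m]mulr_natl => <-.
      apply: (Ex_le _ bm (measurable_good R) (good_as Hmu)).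
        exact: (bdd_sum (X := fun _ (u : S) => nat_of_bool `[< (m <= gains F theta g u 0 T%:R)%N >]) (fun _ _ => bI)).
      move=> u _; rewrite sum_nat_const card_ord.
      by case: asboolP => [mg|_]; rewrite ?muln0// muln1 leq_min mg leqnn.
    have := @mean_ineq T%:R m (ler0n _ _); have := Ex_ge0 mu (fun u => g (edge_size u 0 0)).
    have : Ex mu (fun u => g (edge_size u T%:R 0)) <= B%:R.
      rewrite -(Ex_cst mu B); apply: (Ex_le _ (bdd_cst S B) (measurable_good R) (good_as Hmu)).
        split; last by move=> u; apply: gB; exact: hamming_le.
        by apply: (mfib_comp g); exact: mfib_edge.
      by move=> u _; apply: gB; exact: hamming_le.
    move=> a b c; apply: le_trans a; apply: le_trans c; by rewrite lerDr.
  rewrite PF; apply: (@le_trans _ _ (m%:R * (Pr mu [set u : S | (m <= gains F theta g u 0 T%:R)%N] + e / m.+1%:R))).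
    apply: ler_wpM2l => //; apply: le_trans HT _; rewrite lerD2r.
    by apply: Pr_le; [exact: mFg|exact: mG|move=> u []].
  rewrite mulrDr; apply: lerD => //.
  rewrite mulrCA -[leRHS]mulr1; apply: ler_wpM2l; first exact: ltW.
  by rewrite ler_pdivrMr ?ltr0n// mul1r ler_nat.
have P0 : Pr mu (\bigcap_m Fm m) = 0.
  apply/eqP; rewrite eq_le Pr_ge0 andbT; apply/ler_addgt0Pr => e e0; rewrite add0r.
  have [m mB] := exists_nat_gt (B%:R / e).
  have mI : measurable (\bigcap_m Fm m) by exact: bigcapT_measurable.
  apply: (@le_trans _ _ (Pr mu (Fm m))); first by apply: Pr_le; [exact: mI|exact: mFm|move=> u; apply].
  have m0 : 0 < m%:R :> R by apply: le_lt_trans mB; rewrite divr_ge0// ltW.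
  rewrite -(ler_pM2l m0); apply: le_trans (bound m) _.
  by rewrite -ler_pdivrMr// ltW.
have mI : measurable (\bigcap_m Fm m) by exact: bigcapT_measurable.
have P1 : Pr mu (~` (\bigcap_m Fm m)) = 1 by rewrite PrC// P0 subr0.
apply: Pr1_sub (measurableI _ _ (measurableC mI) (measurable_good R)) _ _.
- change (mP (fun u : S => exists K, forall k, (K <= k)%N -> gain F theta g u 0 k = 0%N)).
  by apply: mP_ex => K; apply: mP_all => k; apply: mP_imp; [exact: mP_const|exact: mfib_gain].
- by apply: Pr1_I => //; [exact: measurableC|exact: measurable_good|exact: good_as].
move=> u [nI gu].
have [m Hm] : exists m, forall T : nat, (gains F theta g u 0 T%:R < m)%N.
  apply: contrapT => H; apply: nI => m _; apply: contrapT => H2; apply: H; exists m => T.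
  by rewrite ltnNge; apply/negP => ?; apply: H2; exists T.
have {}Hm n : (\sum_(k < n) gain F theta g u 0 k < m)%N.
  have [T nT] := exists_nat_gt (ring_time u 0 n).
  apply: leq_ltn_trans (Hm T); rewrite /gains.
  have le : (n <= nrings u 0 T%:R)%N by apply: ltnW; rewrite nringsP.
  exact: (leq_sum_ord (gain F theta g u 0) le).
apply: contrapT => H.
have H' K : exists2 k, (K <= k)%N & (0 < gain F theta g u 0 k)%N.
  apply: contrapT => H2; apply: H; exists K => k Kk; apply/eqP; rewrite -leqn0 leqNgt.
  by apply/negP => ?; apply: H2; exists k.
have grow j : exists n, (j <= \sum_(k < n) gain F theta g u 0 k)%N.
  elim: j => [|j [n Hj]]; first by exists 0%N.
  have [k nk gk] := H' n; exists k.+1.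
  rewrite big_ord_recr /= -addn1; apply: leq_add => //; apply: leq_trans Hj _.
  exact: (leq_sum_ord (gain F theta g u 0) nk).
have [n] := grow m; by rewrite leqNgt Hm.
Qed.

End MeanInequality.

(** * Fixation *)

Definition dist_pot (theta j : nat) : nat := ((j - theta) + (theta - j))%N.

Definition def_pot (theta j : nat) : nat := (theta - j)%N.

Lemma potential_dist theta : potential theta (dist_pot theta).
Proof. by rewrite /dist_pot; split=> [j jt|j]; lia. Qed.

Lemma potential_def theta : potential theta (def_pot theta).
Proof. by rewrite /def_pot; split=> [j jt|j]; lia. Qed.

Section Fixation.
Variables (R : realType) (F theta : nat) (u : idx -> R).

Definition fixed_at x (v : opinion F) : Prop :=
  exists K, forall k, (K <= k)%N -> val_at F theta u x k = v.

Definition fixates x : Prop := exists v, fixed_at x v.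

Definition gains_stop x : Prop :=
  exists K, forall k, (K <= k)%N -> gain F theta (def_pot theta) u x k = 0%N.

Hypothesis gu : good u.

Let V x k := val_at F theta u x k.
Let L t x := left_state F theta u t x.

Lemma change_flip x k : V x k.+1 != V x k ->
  exists2 i, V x k i != L (ring_time u x k) (ring_nbr u x k) i & V x k.+1 = flip i (V x k).
Proof.
rewrite {1}/V valS// -/(V x k) -/(L _ _).
case: (boolP (1 <= hamming (V x k) (L (ring_time u x k) (ring_nbr u x k)) <= theta)%N) => H; last first.
  by rewrite deff_update_id// eqxx.
have [i iH E] := deff_update_flip (u (Iss x k)) H => _.
by exists i => //; rewrite /V valS.
Qed.

Lemma change_active x k : V x k.+1 != V x k ->
  (1 <= hamming (V x k) (L (ring_time u x k) (ring_nbr u x k)) <= theta)%N.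
Proof.
apply: contraR => H; apply/eqP; rewrite /V valS//; exact: deff_update_id.
Qed.

Lemma active_change x k :
  (1 <= hamming (V x k) (L (ring_time u x k) (ring_nbr u x k)) <= theta)%N ->
  V x k.+1 != V x k.
Proof.
move=> H; have [i _ E] := deff_update_flip (u (Iss x k)) H.
by rewrite /V valS// -/(V x k) -/(L _ _) E flip_neq.
Qed.

(** A vertex that changes interacts along an active edge, so the blocked edge is its other one.
    There the number of disagreements stays at least [theta], [def_pot] remains 0, and the gain of
    the active edge is not compensated. *)
Lemma blocked_gain x k : V x k.+1 != V x k ->
  (theta < hamming (L (ring_time u x k) (x - 1)) (V x k))%N \/
  (theta < hamming (V x k) (L (ring_time u x k) (x + 1)))%N ->
  (0 < gain F theta (def_pot theta) u x k)%N.
Proof.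
move=> ch; have act := change_active ch; have [i iH E] := change_flip ch.
rewrite /gain -/(V x k) -/(V x k.+1) -!/(L _ _) E.
rewrite ![hamming (L _ (x - 1)) _]hammingC.
case: (nbrP u x k) => y; rewrite y in iH act; move=> H; rewrite /def_pot.
  rewrite [hamming _ (L _ (x + 1))]hamming_flip iH hamming_flip.
  by move: H act; case: ifP => _; rewrite ?hamming_flip ?iH; lia.
rewrite [hamming _ (L _ (x - 1))]hamming_flip iH hamming_flip.
by move: H act; case: ifP => _; rewrite ?hamming_flip ?iH; lia.
Qed.

Lemma const_from x (m n : nat) : (m <= n)%N ->
  (forall k, (m <= k < n)%N -> V x k.+1 = V x k) -> V x n = V x m.
Proof.
elim: n => [|n IH]; first by rewrite leqn0 => /eqP ->.
rewrite leq_eqVlt => /orP[/eqP->//|mn] H.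
rewrite H ?ltnSn ?andbT//; apply: IH => // k /andP[mk kn].
by apply: H; rewrite mk ltnW.
Qed.

(** Choose a time [t] past all gains of both ends at which the edge is blocked. The first change of
    an end after [t] would still find the edge blocked and be a gain, so there is none. *)
Lemma blocked_io_fixates x :
  gains_stop x -> gains_stop (x + 1) ->
  (forall T : nat, exists2 t : R, T%:R <= t & (theta < edge_size F theta u t x)%N) ->
  fixates x.
Proof.
move=> [K0 H0] [K1 H1] io.
pose T := (Num.truncn (Order.max (ring_time u x K0) (ring_time u (x + 1) K1))).+1.
have [t Tt bt] := io T.
have : Order.max (ring_time u x K0) (ring_time u (x + 1) K1) < t.
  by apply: lt_le_trans Tt; exact: truncnS_gt.
rewrite gt_max => /andP[t0 t1].
have noch y k : y = x \/ y = x + 1 -> t <= ring_time u y k -> V y k.+1 = V y k.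
  move: y k; apply: (ring_ind gu) => y k IH yx tk.
  have Lc z : z = x \/ z = x + 1 -> L (ring_time u y k) z = L t z.
    move=> zx; apply: const_from; first exact: nrings_mono.
    move=> j /andP[tj jk]; apply: IH => //.
    - by rewrite -nringsP.
    - by case: zx yx => -> [] ->; rewrite ?addrK; [left|right; right|right; left|left].
    - by rewrite leNgt -nringsP// -leqNgt.
  apply/eqP/negPn/negP => ch.
  have : (0 < gain F theta (def_pot theta) u y k)%N.
    apply: blocked_gain => //.
    have LV : L (ring_time u y k) y = V y k by exact: left_state_ring.
    case: yx => yE; [right|left]; rewrite -LV yE.
      by rewrite !yE in Lc *; rewrite !Lc; [exact: bt|right|left].
    by rewrite addrK; rewrite !yE in Lc *; rewrite !Lc; [exact: bt|right|left].
  case: yx => yE; rewrite yE ?H0 ?H1//.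
    by rewrite yE in tk; have := lt_le_trans t0 tk; rewrite -nringsP// nrings_ring// => /ltnW.
  by rewrite yE in tk; have := lt_le_trans t1 tk; rewrite -nringsP// nrings_ring// => /ltnW.
exists (L t x), (nrings u x t) => k tk; apply: const_from => // j /andP[tj _].
by apply: noch; [left|rewrite leNgt -nringsP// -leqNgt].
Qed.

(** State of the edge just after the [l]-th ring of [x + 1]: the left value of [x] can be used
    because the two sites never ring together on good configurations. *)
Definition active_after x l : Prop :=
  (1 <= hamming (L (ring_time u (x + 1) l) x) (V (x + 1) l.+1) <= theta)%N.

(** Late changes of [x + 1] against the constant [v] fall into three cases. From agreement the
    change creates one disagreement, an active edge since [theta >= 1]; from a blocked edge it would
    be a gain, and gains have stopped; otherwise the edge was already active after the preceding
    ring. *)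
Lemma active_io x : (0 < theta)%N -> gains_stop (x + 1) ->
  fixates x -> ~ fixates (x + 1) -> forall n, exists2 l, (n <= l)%N & active_after x l.
Proof.
move=> th0 [K1 H1] [v [K HK]] nfix n; apply: contrapT => nact.
have [m Hm] : exists m, forall l, (m <= l)%N -> (K <= nrings u x (ring_time u (x + 1) l))%N.
  have [T KT] := exists_nat_gt (ring_time u x K).
  have [m Tm] := good_inf gu (x + 1) T; exists m => l ml.
  apply: ltnW; rewrite nringsP//; apply: lt_trans KT _; apply: lt_le_trans Tm _.
  exact: ring_time_le.
have Lx l : (m <= l)%N -> L (ring_time u (x + 1) l) x = v by move=> /Hm /HK.
pose N := maxn (maxn m n) K1.
have [l Nl ch] : exists2 l, (N < l)%N & V (x + 1) l.+1 != V (x + 1) l.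
  apply: contrapT => nch; apply: nfix; exists (V (x + 1) N.+1), N.+1 => k Nk.
  apply: const_from => // j /andP[Nj _]; apply/eqP/negPn/negP => ch; apply: nch.
  by exists j.
move: Nl; rewrite !gtn_max -andbA => /and3P[ml nl K1l].
have [i iH E] := change_flip ch.
have nactl k : (n <= k)%N -> (m <= k)%N -> ~~ (1 <= hamming v (V (x + 1) k.+1) <= theta)%N.
  move=> nk mk; apply/negP => a; apply: nact; exists k => //.
  by rewrite /active_after Lx.
have := nactl l.-1; rewrite !(prednK (leq_ltn_trans (leq0n _) ml)).
have -> : (n <= l.-1)%N by move: nl; case: (l).
have -> : (m <= l.-1)%N by move: ml; case: (l).
move=> /(_ isT isT); rewrite negb_and => /orP[|].
  rewrite -ltnNge ltnS leqn0 => H0.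
  have := nactl l (ltnW nl) (ltnW ml); rewrite E hammingC hamming_flip.
  move: H0; rewrite hamming_eq0 => /eqP <-; rewrite eqxx.
  have -> : hamming v v = 0%N by apply/eqP; rewrite hamming_eq0.
  by rewrite /= th0.
rewrite -ltnNge => Hb.
have := @blocked_gain (x + 1) l ch; rewrite addrK Lx ?(ltnW ml)// => /(_ (or_introl Hb)).
by rewrite H1// ltnW.
Qed.

End Fixation.

Section FixationEvents.
Variables (R : realType) (mu : probability (space R) R).
Hypothesis Hmu : uniform_law mu.
Let S : measurableType _ := space R.
Variables (F theta : nat).

Lemma mP_fixed x (v : opinion F) : mP (fun u : S => fixed_at theta u x v).
Proof.
apply: mP_ex => K; apply: mP_all => k; apply: mP_imp; first exact: mP_const.
exact: mfib_val.
Qed.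

Lemma mP_fixates x : mP (fun u : S => fixates F theta u x).
Proof. by apply: mP_ex => v; exact: mP_fixed. Qed.

Lemma mP_gains_stop x : mP (fun u : S => gains_stop F theta u x).
Proof.
by apply: mP_ex => K; apply: mP_all => k; apply: mP_imp; [exact: mP_const|exact: mfib_gain].
Qed.

Lemma gains_stop_as x : Pr mu [set u : S | gains_stop F theta u x] = 1.
Proof.
have gB j : (j <= F)%N -> (def_pot theta j <= theta)%N by rewrite /def_pot leq_subr.
apply: etrans (gains_finite Hmu (potential_def theta) gB).
apply: etrans (shift_law x Hmu (mP_gains_stop 0)).
congr (Pr mu _); apply/seteqP; split=> u [K H]; exists K => k /H.
  by rewrite gain_shift add0r.
by rewrite gain_shift add0r.
Qed.

End FixationEvents.

(** * Propagation of fixation *)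

Section Propagation.
Variables (R : realType) (mu : probability (space R) R).
Hypothesis Hmu : uniform_law mu.
Let S : measurableType _ := space R.
Variables (F theta : nat) (x : int).
Hypothesis theta0 : (0 < theta)%N.

Let y : int := x + 1.
Let V (u : S) z k := val_at F theta u z k.
Let L (u : S) t z := left_state F theta u t z.
Let s (u : S) l := ring_time u y l.

Let late_active K (u : S) l : Prop :=
  (K <= nrings u x (s u l))%N /\ active_after F theta u x l.

(* [l] is the first ring of [y] from the [n]-th on after which the edge [x, y] is
   active while [x] has rung [k >= K] times and has not changed since its [K]-th ring. *)
Definition first_active K n l k (u : S) : Prop :=
  good u /\ (nrings u x (s u l) = k /\ ((K <= k)%N /\
  ((forall k', (K <= k')%N -> (k' <= k)%N -> V u x k' = V u x K) /\
  (active_after F theta u x l /\ ((n <= l)%N /\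
  forall l', (n <= l')%N -> (l' < l)%N -> ~ late_active K u l'))))).

Lemma mP_active l : mP (fun u : S => active_after F theta u x l).
Proof.
apply: (mP_pred2 (fun a b => is_true (1 <= hamming a b <= theta)%N)); last exact: mfib_val.
by apply: mfib_left; exact: measurable_ring.
Qed.

Lemma mP_first_active K n l k : mP (first_active K n l k).
Proof.
have mn l' : mfib (fun u : S => nrings u x (s u l')) by apply: mfib_nrings; exact: measurable_ring.
apply: mP_and; first exact: mP_good.
apply: mP_and; first exact: mn.
apply: mP_and; first exact: mP_const.
apply: mP_and.
  apply: mP_all => k'; do 2 (apply: mP_imp; first exact: mP_const).
  exact: mP_val_eq.
apply: mP_and; first exact: mP_active.
apply: mP_and; first exact: mP_const.
apply: mP_all => l'; do 2 (apply: mP_imp; first exact: mP_const).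
apply: mP_not; apply: mP_and; last exact: mP_active.
by apply: (mP_pred (fun m => is_true (K <= m)%N)).
Qed.

(** Coupling with the zero twist: the event is decided by the randomness used up to the [l]-th ring
    of [y]. *)
Lemma first_active_past K n l k (u u' : S) : good u' ->
  s u' l = s u l ->
  (forall z j, ring_time u z j <= s u l \/ ring_time u' z j <= s u l ->
    [/\ ring_time u' z j = ring_time u z j, ring_nbr u' z j = ring_nbr u z j &
        u' (Iss z j) = u (Iss z j)]) ->
  (forall z i, u' (Init z i) = u (Init z i)) ->
  first_active K n l k u -> first_active K n l k u'.
Proof.
move=> gu' sl same ini [gu [nk [Kk [cst [act [nl nact]]]]]].
have inix z : init_opinion F u' z = xor (xor0 F) (init_opinion F u z).
  by rewrite xor0E; apply/ffunP => i; rewrite !ffunE ini.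
pose w := fun _ : int => xor0 F.
have blk z j : ring_time u z j <= s u l -> w z = w (ring_nbr u z j) \/
   (~~ (1 <= hamming (V u z j) (L u (ring_time u z j) (ring_nbr u z j)) <= theta)%N /\
   ~~ (1 <= hamming (xor (w z) (V u z j))
        (xor (w (ring_nbr u z j)) (L u (ring_time u z j) (ring_nbr u z j))) <= theta)%N) by left.
have Nt z t : t <= s u l -> nrings u' z t = nrings u z t by exact: coupling_nrings.
have Lt z t : t <= s u l -> L u' t z = L u t z.
  by move=> ts; rewrite /L (coupling_left gu gu' same inix blk)// xor0E.
have Vt z j : ring_time u z j <= s u l -> V u' z j.+1 = V u z j.+1.
  by move=> ts; rewrite /V (coupling_val gu gu' same inix blk)// xor0E.
have Vx k' : (k' <= k)%N -> V u' x k' = V u x k'.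
  case: k' => [_|k' k'k]; first by rewrite /V !val0 inix xor0E.
  by apply/Vt/ltW; rewrite -nringsP// nk.
have sl' l' : (l' <= l)%N -> s u' l' = s u l' /\ s u l' <= s u l.
  move=> ll; have le := ring_time_le gu y ll; split=> //.
  by have [e _ _] := same y l' (or_introl le).
have acte l' : (l' <= l)%N -> active_after F theta u' x l' <-> active_after F theta u x l'.
  move=> /sl'[e le]; rewrite /active_after -/y -!/(s _ l') e.
  by rewrite -!/(L _ _ _) Lt// -!/(V _ _ _) Vt.
split=> //; split; first by rewrite sl Nt.
split=> //; split.
  by move=> k' Kk' k'k; rewrite !Vx// cst.
split; first exact/acte.
split=> // l' nl' l'l [Kl' a']; apply: (nact l' nl' l'l); have [e le] := sl' l' (ltnW l'l).
by split; [rewrite -Nt// -e|exact/(acte l' (ltnW l'l))].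
Qed.

(** Probability that an exponential waiting time exceeds 1; multiplying a uniform by [c] lengthens
    its waiting time by exactly 1. *)
Let c : R := expR (-1).

Let c01 : 0 < c <= 1.
Proof. by rewrite /c expR_gt0/= -expR0 ler_expR oppr_le0. Qed.

Let c1 : c < 1.
Proof. by rewrite /c -expR0 ltr_expR oppr_lt0. Qed.

(** Memoryless property. Scaling [u (Wait x k)] by [c] delays the [k]-th and all later rings of [x]
    by 1, which the past up to the [l]-th ring of [y] does not notice; [scale_law] turns this into a
    factor [c]. *)
Lemma residual K n l k :
  Pr mu [set u : S | first_active K n l k u /\ s u l + 1 < ring_time u x k] <=
  c * Pr mu [set u : S | first_active K n l k u].
Proof.
pose j := Wait x k.
pose T : S -> S := coordmap id (fun i r => if i == j then c * r else r).
have mC := mP_first_active K n l k.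
pose C1 := fun u : S => first_active K n l k u /\ s u l + 1 < ring_time u x k.
have mC1 : mP C1.
  apply: mP_and => //; apply: mP_lt; last exact: measurable_ring.
  by apply: measurable_funD; [exact: measurable_ring|exact: measurable_cst].
have mT : mP (fun u : S => C1 (T u)).
  have mT : measurable_fun setT T.
    by apply: measurable_coordmap => i; case: (i == j); [exact: mulrl_measurable|exact: measurable_id].
  by rewrite /mP -[X in measurable X]setTI; exact: (mT measurableT [set u | C1 u]).
have xy : x != y by rewrite /y; lia.
have := scale_law Hmu j c01 mC1; rewrite -/T => H.
have -> : Pr mu [set u : S | C1 u] = Pr mu ([set u : S | C1 u] `&` [set u : S | 0 <= u j <= c]).
  congr (Pr mu _); apply/seteqP; split=> u; last by case.
  move=> C1u; split=> //; have [[gu [nk _]] lt] := C1u.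
  have /andP[u0 u1] := good_wait gu x k.
  rewrite /= (ltW u0)/= -(@ler_ln _ (u j) c) ?posrE ?expR_gt0// /c expRK.
  have : ring_time u x k <= s u l + - ln (u j).
    have s0 : 0 < s u l by exact: ring_time_gt0.
    rewrite /j; case E : k => [|k']; first by rewrite ring_time0 lerDr ltW.
    rewrite ring_timeS lerD2r; apply: ltW; rewrite -(nringsP gu) nk E //.
  by move: lt; rewrite /j; lra.
rewrite -H; apply: ler_wpM2l; first by case/andP: c01 => /ltW.
apply: (Pr_le_ae mT mC (measurable_good R) (good_as Hmu)) => u gu [[gu' FA] lt].
have rt z i : z != x \/ (i < k)%N -> ring_time (T u) z i = ring_time u z i.
  move=> zi; apply: eq_bigr => m _; rewrite /T /coordmap; case: eqP => // -[zx mk].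
  by case: zi; rewrite ?zx ?eqxx// -mk ltnNge -ltnS ltn_ord.
have rtk i : (k <= i)%N -> ring_time (T u) x i = ring_time u x i + 1.
  have /andP[u0 _] := good_wait gu x k; have /andP[cp _] := c01.
  have base : ring_time (T u) x k = ring_time u x k + 1.
    case E : k => [|k'].
      by rewrite !ring_time0 /T /coordmap -E -/j eqxx lnM ?posrE// /c expRK; lra.
    rewrite !ring_timeS rt; last by right; rewrite E.
    by rewrite -E /T /coordmap -/j eqxx lnM ?posrE// /c expRK; lra.
  elim: i => [|i IH]; first by rewrite leqn0 => /eqP k0; rewrite k0 in base.
  rewrite leq_eqVlt => /orP[/eqP <-//|ki].
  rewrite !ring_timeS IH// /T /coordmap; case: eqP => [[ik]|_]; last by ring.
  by move: ki; rewrite ik ltnn.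
have yx : y != x by rewrite eq_sym.
have sT i : s (T u) i = s u i by apply: rt; left.
have lt' : s u l < ring_time u x k.
  by move: lt; rewrite sT rtk//; lra.
apply: (first_active_past gu _ _ _ (conj gu' FA)); first by rewrite sT.
  move=> z i; rewrite sT => H2.
  have zi : z != x \/ (i < k)%N.
    case: (eqVneq z x) => [zx|]; [right|by left].
    rewrite ltnNge; apply/negP => ki; subst z.
    have a := lt_le_trans lt' (ring_time_le gu x ki).
    by case: H2; rewrite ?rtk// => b; lra.
  by rewrite rt//; split=> //; rewrite /T /coordmap.
by move=> z i; rewrite /T /coordmap.
Qed.

(** The next ring of [y] waits at least 1 and that of [x] comes within 1, so the edge is as the
    activation left it when [x] rings and selects [y]. The bound 1/4 yields the strict inequality of
    [ring_nbr] from an event with [<=]. *)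
Lemma first_active_success K n l k (u : S) :
  first_active K n l k u -> ring_time u x k <= s u l + 1 ->
  u (Wait y l.+1) <= c -> u (Dir x k) <= 4^-1 -> V u x k.+1 != V u x k.
Proof.
move=> [gu [nk [_ [_ [act _]]]]] le w1 d1.
have xy : x != y by rewrite /y; lia.
have nb : ring_nbr u x k = y.
  by rewrite /ring_nbr (_ : u (Dir x k) < 2^-1)//; apply: le_lt_trans d1 _; rewrite ltf_pV2 ?posrE// ltr_nat.
have lt1 : s u l < ring_time u x k.
  rewrite lt_neqAle good_neq ?(eq_sym y)//= leNgt -(nringsP gu) nk ltnn //.
have lt2 : ring_time u x k < ring_time u y l.+1.
  rewrite lt_neqAle good_neq//= ring_timeS; apply: le_trans le _.
  rewrite lerD2l; have /andP[u0 _] := good_wait gu y l.+1.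
  by move: w1; rewrite -(@ler_ln _ _ c) ?posrE ?expR_gt0// /c expRK; lra.
apply: active_change => //; rewrite nb.
have -> : left_state F theta u (ring_time u x k) y = V u y l.+1.
  rewrite /left_state; congr val_at; apply/eqP; rewrite eqn_leq nringsP// lt1 andbT.
  by rewrite leqNgt nringsP// -leNgt ltW.
by move: act; rewrite /active_after -/y -/(s u l) /left_state nk.
Qed.

(** Lower bound for a success: [1 - c] for a ring of [x] within 1, [c] for the silence of [y] during
    1, [4^-1] for the choice of [y]. *)
Let del : R := (1 - c) * (c * 4^-1).

(** The coordinates [Wait y l.+1] and [Dir x k] enter only after the activation; the event [D], past
    plus a short residual time of [x], does not depend on them on good configurations, hence the
    product in [PDE]. *)
Lemma success_prob K n l k :
  Pr mu [set u : S | first_active K n l k u /\ V u x k.+1 = V u x k] <=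
  (1 - del) * Pr mu [set u : S | first_active K n l k u].
Proof.
have mC := mP_first_active K n l k.
have mr := measurable_ring.
have ms : mP (fun u : S => s u l + 1 < ring_time u x k).
  apply: mP_lt; last exact: measurable_ring.
  by apply: measurable_funD; [exact: measurable_ring|exact: measurable_cst].
pose D : set S := [set u | first_active K n l k u /\ ~ (s u l + 1 < ring_time u x k)].
have mD : measurable D.
  change (mP (fun u : S => first_active K n l k u /\ ~ (s u l + 1 < ring_time u x k))).
  by apply: mP_and => //; exact: mP_not.
have mVV : mP (fun u : S => V u x k.+1 = V u x k).
  exact: mP_val_eq.
pose j2 := Wait y l.+1; pose j3 := Dir x k.
pose E : set S := [set u | u j2 <= c] `&` [set u | u j3 <= 4^-1].
have mE : measurable E by apply: measurableI; exact: mle.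
have PE : Pr mu E = c * 4^-1.
  pose A i := (if i == j2 then `]-oo, c] else `]-oo, 4^-1])%classic : set R.
  have mA i : measurable (A i) by rewrite /A; case: ifP => _; exact: measurable_itv.
  have uj : uniq [:: j2; j3] by [].
  have Aj2 : A j2 = `]-oo, c]%classic by rewrite /A eqxx.
  have Aj3 : A j3 = `]-oo, 4^-1]%classic by rewrite /A; case: eqP.
  have -> : E = [set u : S | forall i, i \in [:: j2; j3] -> A i (u i)].
    apply/seteqP; split=> u.
      by move=> [e2 e3] i; rewrite !inE => /orP[]/eqP ->; rewrite ?Aj2 ?Aj3; [exact: e2|exact: e3].
    move=> H; split.
      by have := H j2; rewrite mem_head Aj2 => /(_ isT).
    by have := H j3; rewrite !inE eqxx orbT Aj3 => /(_ isT).
  rewrite (law_cyl Hmu uj mA) !big_cons big_nil mulr1.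
  have e2 : Pr mu [set u : S | A j2 (u j2)] = c.
    rewrite Aj2; change (Pr mu [set u : S | u j2 <= c] = c).
    by rewrite law_coord// min_r ?max_r//; case/andP: c01 => // /ltW.
  have e3 : Pr mu [set u : S | A j3 (u j3)] = 4^-1.
    rewrite Aj3; change (Pr mu [set u : S | u j3 <= 4^-1] = 4^-1).
    by rewrite law_coord// min_r ?max_r ?invr_ge0// invf_le1// ler1n.
  by rewrite e2 e3.
have PD : (1 - c) * Pr mu [set u : S | first_active K n l k u] <= Pr mu D.
  have := Pr_split mu mC ms; rewrite (_ : _ `\` _ = D)// => ->.
  have := residual K n l k.
  rewrite (_ : [set u | _ /\ _] = [set u | first_active K n l k u] `&` [set u | s u l + 1 < ring_time u x k])//.
  have := Pr_split mu mC ms; rewrite (_ : _ `\` _ = D)//.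
  set a := Pr mu _; set b := Pr mu _; set d := Pr mu _ => -> ; lra.
have PDE : Pr mu (D `&` E) = Pr mu D * (c * 4^-1).
  rewrite -PE; apply: (indep Hmu (I := fun i => (i != j2) && (i != j3)) (measurable_good R)) => //.
  - exact: good_as.
  - move=> u v gu gv uv [Cu nlt].
    have uvw z i : Wait z i != j2 -> u (Wait z i) = v (Wait z i).
      by move=> ne; apply: uv; rewrite ne.
    have rt z i : z != y \/ (i <= l)%N -> ring_time v z i = ring_time u z i.
      move=> zi; apply: eq_bigr => m _; rewrite uvw//.
      apply/eqP => -[zy ml]; case: zi; rewrite ?zy ?eqxx// => il.
      by have := ltn_ord m; rewrite ml ltnS ltnNge il.
    have xy : x != y by rewrite /y; lia.
    have st : s v l = s u l by apply: rt; right.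
    have [_ [nk _]] := Cu.
    split; last by rewrite st rt//; left.
    have lek : s u l < ring_time u x k.
      by rewrite lt_neqAle good_neq ?(eq_sym y)//= leNgt -(nringsP gu) nk ltnn.
    have lek' : s u l < ring_time v x k by rewrite rt//; left.
    apply: (first_active_past gv _ _ _ Cu) => //.
      move=> z i H2.
      have zi : z != y \/ (i <= l)%N.
        case: (eqVneq z y) => [zy|]; [right|by left]; subst z.
        rewrite leqNgt; apply/negP => li.
        have a := ring_time_lt gu y li.
        have b := ring_time_lt gv y li; rewrite -/(s v l) st in b.
        by case: H2; rewrite leNgt ?a ?b.
      have zik : z != x \/ i != k.
        case: (eqVneq z x) => [zx|]; [right|by left]; subst z.
        apply/eqP => ik; subst i.
        by case: H2; rewrite leNgt ?lek ?lek'.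
      rewrite rt//; split=> //; last by rewrite -uv.
      rewrite /ring_nbr -uv//=; apply/eqP => -[zx ik].
      by case: zik; rewrite ?zx ?ik eqxx.
    by move=> z i; rewrite -uv.
  - move=> u v uv [e2 e3].
    have u2 : u j2 = v j2 by apply: uv; rewrite /= eqxx.
    have u3 : u j3 = v j3 by apply: uv; rewrite /= eqxx ?andbF.
    by split; rewrite /= -?u2 -?u3.
have := Pr_split mu mC mVV; rewrite (_ : _ `&` _ = [set u : S | first_active K n l k u /\ V u x k.+1 = V u x k])//.
set B := _ `\` _ => eqC.
have mB : measurable B by exact: measurableD.
have : Pr mu (D `&` E) <= Pr mu B.
  apply: Pr_le => //; first exact: measurableI.
  move=> u [[Cu /negP nlt] [e2 e3]]; split=> //; apply/eqP.
  by apply: (first_active_success Cu) => //; rewrite leNgt.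
rewrite PDE => le.
have : (1 - c) * Pr mu [set u : S | first_active K n l k u] * (c * 4^-1) <= Pr mu D * (c * 4^-1).
  by apply: ler_wpM2r => //; rewrite mulr_ge0 ?invr_ge0//; case/andP: c01 => /ltW.
move: eqC; rewrite /del.
set a := Pr mu [set u : S | first_active K n l k u]; set b := Pr mu _; set d := Pr mu D in le *.
move: le; set e := Pr mu B; set f := c * 4^-1 => *; nra.
Qed.

Let del0 : 0 < del.
Proof.
by rewrite /del mulr_gt0 ?subr_gt0// mulr_gt0 ?invr_gt0//; case/andP: c01.
Qed.

Let del1 : del <= 1.
Proof.
have /andP[cp cl] := c01; have q : 0 <= c * 4^-1 <= 1 by apply/andP; split; lra.
by case/andP: q => q0 q1; apply: mulr_ile1 => //; lra.
Qed.

Definition stuck K (u : S) : Prop := good u /\ ((forall k, (K <= k)%N -> V u x k = V u x K) /\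
  forall n, exists l, (n <= l)%N /\ active_after F theta u x l).

Lemma mP_stuck K : mP (stuck K).
Proof.
apply: mP_and; first exact: mP_good.
apply: mP_and.
  apply: mP_all => k; apply: mP_imp; first exact: mP_const.
  exact: mP_val_eq.
apply: mP_all => n; apply: mP_ex => l; apply: mP_and; first exact: mP_const.
exact: mP_active.
Qed.

(** On [stuck K] the site [x] never changes again, so for each [n] the first activation from [n] on
    is a failed trial, and the probability p of the event is at most [1 - del] times that of [Z n].
    The events [Z n] decrease to a subset of [stuck K], which yields p <= (1 - del) p. *)
Lemma no_active_forever K : Pr mu [set u : S | stuck K u] = 0.
Proof.
set St := [set u | _]; have mSt : measurable St by exact: mP_stuck.
pose Z n : set S := [set u | exists l k, first_active K n l k u].
have mZ n : measurable (Z n).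
  by apply: (@mP_ex _ S) => l; apply: mP_ex => k; exact: mP_first_active.
have stZ u n : St u -> exists l k, first_active K n l k u /\ V u x k.+1 = V u x k.
  move=> [gu [cst io]].
  have [m Hm] : exists m, forall l, (m <= l)%N -> (K <= nrings u x (s u l))%N.
    have [T KT] := exists_nat_gt (ring_time u x K).
    have [m Tm] := good_inf gu y T; exists m => l ml.
    apply: ltnW; rewrite nringsP//; apply: lt_trans KT _; apply: lt_le_trans Tm _.
    exact: ring_time_le.
  have ex : exists l, (n <= l)%N && `[< late_active K u l >].
    have [l [nml al]] := io (maxn n m); move: nml; rewrite geq_max => /andP[nl ml].
    by exists l; rewrite nl; apply/asboolP; split=> //; exact: Hm.
  have [l /andP[nl /asboolP[Kl al]] lmin] := ex_minnP ex.
  exists l, (nrings u x (s u l)); split; last by rewrite !cst// ltnW.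
  split=> //; split=> //; split=> //; split; first by move=> k' Kk' _; rewrite cst.
  split=> //; split=> // l' nl' l'l la.
  by have := lmin l'; rewrite nl' leqNgt l'l asboolT// => /(_ isT).
have step n e : 0 < e -> Pr mu St <= (1 - del) * Pr mu (Z n) + e.
  move=> e0.
  (* The indices [l] and [k] are bounded to make the disjoint sum finite; [M] is then taken
     large. *)
  pose W M : set S := [set u | exists p : 'I_M * 'I_M, first_active K n p.1 p.2 u /\ V u x p.2.+1 = V u x p.2].
  have mCV l k : mP (fun u => first_active K n l k u /\ V u x k.+1 = V u x k).
    apply: mP_and; first exact: mP_first_active.
    exact: mP_val_eq.
  have mW M : measurable (W M).
    by apply: (@mP_ex _ S _ (fun (p : 'I_M * 'I_M) u => first_active K n p.1 p.2 u /\ V u x p.2.+1 = V u x p.2)).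
  have incW M : W M `<=` W M.+1.
    by move=> u [[l k] H]; exists (widen_ord (leqnSn M) l, widen_ord (leqnSn M) k).
  have [M HM] := Pr_incr mu mW incW e0.
  apply: (@le_trans _ _ (Pr mu (\bigcup_M W M))).
    apply: Pr_le => //; first exact: bigcupT_measurable.
    move=> u /(stZ _ n)[l [k H]]; exists (maxn l k).+1 => //.
    by exists (Ordinal (leq_maxl l k : (l < (maxn l k).+1)%N), Ordinal (leq_maxr l k : (k < (maxn l k).+1)%N)).
  apply: le_trans HM _; rewrite lerD2r.
  have uniqlk l k l' k' u : first_active K n l k u -> first_active K n l' k' u -> l = l' /\ k = k'.
    move=> [gu [nk [Kk [_ [al [nl na]]]]]] [_ [nk' [Kk' [_ [al' [nl' na']]]]]].
    have ll : l = l'.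
      case: (ltngtP l l') => // h.
        by case: (na' l nl h); split=> //; rewrite nk.
      by case: (na l' nl' h); split=> //; rewrite nk'.
    by split=> //; rewrite -nk -nk' ll.
  have dj (p q : 'I_M * 'I_M) u : first_active K n p.1 p.2 u -> first_active K n q.1 q.2 u -> p = q.
    by case: p q => [l k] [l' k'] /= /uniqlk h /h [/val_inj -> /val_inj ->].
  have -> : Pr mu (W M) = \sum_(p : 'I_M * 'I_M) Pr mu [set u : S | first_active K n p.1 p.2 u /\ V u x p.2.+1 = V u x p.2].
    apply: (Pr_sum mu (F := fun p : 'I_M * 'I_M => [set u : S | first_active K n p.1 p.2 u /\ V u x p.2.+1 = V u x p.2])).
      by move=> p; exact: mCV.
    by move=> p q u [h _] [h' _]; exact: dj h h'.
  apply: (@le_trans _ _ (\sum_(p : 'I_M * 'I_M) (1 - del) * Pr mu [set u : S | first_active K n p.1 p.2 u])).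
    by apply: ler_sum => p _; exact: success_prob.
  rewrite -mulr_sumr; apply: ler_wpM2l.
    by rewrite subr_ge0.
  rewrite -(Pr_sum mu (F := fun p : 'I_M * 'I_M => [set u : S | first_active K n p.1 p.2 u])).
  - apply: Pr_le; [|exact: mZ|].
      apply: (@mP_ex _ S _ (fun (p : 'I_M * 'I_M) u => first_active K n p.1 p.2 u)) => p.
      exact: mP_first_active.
    by move=> u [[l k] H]; exists l, k.
  - by move=> p; exact: mP_first_active.
  - by move=> p q u; exact: dj.
have decZ n : Z n.+1 `<=` Z n.
  move=> u [l [k [gu [nk [Kk [cst [al [nl na]]]]]]]].
  have [la|nla] := pselect (late_active K u n); last first.
    exists l, k; split=> //; split=> //; split=> //; split=> //; split=> //; split; first exact: ltnW.
    move=> l' nl' l'l; move: nl'; rewrite leq_eqVlt => /orP[/eqP <-//|nl'].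
    exact: na.
  have [Kn an] := la; exists n, (nrings u x (s u n)).
  split=> //; split=> //; split=> //; split.
    move=> k' Kk' k'n; apply: cst => //; apply: leq_trans k'n _; rewrite -nk.
    by apply: nrings_mono => //; apply: ring_time_le => //; exact: ltnW.
  by split=> //; split=> // l' a b; move: (leq_ltn_trans a b); rewrite ltnn.
have capZ : \bigcap_n Z n `<=` St.
  move=> u H; have [_ [_ [gu _]]] := H 0%N Logic.I.
  split=> //; split; last first.
    by move=> n; have [l [k [_ [_ [_ [_ [al [nl _]]]]]]]] := H n Logic.I; exists l.
  move=> k Kk.
  have [T KT] := exists_nat_gt (ring_time u x k).
  have [m Tm] := good_inf gu y T.
  have [l [k' [_ [nk' [_ [cst [_ [ml _]]]]]]]] := H m Logic.I.
  apply: cst => //; rewrite -nk'; apply: ltnW; rewrite nringsP//.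
  by apply: lt_trans KT _; apply: lt_le_trans Tm _; exact: ring_time_le.
apply/eqP; rewrite eq_le Pr_ge0 andbT.
apply/ler_addgt0Pr => e e0; rewrite add0r.
have e'0 : 0 < del * e / 2 by rewrite divr_gt0// mulr_gt0.
have [n Hn] := Pr_decr mu mZ decZ e'0.
have hS := step n _ e'0.
have mI : measurable (\bigcap_n Z n) by exact: bigcapT_measurable.
have hI := Pr_le mu mI mSt capZ.
have d1 := del1.
move: Hn hS hI del0 d1 e0; set a := Pr mu St; set b := Pr mu (Z n); set d := Pr mu (\bigcap_n Z n).
move=> h1 h2 h3 h4 h5 h6.
have : (1 - del) * b <= (1 - del) * (a + del * e / 2).
  by apply: ler_wpM2l; lra.
move=> h7; have h8 : del * a <= del * e by nra.
by rewrite -(ler_pM2l h4).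
Qed.

Lemma propagation : Pr mu [set u : S | fixates F theta u x -> fixates F theta u (x + 1)] = 1.
Proof.
have mfix z : mP (fun u : S => fixates F theta u z) by exact: mP_fixates.
have mG : measurable [set u : S | gains_stop F theta u (x + 1)] by exact: mP_gains_stop.
pose B K : set S := [set u | stuck K u].
have mB K : measurable (B K) by exact: mP_stuck.
have mUB : measurable (\bigcup_K B K) by exact: bigcupT_measurable.
have PB : Pr mu (~` \bigcup_K B K) = 1.
  by rewrite PrC// Pr_bigcup0 ?subr0// => K; exact: no_active_forever.
have mgG := measurableI _ _ (measurable_good R) mG.
have PgG := Pr1_I (measurable_good R) mG (good_as Hmu) (gains_stop_as Hmu F theta (x + 1)).
apply: (Pr1_sub _ (measurableI _ _ (measurableC mUB) mgG)).
- change (mP (fun u : S => fixates F theta u x -> fixates F theta u (x + 1))).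
  exact: mP_imp.
- by apply: Pr1_I => //; exact: measurableC.
move=> u [nB [gu Gu]] fx; apply: contrapT => nfix; apply: nB.
have [v [K HK]] := fx; exists K => //; split=> //; split.
  by move=> k Kk; rewrite /V !HK.
by move=> n; have [l nl al] := active_io gu theta0 Gu fx nfix n; exists l.
Qed.

End Propagation.

(** * A zero-one law *)

Section ZeroOne.
Variables (R : realType) (mu : probability (space R) R).
Hypothesis Hmu : uniform_law mu.
Let S : measurableType _ := space R.
Implicit Types (A B : set S).

Definition site (j : idx) : int :=
  match j with Init x _ => x | Wait x _ => x | Dir x _ => x | Iss x _ => x end.

Definition near_origin (n : nat) : pred idx := fun j => (`|site j| <= n)%N.

Lemma depends_le n m A : (n <= m)%N -> depends (near_origin n) A -> depends (near_origin m) A.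
Proof.
by move=> nm H u v uv; apply: H => j jn; apply: uv; exact: leq_trans jn nm.
Qed.

(** Approximation in probability by events on finitely many sites. Such sets form a sigma-algebra
    containing the rays; both differences are recorded so that complements are immediate. *)
Let approx B : Prop := measurable B /\ forall e : R, 0 < e -> exists n A,
  [/\ measurable A, depends (near_origin n) A, Pr mu (B `\` A) <= e & Pr mu (A `\` B) <= e].

Lemma approx_ray s a : approx (ray s a).
Proof.
split; first exact: measurable_ray.
move=> e e0; exists (\max_(j <- s) `|site j|)%N, (ray s a); split.
- exact: measurable_ray.
- move=> u v uv Hu j js; rewrite -uv; first exact: Hu.
  by rewrite /near_origin (big_rem j js)/= leq_maxl.
- by rewrite setDv Pr0 ltW.
- by rewrite setDv Pr0 ltW.
Qed.

Lemma approxC B : approx B -> approx (~` B).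
Proof.
move=> [mB H]; split; first exact: measurableC.
move=> e e0; have [n [A [mA dA h1 h2]]] := H e e0.
exists n, (~` A); split.
- exact: measurableC.
- by move=> u v uv nA Av; apply: nA; apply: dA Av => j jn; rewrite uv.
- by rewrite setDE setCK setIC -setDE.
- by rewrite setDE setCK setIC -setDE.
Qed.

Lemma approxU B B' : approx B -> approx B' -> approx (B `|` B').
Proof.
move=> [mB H] [mB' H']; split; first exact: measurableU.
move=> e e0; have e2 : 0 < e / 2 by lra.
have [n [A [mA dA h1 h2]]] := H _ e2; have [n' [A' [mA' dA' h1' h2']]] := H' _ e2.
exists (maxn n n'), (A `|` A'); split.
- exact: measurableU.
- move=> u v uv [Au|Au]; [left|right].
    by apply: (depends_le (leq_maxl n n') dA uv).
  by apply: (depends_le (leq_maxr n n') dA' uv).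
- apply: (@le_trans _ _ (Pr mu ((B `\` A) `|` (B' `\` A')))).
    apply: Pr_le.
    + by apply: measurableD; exact: measurableU.
    + by apply: measurableU; exact: measurableD.
    + move=> u [[Bu|Bu] nA]; [left|right]; split=> // ?; apply: nA; by [left|right].
  apply: le_trans (Pr_leU _ _ _) _; [exact: measurableD|exact: measurableD|lra].
- apply: (@le_trans _ _ (Pr mu ((A `\` B) `|` (A' `\` B')))).
    apply: Pr_le.
    + by apply: measurableD; exact: measurableU.
    + by apply: measurableU; exact: measurableD.
    + move=> u [[Bu|Bu] nA]; [left|right]; split=> // ?; apply: nA; by [left|right].
  apply: le_trans (Pr_leU _ _ _) _; [exact: measurableD|exact: measurableD|lra].
Qed.

Lemma approx_bigcup (B : nat -> set S) : (forall i, approx (B i)) -> approx (\bigcup_i B i).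
Proof.
move=> H; have mU : measurable (\bigcup_i B i) by apply: bigcupT_measurable => i; exact: (H i).1.
split=> // e e0; have e2 : 0 < e / 2 by lra.
pose C n := \bigcup_(i in [set i | (i <= n)%N]) B i.
have CS n : C n.+1 = C n `|` B n.+1.
  apply/seteqP; split=> u.
    move=> [i /=]; rewrite leq_eqVlt => /orP[/eqP->|]; first by right.
    by rewrite ltnS => ? ?; left; exists i.
  move=> [[i /= ni Bi]|Bn]; first by exists i => //=; exact: leqW.
  by exists n.+1 => /=.
have aC n : approx (C n).
  elim: n => [|n IH]; last by rewrite CS; exact: approxU.
  have -> : C 0%N = B 0%N.
    apply/seteqP; split=> u; first by move=> [i /=]; rewrite leqn0 => /eqP ->.
    by exists 0%N => /=.
  exact: H.
have CB : \bigcup_n C n = \bigcup_i B i.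
  apply/seteqP; split=> u; first by move=> [n _ [i _ ?]]; exists i.
  by move=> [i _ Bi]; exists i => //; exists i => /=.
have mC n : measurable (C n) by exact: (aC n).1.
have [|n Hn] := Pr_incr mu mC _ e2; first by move=> n; rewrite CS; left.
rewrite CB in Hn.
have [m [A [mA dA h1 h2]]] := (aC n).2 _ e2.
have CnB : C n `<=` \bigcup_i B i by rewrite -CB; exact: bigcup_sup.
exists m, A; split=> //.
- apply: (@le_trans _ _ (Pr mu (((\bigcup_i B i) `\` C n) `|` (C n `\` A)))).
    have m1 := measurableD mU (mC n); have m2 := measurableD (mC n) mA.
    apply: Pr_le; [exact: measurableD|exact: measurableU|].
    by move=> u [Bu nA]; have [Cu|nC] := pselect (C n u); [right|left].
  have m1 := measurableD mU (mC n); have m2 := measurableD (mC n) mA.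
  apply: le_trans (Pr_leU mu m1 m2) _.
  have := Pr_split mu mU (mC n).
  have -> : (\bigcup_i B i) `&` C n = C n by rewrite setIC; exact/setIidPl.
  move: Hn h1; set a := Pr mu (\bigcup_i B i); set b := Pr mu (C n).
  set c := Pr mu (_ `\` C n); set d := Pr mu (C n `\` A) => *; lra.
- apply: (@le_trans _ _ (Pr mu (A `\` C n))); last by apply: le_trans h2 _; lra.
  have m1 := measurableD mA mU; have m2 := measurableD mA (mC n).
  apply: (Pr_le mu m1 m2).
  by move=> u [Au nB]; split=> // /CnB.
Qed.

Lemma approx_measurable B : measurable B -> approx B.
Proof.
move=> mB; suff : <<s @rays R >> `<=` approx by exact.
apply: smallest_sub; last by move=> _ [s [a ->]]; exact: approx_ray.
split.
- split; first exact: measurable0.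
  move=> e e0; exists 0%N, set0; split; first exact: measurable0.
  + by move=> u v _ [].
  + by rewrite set0D Pr0 ltW.
  + by rewrite set0D Pr0 ltW.
- by move=> A aA; rewrite setTD; exact: approxC.
- exact: approx_bigcup.
Qed.

(** Translate an approximation [A] of [B] far enough to be independent of it: [A] and its translate
    both approximate the invariant [B], so p is arbitrarily close to p^2. *)
Lemma zero_one B : measurable B -> (forall m u, B (shift m u) <-> B u) ->
  Pr mu B = 0 \/ Pr mu B = 1.
Proof.
move=> mB inv; have [_ H] := approx_measurable mB.
pose p := Pr mu B.
have p0 : 0 <= p by exact: Pr_ge0.
have p1 : p <= 1 by exact: Pr_le1.
suff : p <= p ^+ 2.
  move=> pp; have : p * (1 - p) <= 0 by rewrite mulrBr mulr1 subr_le0.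
  move=> h; have : p * (1 - p) = 0 by apply/eqP; rewrite eq_le h mulr_ge0// subr_ge0.
  by move=> /eqP; rewrite mulf_eq0 subr_eq0 => /orP[/eqP h0|/eqP h1]; [left|right].
apply/ler_addgt0Pr => e0' e0'0.
(* The 5 comes from (p + e)^2 + 2 e <= p^2 + 5 e for p and e at most 1. *)
pose e := Order.min (e0' / 5) 1.
have e0 : 0 < e by rewrite lt_min ltr01 andbT divr_gt0.
have e1 : e <= 1 by rewrite ge_min lexx orbT.
have e5 : e * 5 <= e0' by rewrite -ler_pdivlMr// ge_min lexx.
have [n [A [mA dA h1 h2]]] := H _ e0.
(* The sites within [n] of the origin and their translates by 2 n + 1 are disjoint. *)
pose m : int := (2 * n).+1%:Z.
pose A' := shift m @^-1` A.
have mA' : measurable A' by exact: (mP_shift m mA).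
have PA' : Pr mu A' = Pr mu A by exact: shift_law.
have ind : Pr mu (A `&` A') = Pr mu A * Pr mu A'.
  apply: (indep Hmu (I := near_origin n) measurableT) => //; first exact: PrT.
    by move=> u v _ _ uv; exact: dA.
  move=> u v uv; rewrite /A'; apply: dA => j jn; apply: uv.
  by move: jn; rewrite /near_origin /= /m; case: j => x i /=; lia.
have PBA' : Pr mu (B `\` A') <= e.
  have -> : B `\` A' = shift m @^-1` (B `\` A).
    by apply/seteqP; split=> u [Bu nA]; split=> //; apply/(inv m).
  by rewrite shift_law//; exact: measurableD.
have mAA' := measurableI _ _ mA mA'.
have le : p <= Pr mu A ^+ 2 + e * 2.
  rewrite expr2 -{2}PA' -ind.
  apply: (@le_trans _ _ (Pr mu ((A `&` A') `|` ((B `\` A) `|` (B `\` A'))))).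
    apply: Pr_le => //.
      by apply: measurableU => //; apply: measurableU; exact: measurableD.
    move=> u Bu; have [Au|nA] := pselect (A u); last by right; left.
    by have [A'u|nA] := pselect (A' u); [left|right; right].
  have mBA := measurableD mB mA; have mBA' := measurableD mB mA'.
  apply: le_trans (Pr_leU mu mAA' (measurableU _ _ mBA mBA')) _.
  have := Pr_leU mu mBA mBA'.
  move: h1 PBA'; set a := Pr mu (A `&` A'); set b := Pr mu (B `\` A); set c := Pr mu (B `\` A').
  by set d := Pr mu (_ `|` _) => *; lra.
have qa : Pr mu A <= p + e.
  have := Pr_split mu mA mB => ->; apply: lerD => //.
  by apply: Pr_le; [exact: measurableI|exact: mB|move=> u []].
have q0 : 0 <= Pr mu A by exact: Pr_ge0.
move: le qa q0 e0 e1 e5 p0 p1; set q := Pr mu A => le qa q0 *.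
have : q ^+ 2 <= (p + e) ^+ 2 by rewrite ler_pXn2r ?nnegrE//; lra.
move=> h; apply: le_trans le _; nra.
Qed.

End ZeroOne.

(** * Flips of the initial bits *)

Section InitialFlips.
Variables (R : realType) (F : nat).
Let S : measurableType _ := space R.

(** A bit is the test [u < 1/2], which the reflection of [u] to [1 - u] reverses except at the tie
    excluded here. *)
Definition fair (u : S) : Prop := forall x i, u (Init x i) != 2^-1.

Section Map.
Variable W : int -> opinion F.

(** Reflects the uniform variables behind the bits selected by [W]. [Init] is indexed by [nat],
    hence the search for an ordinal of the same value; indices from [F] on are left alone. *)
Definition flip_coord (j : idx) : R -> R :=
  if j is Init x i then
    if [exists i' : 'I_F, (i' == i :> nat) && W x i'] then fun r => 1 - r else id
  else id.

Definition flip_init : S -> S := coordmap id flip_coord.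

Lemma measurable_flip_coord j : measurable_fun setT (flip_coord j).
Proof.
case: j => [x i|x i|x i|x i]; try exact: measurable_id.
rewrite /flip_coord; case: ifP => _; last exact: measurable_id.
by apply: measurable_funB; [exact: measurable_cst|exact: measurable_id].
Qed.

Lemma measurable_flip_init : measurable_fun setT flip_init.
Proof. by apply: measurable_coordmap => j; exact: measurable_flip_coord. Qed.

Lemma mP_flip (Q : S -> Prop) : mP Q -> mP (fun u => Q (flip_init u)).
Proof. by move=> mQ; rewrite /mP -[X in measurable X]setTI; exact: measurable_flip_init. Qed.

Lemma init_flip u x : fair u -> init_opinion F (flip_init u) x = xor (W x) (init_opinion F u x).
Proof.
move=> fu; apply/ffunP => i; rewrite !ffunE /flip_init /coordmap /flip_coord.
have -> : [exists i' : 'I_F, (i' == i :> nat) && W x i'] = W x i.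
  apply/existsP/idP => [[i' /andP[/eqP/val_inj ->]]//|Wi].
  by exists i; rewrite eqxx.
case: (W x i) => //=; have := fu x i; set r := u _ => ne.
by apply/idP/idP; [rewrite -leNgt|rewrite -leNgt le_eqVlt eq_sym (negbTE ne)/=]; lra.
Qed.

Lemma ring_time_flip u x n : ring_time (flip_init u) x n = ring_time u x n.
Proof. by []. Qed.

Lemma good_flip u : good u -> good (flip_init u).
Proof. by case=> *; split. Qed.

End Map.

Lemma mP_fair : mP fair.
Proof.
apply: (@mP_ext _ _ (fun u : S => forall x i, ~ u (Init x i) = 2^-1)).
  by move=> u; split=> H x i; apply/eqP; exact: H.
by meas.
Qed.

Variable mu : probability (space R) R.
Hypothesis Hmu : uniform_law mu.

Lemma law_lt j (a : R) : Pr mu [set u : S | u j < a] = Order.max 0 (Order.min 1 a).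
Proof.
rewrite -(law_coord Hmu j); apply/eqP; rewrite eq_le; apply/andP; split.
  by apply: Pr_le; [exact: mlt|exact: mle|move=> u /= /ltW].
apply/ler_addgt0Pr => e e0.
apply: (@le_trans _ _ (Pr mu [set u : S | u j <= a - e] + e)); last first.
  by rewrite lerD2r; apply: Pr_le; [exact: mle|exact: mlt|move=> u /= ue; lra].
rewrite !law_coord// /Order.max /Order.min.
repeat case: ifP; move=> *; lra.
Qed.

Lemma fair_as : Pr mu [set u | fair u] = 1.
Proof.
have m1 x i : mP (fun u : S => ~ u (Init x i) = 2^-1) by meas.
apply: etrans (_ : Pr mu [set u : S | forall x i, ~ u (Init x i) = 2^-1] = 1).
  by congr (Pr mu _); apply/seteqP; split=> u H x i; apply/eqP; exact: H.
apply: Pr1_all => x; first by meas.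
apply: Pr1_all => i; first by meas.
rewrite (_ : [set u | _] = ~` [set u : S | u (Init x i) = 2^-1])//.
have me : mP (fun u : S => u (Init x i) = 2^-1) by meas.
rewrite PrC//.
suff -> : Pr mu [set u : S | u (Init x i) = 2^-1] = 0 by rewrite subr0.
have := Pr_split mu (mle (Init x i) 2^-1) (mlt (Init x i) 2^-1).
have -> : [set u : S | u (Init x i) <= 2^-1] `&` [set u | u (Init x i) < 2^-1] = [set u | u (Init x i) < 2^-1].
  by apply/seteqP; split=> u; [case|move=> h; split=> //; exact: ltW].
have -> : [set u : S | u (Init x i) <= 2^-1] `\` [set u | u (Init x i) < 2^-1] = [set u | u (Init x i) = 2^-1].
  apply/seteqP; split=> u /=; first by move=> [a /negP b]; apply/eqP; rewrite eq_le a leNgt.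
  by move=> ->; rewrite lexx ltxx; split.
rewrite law_coord// law_lt => h; lra.
Qed.

Lemma flip_law W B : measurable B -> Pr mu (flip_init W @^-1` B) = Pr mu B.
Proof.
move=> mB; apply: coordmap_law => //; first by move=> j; exact: measurable_flip_coord.
move=> j a; case: j => [x i|//|//|//]; rewrite /flip_coord; case: ifP => // _.
have -> : [set u : S | 1 - u (Init x i) <= a] = ~` [set u | u (Init x i) < 1 - a].
  by apply/seteqP; split=> u /= H; [apply/negP; rewrite -leNgt; lra|move/negP : H; rewrite -leNgt => H; lra].
rewrite PrC ?law_lt ?law_coord//; last exact: mlt.
rewrite /Order.max /Order.min.
repeat case: ifP; move=> *; lra.
Qed.

End InitialFlips.

(** * Counting opinions by weight *)

Section Weights.
Variable F : nat.
Implicit Types A : opinion F.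

Definition weight A : nat := hamming A (xor0 F).

Lemma hamming_weight (v v' : opinion F) : hamming v v' = weight (xor v v').
Proof.
rewrite /weight -[LHS](hamming_xor v) hammingC; congr hamming.
by apply/ffunP => i; rewrite !ffunE addbb.
Qed.

Definition full : opinion F := [ffun=> true].

Lemma weightE A : weight A = (\sum_i A i)%N.
Proof.
rewrite /weight hammingE -sum1_card big_mkcond /=; apply: eq_bigr => i _.
by rewrite finset.inE !ffunE; case: (A i).
Qed.

Lemma weight_compl A : (weight A + weight (xor full A) = F)%N.
Proof.
rewrite !weightE -big_split /= -[RHS]card_ord -sum1_card.
by apply: eq_bigr => i _; rewrite !ffunE; case: (A i).
Qed.

Lemma sum_weight : (2 * \sum_A weight A = F * 2 ^ F)%N.
Proof.
rewrite mul2n -addnn {2}(reindex_inj (inv_inj (xorK full))) -big_split /=.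
under eq_bigr do rewrite weight_compl.
by rewrite sum_nat_const card_ffun card_bool card_ord mulnC.
Qed.

(* With [F >= 4 theta - 1] the mean initial value of [dist_pot], increased by the
   mean gain of the additions at first hits, is at least [theta]. *)
Lemma sum_dist_pot theta (i : 'I_F) : (0 < theta)%N -> (4 * theta - 1 <= F)%N ->
  (theta * 2 ^ F <= \sum_A dist_pot theta (weight A) +
    2 * #|[pred A | (theta < weight A)%N && ~~ A i]|)%N.
Proof.
move=> th0 hF.
have cA : #|{: opinion F}| = (2 ^ F)%N by rewrite card_ffun card_bool card_ord.
have w0 : weight (xor0 F) = 0%N by rewrite weightE big1// => j _; rewrite ffunE.
(* Termwise |w - theta| + theta >= w, and the zero opinion improves this by 2 theta >= 2, that is by
   4 after doubling. *)
have base : (F * 2 ^ F + 4 <= 2 * (\sum_A dist_pot theta (weight A) + theta * 2 ^ F))%N.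
  rewrite -sum_weight -[(2 ^ F)%N]cA mulnC [(theta * _)%N]mulnC -sum_nat_const -big_split /=.
  rewrite mulnC (_ : 4 = 2 * 2)%N// -mulnDr leq_mul2l /=.
  rewrite (bigD1 (xor0 F))//= [leqRHS](bigD1 (xor0 F))//= addnAC; apply: leq_add.
    by rewrite w0 /dist_pot; lia.
  by apply: leq_sum => A _; rewrite /dist_pot; lia.
set c := #|_|.
(* In the first case the mean of |w - theta| alone reaches [theta]; what remains is F = 4 theta - 1,
   where [base] leaves about half a unit per opinion to be found. *)
have [F4|F4] := leqP (4 * theta) F.
  have : (4 * theta * 2 ^ F <= F * 2 ^ F)%N by rewrite leq_mul2r F4 orbT.
  by move: base; set a := (\sum_A _)%N; set b := (2 ^ F)%N => *; nia.
have FE : (F = 4 * theta - 1)%N by lia.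
have fE : (F * 2 ^ F)%N = (4 * (theta * 2 ^ F) - 2 ^ F)%N.
  by rewrite {1}FE mulnBl mul1n mulnA.
(* Complement on all issues but [i]. For opinions without [i] the two weights add up to F - 1 = 4
   theta - 2, so one of them exceeds [theta] as soon as theta >= 2, and at least half of these
   opinions are blocked. *)
pose bc : opinion F -> opinion F := xor (flip i full).
have bcK : involutive bc by exact: xorK.
have bci A : bc A i = A i by rewrite /bc !ffunE eqxx.
have wbc A : ~~ A i -> (weight A + weight (bc A) = F.-1)%N.
  move=> nAi; rewrite !weightE -big_split /= (bigD1 i)//= (negbTE nAi) bci (negbTE nAi) addn0 add0n.
  rewrite (eq_bigr (fun=> 1%N)); last first.
    by move=> j ji; rewrite /bc !ffunE (negbTE ji); case: (A j).
  by rewrite sum1_card cardC1 card_ord.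
have ci : (2 * #|[pred A : opinion F | ~~ A i]| = 2 ^ F)%N.
  rewrite -cA -(cardC [pred A : opinion F | A i]) mul2n -addnn; congr addn.
  rewrite -(fintype.card_image (can_inj (xorK full))); apply: eq_card => A.
  rewrite [LHS]inE; apply/idP/fintype.imageP => [nAi|[B]]; last by rewrite inE => Bi ->; rewrite !ffunE Bi.
  by exists (xor full A); rewrite ?xorK// inE !ffunE (negbTE nAi).
(* For theta = 1 and F = 3 the pairing argument fails; one blocked opinion without [i] and the extra
   4 in [base] give the inequality, which is an equality there. *)
have [th1|th1] := leqP theta 1.
  have th : theta = 1%N by lia.
  have F3 : F = 3%N by lia.
  have c1 : (0 < c)%N.
    rewrite /c; apply/card_gt0P; exists (bc (xor0 F)); rewrite inE bci ffunE andbT.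
    have := wbc (xor0 F); rewrite w0 ffunE => /(_ isT); rewrite add0n => ->.
    by rewrite th F3.
  have p8 : (2 ^ F = 8)%N by rewrite F3.
  move: base; rewrite p8; set a := (\sum_A _)%N => *; nia.
suff : (2 ^ F <= 4 * c)%N.
  move: base; rewrite fE; set a := (\sum_A _)%N; set b := (2 ^ F)%N.
  move=> *; nia.
rewrite -ci (_ : 4 * c = 2 * (2 * c))%N; last by lia.
rewrite leq_mul2l /= mul2n -addnn.
rewrite -(cardID [pred A | (theta < weight A)%N] [pred A : opinion F | ~~ A i]); apply: leq_add.
  by apply: eq_leq; apply: eq_card => A; rewrite !inE andbC.
rewrite -(fintype.card_image (can_inj bcK) [predD _ & _]); apply: subset_leq_card; apply/fintype.subsetP => A /fintype.imageP[B].
rewrite !inE -leqNgt => /andP[lB nB] ->; rewrite bci nB andbT.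
by have := wbc B nB; lia.
Qed.

End Weights.

(** * The first change at an edge *)

Section FirstHit.
Variables (R : realType) (F theta : nat).
Let S : measurableType _ := space R.
Implicit Types (u : S) (b : bool) (i : 'I_F).

Let end_ b : int := (b : nat)%:Z.

Lemma endP z : z = 0 \/ z = 1 -> exists b, z = end_ b.
Proof. by case=> ->; [exists false|exists true]. Qed.

Lemma end01 b : end_ b = 0 \/ end_ b = 1.
Proof. by case: b; [right|left]. Qed.

Definition edge_diff u : opinion F := xor (init_opinion F u 0) (init_opinion F u 1).

Definition quiet u (t : R) : Prop := forall b j, ring_time u (end_ b) j < t ->
  val_at F theta u (end_ b) j.+1 = val_at F theta u (end_ b) j.

(** The issue is named through a flip, which commutes with [xor]; the triple [(b, k, i)] is unique
    by [first_hit_uniq], so these events are disjoint. *)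
Definition first_hit b k i u : Prop :=
  quiet u (ring_time u (end_ b) k) /\
  val_at F theta u (end_ b) k.+1 = flip i (val_at F theta u (end_ b) k).

Lemma mP_first_hit b k i : mP (first_hit b k i).
Proof.
apply: mP_and; last first.
  by apply: (mP_pred2 (fun a c => a = flip i c)); exact: mfib_val.
apply: mP_all => b'; apply: mP_all => j; apply: mP_imp; first by meas.
exact: mP_val_eq.
Qed.

Lemma mfib_edge_diff : mfib (fun u : S => edge_diff u).
Proof.
apply: (mfib_bind (f := fun u : S => init_opinion F u 0)
  (h := fun a u => xor a (init_opinion F u 1))); first exact: mfib_init.
by move=> a; apply: (mfib_comp (xor a)); exact: mfib_init.
Qed.

Section Good.
Variable u : S.
Hypothesis gu : good u.

Lemma quiet_val t b j : quiet u t -> (forall l, (l < j)%N -> ring_time u (end_ b) l < t) ->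
  val_at F theta u (end_ b) j = init_opinion F u (end_ b).
Proof.
move=> q; elim: j => [|j IH] H; first by rewrite val0.
by rewrite q ?H// IH// => l lj; apply: H; exact: ltnW.
Qed.

Lemma quiet_left t s b : quiet u t -> s <= t ->
  left_state F theta u s (end_ b) = init_opinion F u (end_ b).
Proof.
move=> q st; apply: (quiet_val q) => l; rewrite nringsP// => h; exact: lt_le_trans st.
Qed.

Lemma first_hit_uniq b k i b' k' i' : first_hit b k i u -> first_hit b' k' i' u ->
  [/\ b = b', k = k' & i = i'].
Proof.
move=> [q e] [q' e'].
have H c l j c' l' : quiet u (ring_time u (end_ c') l') ->
   val_at F theta u (end_ c) l.+1 = flip j (val_at F theta u (end_ c) l) ->
   ring_time u (end_ c') l' <= ring_time u (end_ c) l.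
  move=> qc ec; rewrite leNgt; apply/negP => /qc; rewrite ec => /eqP.
  by rewrite (negbTE (flip_neq _ _)).
have tt : ring_time u (end_ b) k = ring_time u (end_ b') k'.
  by apply/eqP; rewrite eq_le (H _ _ _ _ _ q e') (H _ _ _ _ _ q' e).
have bb : b = b'.
  apply/eqP/negPn/negP => ne; have : end_ b != end_ b' by case: (b) (b') ne => -[].
  by move=> /(good_neq gu k k'); rewrite tt eqxx.
subst b'.
have kk : k = k' by rewrite -(nrings_ring gu (end_ b) k) tt nrings_ring.
subst k'; split=> //; apply/eqP/negPn/negP => ne.
have /ffunP/(_ i) := etrans (esym e) e'; rewrite !ffunE eqxx (negbTE ne).
by case: (val_at _ _ _ _ _ _).
Qed.

Lemma no_hit_fixates : (forall b k i, ~ first_hit b k i u) -> fixates F theta u 0.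
Proof.
move=> nh.
have H : forall z k, z = 0 \/ z = 1 -> val_at F theta u z k.+1 = val_at F theta u z k.
  apply: (ring_ind gu) => z k IH /endP[b zb]; subst z.
  apply/eqP/negPn/negP => /(change_flip gu)[i _ e]; apply: (nh b k i); split=> // b' j lt.
  by apply: IH => //; [case: (b) (b') => -[]; [left|right; right|right; left|left]|exact: end01].
exists (val_at F theta u 0 0), 0%N; elim=> [//|k IH] _; rewrite H; [exact: IH|by left].
Qed.

(** The twist jumps only across the edge {0, 1}. Before the hit both ends keep their initial
    opinions, and the two weight hypotheses make the edge blocked in both systems, so [coupling_val]
    applies up to and including the hit. *)
Lemma first_hit_flip b k i (w : opinion F) : fair u ->
  (theta < weight (edge_diff u))%N -> (theta < weight (xor w (edge_diff u)))%N ->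
  first_hit b k i u -> first_hit b k i (flip_init (fun z : int => if 1 <= z then w else xor0 F) u).
Proof.
set W := fun z : int => _; set u' := flip_init W u.
move=> fu wA wA' [q e].
have gu' : good u' by exact: good_flip.
pose t := ring_time u (end_ b) k.
have W0 : W 0 = xor0 F by [].
have W1 : W 1 = w by [].
pose safe z j := W z = W (ring_nbr u z j) \/
   (~~ (1 <= hamming (val_at F theta u z j) (left_state F theta u (ring_time u z j) (ring_nbr u z j)) <= theta)%N /\
   ~~ (1 <= hamming (xor (W z) (val_at F theta u z j))
        (xor (W (ring_nbr u z j)) (left_state F theta u (ring_time u z j) (ring_nbr u z j))) <= theta)%N).
have blk z j : ring_time u z j <= t -> safe z j.
  move=> zt.
  have edge c c' : end_ c = z -> end_ c' = ring_nbr u z j -> c != c' -> safe z j.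
    rewrite /safe => cz <- cc; subst z; right.
    rewrite (quiet_left c' q zt) (quiet_val q) => [|l lj]; last first.
      by apply: lt_le_trans zt; exact: ring_time_lt.
    rewrite !hamming_weight !negb_and -!ltnNge.
    have -> : xor (init_opinion F u (end_ c)) (init_opinion F u (end_ c')) = edge_diff u.
      by apply/ffunP => l; rewrite !ffunE; case: (c) (c') cc => -[]//; rewrite addbC.
    have -> : xor (xor (W (end_ c)) (init_opinion F u (end_ c))) (xor (W (end_ c')) (init_opinion F u (end_ c'))) = xor w (edge_diff u).
      apply/ffunP => l; rewrite !ffunE; case: (c) (c') cc => -[]// _; rewrite ?W0 ?W1 ?ffunE /=.
        by rewrite -!addbA; congr addb; rewrite addbC.
      by rewrite addbCA.
    by rewrite wA wA' !orbT.
  have [z0|z0] := eqVneq z 0.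
    case: (nbrP u z j) => y; last by left; rewrite y z0.
    by apply: (edge false true) => //; rewrite y z0.
  have [z1|z1] := eqVneq z 1.
    case: (nbrP u z j) => y; first by left; rewrite y z1.
    by apply: (edge true false) => //; rewrite y z1.
  left; rewrite /W; case: (nbrP u z j) => ->.
    by rewrite (_ : (1 <= z + 1) = (1 <= z))//; lia.
  by rewrite (_ : (1 <= z - 1) = (1 <= z))//; lia.
have Vt z j : ring_time u z j <= t ->
    val_at F theta u' z j.+1 = xor (W z) (val_at F theta u z j.+1).
  move=> zt; apply: (coupling_val gu gu' (s := t) _ _ blk) => //.
  by move=> z'; exact: init_flip.
have Vt' z j : (forall l, (l < j)%N -> ring_time u z l <= t) ->
    val_at F theta u' z j = xor (W z) (val_at F theta u z j).
  case: j => [|j] H; first by rewrite !val0 init_flip.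
  by apply: Vt; exact: H.
split.
  move=> c j; rewrite !ring_time_flip => lt.
  rewrite Vt ?(ltW lt)// Vt'; first by rewrite q.
  by move=> l lj; apply: le_trans (ltW lt); exact/ltW/ring_time_lt.
rewrite Vt// Vt'; first by rewrite e flip_xor.
by move=> l lj; exact/ltW/ring_time_lt.
Qed.

(** The edge itself is blocked, so the hit comes from the outer neighbour, -1 or 2. The outer edge
    loses a disagreement from at most [theta], and the blocked edge gets one more above [theta]:
    each moves 1 further from the threshold. *)
Lemma first_hit_gain b k i : first_hit b k i u -> (theta < weight (edge_diff u))%N ->
  ~~ edge_diff u i ->
  ring_nbr u (end_ b) k = (if b then 2 else -1) /\
  (2 <= gain F theta (dist_pot theta) u (end_ b) k)%N.
Proof.
move=> [q e] wA nA.
have Vb : val_at F theta u (end_ b) k = init_opinion F u (end_ b).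
  by apply: (quiet_val q) => l lk; exact: ring_time_lt.
have Lc c : left_state F theta u (ring_time u (end_ b) k) (end_ c) = init_opinion F u (end_ c).
  exact: (quiet_left _ q).
have ch : val_at F theta u (end_ b) k.+1 != val_at F theta u (end_ b) k by rewrite e flip_neq.
have act := change_active gu ch; have [i' iH e'] := change_flip gu ch.
have ii : i' = i.
  apply/eqP/negPn/negP => ne; have /ffunP/(_ i) := etrans (esym e) e'.
  by rewrite !ffunE eqxx eq_sym (negbTE ne); case: (val_at _ _ _ _ _ _).
subst i'; clear e'.
have hw : hamming (init_opinion F u (end_ b)) (init_opinion F u (end_ (~~ b))) = weight (edge_diff u).
  by rewrite /edge_diff -hamming_weight; case: (b) => //=; rewrite hammingC.
have hi : (init_opinion F u (end_ b) i != init_opinion F u (end_ (~~ b)) i) = false.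
  by move: nA; rewrite /edge_diff ffunE; case: (b) => /=; do 2 case: (init_opinion F u _ i).
rewrite Vb in act iH e.
have nb : ring_nbr u (end_ b) k != end_ (~~ b).
  apply/eqP => nb; move: act; rewrite nb Lc hw => /andP[_]; rewrite leqNgt wA //.
case: b q e wA nA Vb Lc ch act iH hw hi nb => q e wA nA Vb Lc ch act iH hw hi nb.
  have nE : ring_nbr u (end_ true) k = 2.
    by case: (nbrP u (end_ true) k) => // h; move: nb; rewrite h.
  split=> //; rewrite nE in act iH.
  rewrite /gain e Vb (Lc false).
  rewrite ![hamming (init_opinion F u (end_ false)) _]hammingC.
  rewrite [hamming (flip _ _) (init_opinion _ _ (end_ false))]hamming_flip hi hw hamming_flip iH.
  by move: act wA; rewrite /dist_pot; set h := hamming _ _; lia.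
have nE : ring_nbr u (end_ false) k = -1.
  by case: (nbrP u (end_ false) k) => // h; move: nb; rewrite h.
split=> //; rewrite nE in act iH.
rewrite /gain e Vb (Lc true).
rewrite ![hamming (left_state _ _ _ _ _) _]hammingC.
rewrite [hamming (flip _ _) (init_opinion _ _ (end_ true))]hamming_flip hi hw hamming_flip iH.
by move: act wA; rewrite /dist_pot; set h := hamming _ _; lia.
Qed.

(** Vertex 0 differs by one issue from two neighbours that agree with each other. Whichever it
    selects, it copies it, and both edges go from 1 to 0 disagreements. *)
Lemma local_gain i : (0 < theta)%N ->
  init_opinion F u 0 = flip i (init_opinion F u 1) -> init_opinion F u (-1) = init_opinion F u 1 ->
  ring_time u 0 0 < ring_time u 1 0 -> ring_time u 0 0 < ring_time u (-1) 0 ->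
  (2 <= gain F theta (dist_pot theta) u 0 0)%N.
Proof.
move=> th0 i0 i1 r1 r2.
have N z : ring_time u 0 0 < ring_time u z 0 -> left_state F theta u (ring_time u 0 0) z = init_opinion F u z.
  move=> lt; rewrite /left_state (_ : nrings _ _ _ = 0%N) ?val0//.
  by apply/eqP; rewrite -leqn0 leqNgt nringsP// -leNgt ltW.
have L1 := N _ r1; have L2 := N _ r2; rewrite i1 in L2.
have h1 : hamming (init_opinion F u 0) (init_opinion F u 1) = 1%N.
  rewrite i0 hamming_flip eqxx; congr _.+1; apply/eqP; rewrite hamming_eq0 //.
have Ln : left_state F theta u (ring_time u 0 0) (ring_nbr u 0 0) = init_opinion F u 1.
  by case: (nbrP u 0 0) => ->; rewrite ?add0r ?sub0r.
have V1 : val_at F theta u 0 1 = init_opinion F u 1.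
  have act : (1 <= hamming (val_at F theta u 0 0) (left_state F theta u (ring_time u 0 0) (ring_nbr u 0 0)) <= theta)%N.
    by rewrite Ln val0 h1.
  have [i' iH e] := change_flip gu (active_change gu act).
  apply/eqP; rewrite -hamming_eq0 e; move: iH; rewrite Ln val0 => iH.
  by rewrite hamming_flip iH h1.
rewrite /gain !add0r L1 L2 V1 val0 h1 [hamming (init_opinion F u 1) (init_opinion F u 0)]hammingC h1.
have -> : hamming (init_opinion F u 1) (init_opinion F u 1) = 0%N by apply/eqP; rewrite hamming_eq0.
by rewrite /dist_pot; lia.
Qed.

End Good.
End FirstHit.

(** * Fixation has positive probability *)

Section FiniteValued.
Context d (S : measurableType d) (R : realType) (P : probability S R).
Variables (I : finType) (X : S -> I).
Hypothesis mX : mfib X.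

Lemma Pr_finite (Q : pred I) : Pr P [set u | Q (X u)] = \sum_(a | Q a) Pr P [set u | X u = a].
Proof.
rewrite big_mkcond /=.
transitivity (Pr P [set u | exists a, (Q a /\ X u = a)]).
  by congr (Pr P _); apply/seteqP; split=> u /=; [exists (X u)|move=> [a [Qa ->]]].
rewrite (Pr_sum P (F := fun a => [set u | Q a /\ X u = a])).
- apply: eq_bigr => a _; case: ifP => Qa.
    by congr (Pr P _); apply/seteqP; split=> u /=; [case|].
  by rewrite (_ : [set u | _] = set0) ?Pr0//; apply/seteqP; split=> u // [].
- by move=> a; apply: mP_and; [exact: mP_const|exact: mX].
- by move=> a b u [_ <-] [_ <-].
Qed.

Lemma Ex_finite b (h : I -> nat) : (forall a, (h a <= b)%N) ->
  Ex P (fun u => h (X u)) = \sum_a (h a)%:R * Pr P [set u | X u = a].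
Proof.
move=> hb; have bX : bdd b (fun u => h (X u)).
  by split=> [|u]; [exact: (mfib_comp h)|exact: hb].
rewrite (Ex_layer P bX).
under eq_bigr do rewrite (Pr_finite (fun a => (_ < h a)%N)) big_mkcond.
rewrite exchange_big /=; apply: eq_bigr => a _.
rewrite -big_mkcond -(big_ord_widen b (fun=> Pr P [set u | X u = a]) (hb a)).
by rewrite sumr_const card_ord mulr_natl.
Qed.

End FiniteValued.

Section Positivity.
Variables (R : realType) (mu : probability (space R) R).
Hypothesis Hmu : uniform_law mu.
Let S : measurableType _ := space R.
Variables (F theta : nat).
Hypotheses (th0 : (0 < theta)%N) (hF : (4 * theta - 1 <= F)%N).

Let D (u : S) := edge_diff F u.

Lemma edge_diff_flip (w : opinion F) u : fair u ->
  D (flip_init (fun z : int => if 1 <= z then w else xor0 F) u) = xor w (D u).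
Proof.
move=> fu; rewrite /D /edge_diff !init_flip//=; apply/ffunP => i; rewrite !ffunE /=.
by rewrite addbCA.
Qed.

(** Flipping issues to the right of the edge carries any difference to any other, so all are equally
    likely, and the probabilities sum to 1. *)
Lemma edge_diff_law A : Pr mu [set u : S | D u = A] = (2 ^ F)%:R^-1.
Proof.
have mD (A' : opinion F) : mP (fun u : S => D u = A') by exact: mfib_edge_diff.
have le (A1 A2 : opinion F) : Pr mu [set u : S | D u = A1] <= Pr mu [set u : S | D u = A2].
  rewrite -(flip_law Hmu (fun z : int => if 1 <= z then xor A2 A1 else xor0 F) (mD A2)).
  apply: (Pr_le_ae (mD A1) (mP_flip _ (mD A2)) (@mP_fair R) (fair_as Hmu)) => u fu /= DA; rewrite edge_diff_flip// DA.
  by apply/ffunP => i; rewrite !ffunE addbK.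
have := Pr_finite mu (@mfib_edge_diff R F) predT.
rewrite (_ : [set u | _] = setT) ?PrT; last by apply/seteqP; split.
rewrite (eq_bigr (fun=> Pr mu [set u : S | D u = A])); last first.
  by move=> B _; apply/eqP; rewrite eq_le !le.
rewrite sumr_const card_ffun card_bool card_ord => h.
have n0 : (2 ^ F)%:R != 0 :> R by rewrite pnatr_eq0 expn_eq0.
by apply: (mulfI n0); rewrite mulr_natl -h divff.
Qed.

Let end_ (b : bool) : int := (b : nat)%:Z.

Definition hit_before b A (i : 'I_F) (T : nat) (u : S) : Prop :=
  good u /\ (D u = A /\ exists k, first_hit theta b k i u /\ ring_time u (end_ b) k < T%:R).

Lemma mP_hit_before b A i T : mP (hit_before b A i T).
Proof.
apply: mP_and; first exact: mP_good.
apply: mP_and; first exact: mfib_edge_diff.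
by apply: mP_ex => k; apply: mP_and; [exact: mP_first_hit|meas].
Qed.

Lemma hit_before_law b A A' i T : (theta < weight A)%N -> (theta < weight A')%N ->
  Pr mu [set u | hit_before b A i T u] = Pr mu [set u | hit_before b A' i T u].
Proof.
suff le A1 A2 : (theta < weight A1)%N -> (theta < weight A2)%N ->
    Pr mu [set u | hit_before b A1 i T u] <= Pr mu [set u | hit_before b A2 i T u].
  by move=> w1 w2; apply/eqP; rewrite eq_le !le.
move=> w1 w2; have mh A3 := mP_hit_before b A3 i T.
rewrite -(flip_law Hmu (fun z : int => if 1 <= z then xor A2 A1 else xor0 F) (mh A2)).
apply: (Pr_le_ae (mh A1) (mP_flip _ (mh A2)) (@mP_fair R) (fair_as Hmu)) => u fu [gu [DA [k [fh lt]]]].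
have xE : xor (xor A2 A1) (D u) = A2.
  by rewrite DA; apply/ffunP => j; rewrite !ffunE addbK.
split; first exact: good_flip.
split; first by rewrite edge_diff_flip.
exists k; split=> //; apply: first_hit_flip => //; last by rewrite -/(D u) xE.
by rewrite -/(D u) DA.
Qed.

(** [full] serves as reference: by [hit_before_law] the end and the issue of the first hit
    contribute the same [q] for every blocked difference. *)
Definition hit (T : nat) (u : S) : Prop :=
  exists p : bool * 'I_F, hit_before p.1 (full F) p.2 T u.

Definition adding_hit b (T : nat) (u : S) : Prop :=
  exists p : 'I_F * opinion F, ((theta < weight p.2)%N && ~~ p.2 p.1) /\ hit_before b p.2 p.1 T u.

Lemma mP_hit T : mP (hit T).
Proof. by apply: mP_ex => p; exact: mP_hit_before. Qed.

Lemma mP_adding_hit b T : mP (adding_hit b T).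
Proof.
by apply: mP_ex => p; apply: mP_and; [exact: mP_const|exact: mP_hit_before].
Qed.

Lemma hit_before_uniq b A i T b' A' i' T' u :
  hit_before b A i T u -> hit_before b' A' i' T' u -> [/\ b = b', A = A' & i = i'].
Proof.
move=> [gu [<- [k [h _]]]] [_ [<- [k' [h' _]]]].
by have [-> _ ->] := first_hit_uniq gu h h'.
Qed.

Lemma weight_full : (theta < weight (full F))%N.
Proof.
rewrite weightE (eq_bigr (fun=> 1%N)) => [|i _]; last by rewrite ffunE.
by rewrite sum1_card card_ord; lia.
Qed.

Let q T b i := Pr mu [set u | hit_before b (full F) i T u].

Lemma hit_prob T : Pr mu [set u | hit T u] = \sum_i (q T true i + q T false i).
Proof.
rewrite (Pr_sum mu (F := fun p : bool * 'I_F => [set u | hit_before p.1 (full F) p.2 T u])).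
- rewrite -(pair_bigA _ (fun b i => q T b i)) /= big_bool big_split//.
- by move=> p; exact: mP_hit_before.
- by move=> [b i] [b' i'] u /hit_before_uniq h /h [/= -> _ ->].
Qed.

(** For a given end and issue all blocked differences have the same probability [q], so the sum over
    them is a count. *)
Lemma adding_hit_prob T b : Pr mu [set u | adding_hit b T u] =
  \sum_i (#|[pred A : opinion F | (theta < weight A)%N && ~~ A i]|)%:R * q T b i.
Proof.
rewrite (Pr_sum mu (F := fun p : 'I_F * opinion F =>
   [set u | ((theta < weight p.2)%N && ~~ p.2 p.1) /\ hit_before b p.2 p.1 T u])).
- rewrite -(pair_bigA _ (fun i A => Pr mu [set u | ((theta < weight A)%N && ~~ A i) /\ hit_before b A i T u])) /=.
  apply: eq_bigr => i _; rewrite mulr_natl -sumr_const big_mkcond [RHS]big_mkcond /=.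
  apply: eq_bigr => A _; rewrite inE /=; case: ifP => c.
    rewrite /q (hit_before_law b i T weight_full (proj1 (andP c))); congr (Pr mu _).
    by apply/seteqP; split=> u; [case|].
  by rewrite (_ : [set u | _] = set0) ?Pr0//; apply/seteqP; split=> u // [].
- move=> p.
  change (mP (fun u : S => ((theta < weight p.2)%N && ~~ p.2 p.1) /\ hit_before b p.2 p.1 T u)).
  by apply: mP_and; [exact: mP_const|exact: mP_hit_before].
- by move=> [i A] [i' A'] u [_ /= /hit_before_uniq h] [_ /= /h [_ -> ->]].
Qed.

Let F0 : (0 < F)%N. Proof. by lia. Qed.
Let i0 : 'I_F := Ordinal F0.

Definition local_event (u : S) : Prop :=
  init_opinion F u 0 = flip i0 (init_opinion F u 1) /\
  (init_opinion F u (-1) = init_opinion F u 1 /\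
  (ring_time u 0 0 < ring_time u 1 0 /\
  (ring_time u 0 0 < ring_time u (-1) 0 /\ ring_time u 0 0 < 1))).

Lemma mP_local : mP local_event.
Proof.
apply: mP_and.
  by apply: (mP_pred2 (fun a c => a = flip i0 c)); exact: mfib_init.
apply: mP_and; last by meas.
by apply: (mP_pred2 (fun a c => a = c)); exact: mfib_init.
Qed.

Lemma local_prob : 0 < Pr mu [set u | local_event u].
Proof.
pose s := undup ([:: Wait 0 0; Wait 1 0; Wait (-1) 0] ++
  [seq Init z i | z <- [:: -1; 0; 1], i <- iota 0 F]).
(* A large uniform is a short waiting time, so vertex 0 rings before its neighbours. All bits of -1,
   0 and 1 are true except bit 0 of vertex 0. *)
pose A (j : idx) : set R := if (j == Wait 0 0) || (j == Init 0 0) then `]2^-1, +oo[%classic else `]-oo, 2^-1[%classic.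
have mA j : measurable (A j) by rewrite /A; case: ifP => _; exact: measurable_itv.
have us : uniq s by exact: undup_uniq.
have mcyl : mP (fun u : S => forall j, j \in s -> A j (u j)).
  by apply: mP_all => j; apply: mP_imp; [exact: mP_const|exact: (mcoord j (mA j))].
apply: (@lt_le_trans _ _ (Pr mu [set u : S | forall j, j \in s -> A j (u j)])).
  rewrite (law_cyl Hmu us mA); apply: prodr_gt0 => j _.
  rewrite /A; case: ifP => _.
    have -> : [set u : S | `]2^-1, +oo[%classic (u j)] = ~` [set u : S | u j <= 2^-1].
      apply/seteqP; split=> u /=; rewrite in_itv /= andbT => h; first by apply/negP; rewrite -ltNge.
      by rewrite ltNge; apply/negP.
    rewrite PrC ?law_coord//; last exact: mle.
    rewrite /Order.max /Order.min; repeat case: ifP; move=> *; lra.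
  have -> : [set u : S | `]-oo, 2^-1[%classic (u j)] = [set u : S | u j < 2^-1].
    by apply/seteqP; split=> u /=; rewrite in_itv.
  by rewrite law_lt// /Order.max /Order.min; repeat case: ifP; move=> *; lra.
apply: (Pr_le_ae mcyl mP_local (measurable_good R) (good_as Hmu)) => u gu H.
have ini z i : z \in [:: -1; 0; 1] -> (i < F)%N -> Init z i \in s.
  move=> zs iF; rewrite mem_undup mem_cat; apply/orP; right.
  by apply/allpairsP; exists (z, i); rewrite mem_iota.
have low z (i : 'I_F) : z \in [:: -1; 0; 1] -> Init z i != Init 0 0 -> init_opinion F u z i.
  move=> zs ne; have := H _ (ini z i zs (ltn_ord i)).
  by rewrite /A (negbTE ne) /= in_itv /= ffunE.
have high : init_opinion F u 0 i0 = false.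
  have := H _ (ini 0 0%N isT F0); rewrite /A eqxx orbT /= in_itv /= andbT ffunE => h.
  by apply/negbTE; rewrite -leNgt ltW.
have w0 : 2^-1 < u (Wait 0 0).
  have := H (Wait 0 0); rewrite mem_undup /= inE eqxx => /(_ isT).
  by rewrite /A eqxx /= in_itv /= andbT.
have w1 : u (Wait 1 0) < 2^-1.
  by have := H (Wait 1 0); rewrite mem_undup /= !inE eqxx orbT => /(_ isT).
have w2 : u (Wait (-1) 0) < 2^-1.
  by have := H (Wait (-1) 0); rewrite mem_undup /= !inE eqxx !orbT => /(_ isT).
have lnlt z : u (Wait z 0) < 2^-1 -> ring_time u 0 0 < ring_time u z 0.
  move=> h; rewrite !ring_time0 ltrN2 ltr_ln ?posrE; first exact: lt_trans w0.
    by have /andP[] := good_wait gu z 0.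
  by have /andP[] := good_wait gu 0 0.
split.
  apply/ffunP => i; rewrite [RHS]ffunE; case: (eqVneq i i0) => [->|ne]; first by rewrite high low.
  rewrite !low//; apply/eqP => -[] e; move: ne; rewrite -val_eqE /= e //.
split; first by apply/ffunP => i; rewrite !low.
split; first exact: lnlt.
split; first exact: lnlt.
rewrite ring_time0 -(opprK 1) ltrN2 -(expRK (-1)) ltr_ln ?posrE ?expR_gt0//; last first.
  by have /andP[] := good_wait gu 0 0.
(* From exp(1) >= 1 + 1 follows exp(-1) <= 1/2, hence a first ring before time 1. *)
apply: le_lt_trans w0; rewrite expRN lef_pV2 ?posrE ?expR_gt0//.
by have := @expR_ge1Dx R 1; rewrite -natr1 => h; exact: h.
Qed.

Lemma init_shift m (u : S) x : init_opinion F (shift m u) x = init_opinion F u (x + m).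
Proof. by apply/ffunP => i; rewrite !ffunE. Qed.

(** The three sources of gain at vertex 0 never share a ring: a hit on the edge to its right comes
    from -1, a hit on the edge to its left (seen through the shift by -1) comes from 1, and the
    local event has both edges unblocked, which excludes the hits. The total is thus at most 4, the
    level of truncation. *)
Lemma hits_gains (T : nat) (u : S) : good u -> (0 < T)%N ->
  (2 * (`[< adding_hit false T u >] + `[< adding_hit true T (shift (-1) u) >] + `[< local_event u >]) <=
   minn (gains F theta (dist_pot theta) u 0 T%:R) 4)%N.
Proof.
move=> gu T0.
have one k : ring_time u 0 k < T%:R -> (gain F theta (dist_pot theta) u 0 k <= gains F theta (dist_pot theta) u 0 T%:R)%N.
  by rewrite /gains -nringsP// => kn; rewrite (bigD1 (Ordinal kn))//= leq_addr.
have two k k' : ring_time u 0 k < T%:R -> ring_time u 0 k' < T%:R -> k != k' ->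
    (gain F theta (dist_pot theta) u 0 k + gain F theta (dist_pot theta) u 0 k' <= gains F theta (dist_pot theta) u 0 T%:R)%N.
  rewrite /gains -!nringsP// => kn kn' kk.
  rewrite (bigD1 (Ordinal kn))//= (bigD1 (Ordinal kn'))//=; last by rewrite -val_eqE /= eq_sym.
  by rewrite addnA leq_addr.
have H1 : adding_hit false T u -> (theta < weight (D u))%N /\
    exists k, [/\ ring_time u 0 k < T%:R, ring_nbr u 0 k = -1 & (2 <= gain F theta (dist_pot theta) u 0 k)%N].
  move=> [[i A] /= [/andP[wA nA] [_ [DA [k [fh lt]]]]]]; subst A; split=> //; exists k.
  by have [? ?] := first_hit_gain gu fh wA nA; split.
have H2 : adding_hit true T (shift (-1) u) -> (theta < weight (D (shift (-1) u)))%N /\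
    exists k, [/\ ring_time u 0 k < T%:R, ring_nbr u 0 k = 1 & (2 <= gain F theta (dist_pot theta) u 0 k)%N].
  move=> [[i A] /= [/andP[wA nA] [gs [DA [k [fh lt]]]]]]; subst A; split=> //; exists k.
  have [nb ga] := first_hit_gain gs fh wA nA.
  move: ga lt; rewrite gain_shift ring_time_shift /end_ /= subrr => ga lt; split=> //.
  have := ring_nbr_shift u (-1) 1 k; rewrite subrr => <-.
  by move: nb; rewrite /= => ->.
have H3 : local_event u -> [/\ (weight (D u) <= theta)%N, (weight (D (shift (-1) u)) <= theta)%N,
    ring_time u 0 0 < T%:R & (2 <= gain F theta (dist_pot theta) u 0 0)%N].
  move=> [e0 [e1 [r1 [r2 r3]]]]; split.
  - by rewrite /D /edge_diff -hamming_weight e0 hamming_flip eqxx (eqP (_ : hamming _ _ == 0%N)) ?hamming_eq0.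
  - rewrite /D /edge_diff -hamming_weight !init_shift add0r subrr e0 e1 hammingC hamming_flip eqxx.
    by rewrite (eqP (_ : hamming _ _ == 0%N)) ?hamming_eq0.
  - by apply: lt_le_trans r3 _; rewrite ler1n.
  - exact: local_gain gu i0 th0 e0 e1 r1 r2.
case: asboolP => [/H1[w1 [k [lt nb ga]]]|_]; case: asboolP => [/H2[w2 [k' [lt' nb' ga']]]|_];
  case: asboolP => [/H3[w3 w4 lt0 ga0]|_] //=; rewrite ?leq_min.
- by move: w3; rewrite leqNgt w1.
- have kk : k != k' by apply/eqP => e; move: nb'; rewrite -e nb.
  by have := two _ _ lt lt' kk; lia.
- by move: w3; rewrite leqNgt w1.
- by have := one _ lt; lia.
- by move: w4; rewrite leqNgt w2.
- by have := one _ lt'; lia.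
- by have := one _ lt0; lia.
Qed.

Lemma hit_le T : Pr mu [set u | hit T u] <= (2 ^ F)%:R^-1.
Proof.
rewrite -(edge_diff_law (full F)); apply: Pr_le; [exact: mP_hit|exact: mfib_edge_diff|].
by move=> u [[b i] /= [_ []]].
Qed.

Let no_fix := Pr mu [set u | fixates F theta u 0] = 0.

(** Without fixation an edge with difference [full] is hit at some time ([no_hit_fixates]); a late
    deadline loses at most [e]. *)
Lemma hit_ge e : no_fix -> 0 < e ->
  exists T0, forall T, (T0 <= T)%N -> (2 ^ F)%:R^-1 <= Pr mu [set u | hit T u] + e.
Proof.
move=> nf e0; have incr T T' : (T <= T')%N -> [set u | hit T u] `<=` [set u | hit T' u].
  move=> TT u [p [gu [DA [k [fh lt]]]]]; exists p; split=> //; split=> //.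
  by exists k; split=> //; apply: lt_le_trans lt _; rewrite ler_nat.
have [T0 HT0] := Pr_incr mu mP_hit (fun T => incr T T.+1 (leqnSn T)) e0.
exists T0 => T TT; rewrite -(edge_diff_law (full F)).
apply: (@le_trans _ _ (Pr mu [set u | hit T0 u] + e)); last first.
  by rewrite lerD2r; apply: Pr_le; [exact: mP_hit|exact: mP_hit|exact: incr].
apply: le_trans HT0.
have mf : measurable [set u : S | fixates F theta u 0] by exact: mP_fixates.
have mnf := measurableC mf; have mG := measurableI _ _ (measurable_good R) mnf.
have G1 : Pr mu ([set u | good u] `&` ~` [set u | fixates F theta u 0]) = 1.
  apply: (Pr1_I (measurable_good R) mnf (good_as Hmu)).
  by rewrite PrC// nf subr0.
apply: (Pr_le_ae _ _ mG G1); [exact: mfib_edge_diff|by apply: bigcupT_measurable; exact: mP_hit|].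
move=> u [gu nfu] DA.
have [b [k [i fh]]] : exists (b : bool) (k : nat) (i : 'I_F), first_hit theta b k i u.
  apply: contrapT => nh; apply: nfu; apply: no_hit_fixates => // b k i fh.
  by apply: nh; exists b, k, i.
exists (Num.truncn (ring_time u (end_ b) k)).+1 => //.
by exists (b, i); split=> //; split=> //; exists k; split=> //; exact: truncnS_gt.
Qed.

(** Being blocked at arbitrarily late integer times forces fixation ([blocked_io_fixates]), here a
    null event. *)
Lemma blocked_vanishes e : no_fix -> 0 < e ->
  exists T0, forall T, (T0 <= T)%N -> Pr mu [set u : S | (theta < edge_size F theta u T%:R 0)%N] <= e.
Proof.
move=> nf e0.
have mB T : measurable [set u : S | (theta < edge_size F theta u T%:R 0)%N].
  change (mP (fun u : S => (theta < edge_size F theta u T%:R 0)%N)).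
  by apply: (mP_pred (fun n => is_true (theta < n)%N)); exact: mfib_edge.
pose Z n : set S := [set u : S | exists T, (n <= T)%N /\ (theta < edge_size F theta u T%:R 0)%N].
have mZ n : measurable (Z n).
  change (mP (fun u : S => exists T, (n <= T)%N /\ (theta < edge_size F theta u T%:R 0)%N)).
  by apply: mP_ex => T; apply: mP_and; [exact: mP_const|exact: mB].
have decZ n : Z n.+1 `<=` Z n by move=> u [T [/ltnW nT ?]]; exists T.
have [n Hn] := Pr_decr mu mZ decZ e0.
have mG z : measurable [set u : S | gains_stop F theta u z] by exact: mP_gains_stop.
have PG z := gains_stop_as Hmu F theta z.
have mGG := measurableI _ _ (mG 0) (mG 1).
have mGa := measurableI _ _ (measurable_good R) mGG.
have Ga1 := Pr1_I (measurable_good R) mGG (good_as Hmu) (Pr1_I (mG 0) (mG 1) (PG 0) (PG 1)).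
have mI : measurable (\bigcap_n Z n) by exact: bigcapT_measurable.
have Z0 : Pr mu (\bigcap_n Z n) = 0.
  apply/eqP; rewrite eq_le Pr_ge0 andbT -nf.
  apply: (Pr_le_ae mI (mP_fixates F theta 0) mGa Ga1) => u [gu [G0 G1]] H.
  apply: (blocked_io_fixates gu G0); first by rewrite add0r.
  by move=> T; have [T' [TT ?]] := H T Logic.I; exists T'%:R; rewrite ?ler_nat.
exists n => T nT; apply: (@le_trans _ _ (Pr mu (Z n))).
  by apply: (Pr_le mu (mB T) (mZ n)) => u ?; exists T.
by rewrite Z0 add0r in Hn.
Qed.

Let g := dist_pot theta.

Lemma initial_energy : (\sum_(A : opinion F) g (weight A))%:R / (2 ^ F)%:R <=
  Ex mu (fun u => g (edge_size F theta u 0 0)).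
Proof.
have gB j : (j <= F)%N -> (g j <= F + theta)%N by rewrite /g /dist_pot; lia.
have mw : mfib (fun u : S => D u) by exact: mfib_edge_diff.
have wB (A : opinion F) : (g (weight A) <= F + theta)%N by apply: gB; exact: hamming_le.
have := Ex_finite mu mw wB.
under eq_bigr do rewrite edge_diff_law.
rewrite -mulr_suml -natr_sum => <-.
have b1 : bdd (F + theta) (fun u : S => g (weight (D u))).
  by split=> //; exact: (mfib_comp (fun A => g (weight A)) mw).
have b2 : bdd (F + theta) (fun u : S => g (edge_size F theta u 0 0)).
  by split=> [|u]; [apply: (mfib_comp g); exact: mfib_edge|apply: gB; exact: hamming_le].
apply: (Ex_le b1 b2 (measurable_good R) (good_as Hmu)) => u gu.
rewrite /edge_size /left_state !nrings0// !val0 add0r.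
by rewrite /D /edge_diff -hamming_weight.
Qed.

(** Pointwise |zeta - theta| <= theta when zeta <= theta; a blocked edge has excess at most [F]. *)
Lemma final_energy t : Ex mu (fun u => g (edge_size F theta u t 0)) <=
  theta%:R + F%:R * Pr mu [set u : S | (theta < edge_size F theta u t 0)%N].
Proof.
have gB j : (j <= F)%N -> (g j <= F + theta)%N by rewrite /g /dist_pot; lia.
have mB : mP (fun u : S => (theta < edge_size F theta u t 0)%N).
  by apply: (mP_pred (fun n => is_true (theta < n)%N)); exact: mfib_edge.
have b2 : bdd (F + theta) (fun u : S => g (edge_size F theta u t 0)).
  by split=> [|u]; [apply: (mfib_comp g); exact: mfib_edge|apply: gB; exact: hamming_le].
have bI := bdd_ind mB.
have bS := bdd_sum (n := F) (fun _ _ => bI).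
have := Ex_add mu (bdd_cst S theta) bS.
rewrite Ex_cst (Ex_sum (n := F) mu (fun _ _ => bI)) sumr_const card_ord Ex_ind// -[_ *+ F]mulr_natl => <-.
apply: (Ex_le b2 (bdd_add (bdd_cst S theta) bS) (measurable_good R) (good_as Hmu)) => u _.
rewrite sum_nat_const card_ord; have := @hamming_le F (left_state F theta u t 0) (left_state F theta u t (0 + 1)).
rewrite -/(edge_size F theta u t 0).
by case: asboolP => [|/negP]; rewrite /g /dist_pot; lia.
Qed.

Lemma mean_gains T : (0 < T)%N ->
  2 * (Pr mu [set u | adding_hit false T u] + Pr mu [set u | adding_hit true T u] +
       Pr mu [set u | local_event u]) <=
  Ex mu (fun u => minn (gains F theta g u 0 T%:R) 4).
Proof.
move=> T0; have m1 := mP_adding_hit false T; have m2 := mP_adding_hit true T.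
have m2' : mP (fun u : S => adding_hit true T (shift (-1) u)) by exact: (mP_shift (-1) m2).
have b1 := bdd_ind m1; have b2 := bdd_ind m2'; have b3 := bdd_ind mP_local.
have b12 := bdd_add b1 b2; have b123 := bdd_add b12 b3; have bb := bdd_add b123 b123.
have -> : Pr mu [set u | adding_hit true T u] = Pr mu [set u | adding_hit true T (shift (-1) u)].
  exact/esym/(shift_law (-1) Hmu m2).
have := Ex_add mu b123 b123.
rewrite (Ex_add mu b12 b3) (Ex_add mu b1 b2) (Ex_ind mu m1) (Ex_ind mu m2') (Ex_ind mu mP_local) => e.
rewrite mulr_natl mulr2n -e.
have bm : bdd 4 (fun u : S => minn (gains F theta g u 0 T%:R) 4).
  split; last by move=> u; exact: geq_minr.
  by apply: (mfib_comp (fun n => minn n 4)); exact: mfib_gains.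
apply: (Ex_le bb bm (measurable_good R) (good_as Hmu)) => u gu.
by rewrite addnn -mul2n; exact: hits_gains.
Qed.

Lemma fixation_positive : 0 < Pr mu [set u | fixates F theta u 0].
Proof.
rewrite lt_def Pr_ge0 andbT; apply/eqP => nf.
have := local_prob; set kappa := Pr mu _ => k0.
pose N : R := (2 ^ F)%:R.
have N0 : 0 < N by rewrite ltr0n expn_gt0.
pose C : R := F%:R + theta%:R * N.
have C0 : 0 <= C by rewrite addr_ge0// mulr_ge0// ltW.
(* [C * e] collects the errors of two limits, F e from [blocked_vanishes] and theta N e from
   [hit_ge]; it stays below [kappa], while the local event contributes twice [kappa]. *)
pose e := kappa / (C + 1).
have e0 : 0 < e by rewrite divr_gt0//; lra.
have eC : C * e < kappa.
  have : (C + 1) * e = kappa by rewrite /e mulrC divfK//; apply/lt0r_neq0; lra.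
  lra.
have [T1 H1] := hit_ge nf e0; have [T2 H2] := blocked_vanishes nf e0.
pose T := (maxn T1 T2).+1.
have {}H1 := H1 T (leqW (leq_maxl T1 T2)); have {}H2 := H2 T (leqW (leq_maxr T1 T2)).
have H3 := hit_le T.
have gB j : (j <= F)%N -> (g j <= F + theta)%N by rewrite /g /dist_pot; lia.
have := mean_ineq Hmu (potential_dist theta) gB 4 (ler0n R T).
move=> ineq; have := le_trans (lerD initial_energy (mean_gains (ltn0Sn _ : (0 < T)%N))) ineq.
move=> /le_trans/(_ (final_energy T%:R)).
have := adding_hit_prob T false; have := adding_hit_prob T true.
set a1 := Pr mu _; move=> E1; set a2 := Pr mu _; move=> E2.
pose m : R := theta%:R * N - (\sum_(A : opinion F) g (weight A))%:R.
have key : m * Pr mu [set u | hit T u] <= 2 * (a2 + a1).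
  rewrite hit_prob E1 E2 -big_split /= !mulr_sumr; apply: ler_sum => i _.
  rewrite -mulrDr addrC [q T false i + _]addrC mulrA; apply: ler_wpM2r; first by rewrite addr_ge0// Pr_ge0.
  rewrite /m lerBlDl -natrM -natrM -natrD ler_nat; exact: sum_dist_pot.
move: key H1 H2 H3; rewrite -/N -/kappa; set h := Pr mu _; set b := Pr mu _; rewrite /m.
set Dd := (\sum_(A : opinion F) _)%:R; have D0 : 0 <= Dd by exact: ler0n.
have F0' : 0 <= F%:R :> R by exact: ler0n.
have t0 : 0 <= theta%:R :> R by exact: ler0n.
move: eC; rewrite /C; have := mulfV (lt0r_neq0 N0).
clear ineq E1 E2 m; clearbody e h b a1 a2 kappa Dd N; clear C C0.
move: F0' t0 N0; move: (F%:R : R) (theta%:R : R) N => f t n.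
set p := n^-1 => f0 t0 n0 np eC key H1 H2 H3 fin.
have fb : f * b <= f * e by apply: ler_wpM2l.
(* The sign of the deficit decides which estimate of [h] serves: the lower bound [hit_ge] if it is
   nonnegative, the upper bound [hit_le] if it is negative. *)
have : t - Dd * p - t * n * e <= (t * n - Dd) * h.
  have [m0|m0] := leP 0 (t * n - Dd).
    have : (t * n - Dd) * (p - e) <= (t * n - Dd) * h by apply: ler_wpM2l => //; lra.
    have : Dd * e >= 0 by rewrite mulr_ge0// ltW.
    have : t * n * p = t by rewrite -mulrA np mulr1.
    move=> *; nra.
  have : (t * n - Dd) * p <= (t * n - Dd) * h by rewrite ler_nM2l.
  have : 0 <= t * n * e by rewrite !mulr_ge0// ltW.
  have : t * n * p = t by rewrite -mulrA np mulr1.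
  move=> *; nra.
move=> *; nra.
Qed.

End Positivity.

(** * Coexistence *)

Section Coexistence.
Variables (R : realType) (mu : probability (space R) R).
Hypothesis Hmu : uniform_law mu.
Let S : measurableType _ := space R.
Variables (F theta : nat).
Hypotheses (th0 : (0 < theta)%N) (hF : (4 * theta - 1 <= F)%N).

Implicit Types v : opinion F.

Lemma fixed_shift m (u : S) x v :
  fixed_at theta (shift m u) x v <-> fixed_at theta u (x + m) v.
Proof. by split=> -[K H]; exists K => k /H; rewrite val_shift. Qed.

Lemma fixates_shift m (u : S) x : fixates F theta (shift m u) x <-> fixates F theta u (x + m).
Proof. by split=> -[v Hv]; exists v; exact/(fixed_shift m u x v). Qed.

Lemma fixed_uniq (u : S) x v v' : fixed_at theta u x v -> fixed_at theta u x v' -> v = v'.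
Proof.
by move=> [K H] [K' H']; rewrite -(H (maxn K K')) ?leq_maxl// H' ?leq_maxr.
Qed.

(** [propagation] goes to the right only; by translation invariance fixation at [x] and at [x + 1]
    are equally likely, so the almost sure inclusion is an almost sure equality. *)
Lemma fixates_step x : Pr mu [set u : S | fixates F theta u x <-> fixates F theta u (x + 1)] = 1.
Proof.
have mf (y : int) : mP (fun u : S => fixates F theta u y) by exact: mP_fixates.
have eqP0 y : Pr mu [set u : S | fixates F theta u y] = Pr mu [set u : S | fixates F theta u 0].
  apply: etrans (shift_law y Hmu (mf 0)); congr (Pr mu _).
  by apply/seteqP; split=> u; [move=> h; apply/fixates_shift|move/fixates_shift]; rewrite add0r.
have prop := propagation Hmu F x th0.
have mI : mP (fun u : S => fixates F theta u x -> fixates F theta u (x + 1)) by apply: mP_imp; exact: mP_fixates.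
have mJ : mP (fun u : S => fixates F theta u (x + 1) -> fixates F theta u x) by apply: mP_imp; exact: mP_fixates.
have PJ : Pr mu [set u : S | fixates F theta u (x + 1) -> fixates F theta u x] = 1.
  have mD := measurableD (mf (x + 1)) (mf x); have mII := measurableI _ _ (mf (x + 1)) (mf x).
  have -> : [set u : S | fixates F theta u (x + 1) -> fixates F theta u x] =
      ~` ([set u | fixates F theta u (x + 1)] `\` [set u | fixates F theta u x]).
    apply/seteqP; split=> u; first by move=> /= H [a]; apply; exact: H.
    by move=> /= H a; apply: contrapT => b; apply: H.
  rewrite PrC//; suff -> : Pr mu ([set u : S | fixates F theta u (x + 1)] `\` [set u | fixates F theta u x]) = 0.
    by rewrite subr0.
  have := Pr_split mu (mf (x + 1)) (mf x).
  have : Pr mu [set u : S | fixates F theta u x] <=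
     Pr mu ([set u : S | fixates F theta u (x + 1)] `&` [set u | fixates F theta u x]).
    by apply: (Pr_le_ae (mf x) mII mI prop) => u H fx; split=> //; exact: H.
  have := Pr_ge0 mu ([set u : S | fixates F theta u (x + 1)] `\` [set u | fixates F theta u x]).
  rewrite !eqP0; set a := Pr mu (_ `\` _); set b := Pr mu _; set c := Pr mu _ => *; lra.
apply: (Pr1_sub _ (measurableI _ _ mI mJ) (Pr1_I mI mJ prop PJ)); last by move=> u [a b]; split.
change (mP (fun u : S => fixates F theta u x <-> fixates F theta u (x + 1))).
by apply: mP_and.
Qed.

Lemma int_chain (Q : int -> Prop) : (forall x, Q x <-> Q (x + 1)) -> forall x y, Q x -> Q y.
Proof.
move=> H; suff H0 x : Q x <-> Q 0 by move=> x y /H0 h; apply/H0.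
have pos (n : nat) : Q n%:Z <-> Q 0.
  elim: n => [//|n IH]; rewrite -IH (H n%:Z) (_ : n%:Z + 1 = n.+1%:Z)//; lia.
have neg (n : nat) : Q (- n%:Z) <-> Q 0.
  elim: n => [|n IH]; first by rewrite oppr0.
  by rewrite -IH (H (- n.+1%:Z)) (_ : - n.+1%:Z + 1 = - n%:Z)//; lia.
by case: (intP x) => [//|n|n].
Qed.

Lemma all_fixate : Pr mu [set u : S | forall x, fixates F theta u x] = 1.
Proof.
have mf (y : int) : mP (fun u : S => fixates F theta u y) by exact: mP_fixates.
have mE : mP (fun u : S => exists x, fixates F theta u x) by exact: mP_ex.
have PE : Pr mu [set u : S | exists x, fixates F theta u x] = 1.
  have inv m u : [set u : S | exists x, fixates F theta u x] (shift m u) <->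
      [set u : S | exists x, fixates F theta u x] u.
    split=> -[x]; first by move=> /fixates_shift ?; exists (x + m).
    by move=> fx; exists (x - m); apply/fixates_shift; rewrite subrK.
  case: (zero_one Hmu mE inv) => // E0.
  have := fixation_positive Hmu th0 hF; rewrite ltNge -E0 => /negP[].
  by apply: (Pr_le mu (mf 0) mE) => u ?; exists 0.
have mS x : mP (fun u : S => fixates F theta u x <-> fixates F theta u (x + 1)).
  by apply: mP_and; apply: mP_imp; exact: mP_fixates.
have mA : mP (fun u : S => forall x, fixates F theta u x <-> fixates F theta u (x + 1)) by exact: mP_all.
have PA := Pr1_all mS fixates_step.
apply: (Pr1_sub _ (measurableI _ _ mE mA) (Pr1_I mE mA PE PA)).
  by change (mP (fun u : S => forall x, fixates F theta u x)); exact: mP_all.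
by move=> u [[x fx] H] y; exact: int_chain H x y fx.
Qed.

Lemma val_global_flip (w : opinion F) (u : S) x k : good u -> fair u ->
  val_at F theta (flip_init (fun=> w) u) x k = xor w (val_at F theta u x k).
Proof.
move=> gu fu; case: k => [|k]; first by rewrite !val0 init_flip.
have gu' : good (flip_init (fun=> w) u) by exact: good_flip.
apply: (coupling_val (s := ring_time u x k) gu gu' (w := fun=> w)) => //.
  by move=> z; exact: init_flip.
by move=> z j _; left.
Qed.

(** Global flips exchange the limits. Opinions are finitely many, so one of them is a limit with
    positive probability, and then all are. *)
Lemma fixed_positive v : 0 < Pr mu [set u : S | fixed_at theta u 0 v].
Proof.
have le v1 v2 : Pr mu [set u : S | fixed_at theta u 0 v1] <= Pr mu [set u : S | fixed_at theta u 0 v2].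
  rewrite -(flip_law Hmu (fun=> xor v2 v1) (mP_fixed theta 0 v2)).
  have mG := measurableI _ _ (measurable_good R) (@mP_fair R).
  have G1 := Pr1_I (measurable_good R) (@mP_fair R) (good_as Hmu) (fair_as Hmu).
  apply: (Pr_le_ae (mP_fixed theta 0 v1) (mP_flip _ (mP_fixed theta 0 v2)) mG G1) => u [gu fu] [K H]; exists K => k Kk; rewrite val_global_flip// H//.
  by apply/ffunP => i; rewrite !ffunE addbK.
have [v' Pv] : exists v' : opinion F, 0 < Pr mu [set u : S | fixed_at theta u 0 v'].
  apply: contrapT => H; have := fixation_positive Hmu th0 hF.
  rewrite (Pr_sum mu (F := fun v : opinion F => [set u : S | fixed_at theta u 0 v])).
  - rewrite big1 ?ltxx// => v' _; apply/eqP; rewrite eq_le Pr_ge0 andbT leNgt.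
    by apply/negP => ?; apply: H; exists v'.
  - by move=> v'; exact: mP_fixed.
  - by move=> v1 v2 u; exact: fixed_uniq.
exact: lt_le_trans (le v' v).
Qed.

Lemma all_limits : Pr mu [set u : S | forall v : opinion F, exists x, fixed_at theta u x v] = 1.
Proof.
have mE v : mP (fun u : S => exists x, fixed_at theta u x v).
  by apply: mP_ex => x; exact: mP_fixed.
apply: Pr1_all => // v.
have inv m u : [set u : S | exists x, fixed_at theta u x v] (shift m u) <->
    [set u : S | exists x, fixed_at theta u x v] u.
  split=> -[x]; first by move=> /fixed_shift ?; exists (x + m).
  by move=> fx; exists (x - m); apply/fixed_shift; rewrite subrK.
case: (zero_one Hmu (mE v) inv) => // E0.
have := fixed_positive v; rewrite ltNge -E0 => /negP[].
by apply: (Pr_le mu (mP_fixed theta 0 v) (mE v)) => u ?; exists 0.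
Qed.

End Coexistence.

(** * Transfer to an arbitrary probability space *)

Section Transfer.
Variables (R : realType) (d : measure_display) (Omega : measurableType d).
Variables (P : probability Omega R) (U : idx -> Omega -> R).
Hypothesis hU : iid_uniform P U.

(** The law of the family [U] on the canonical space is one of the uniform laws, so an event almost
    sure under each of them holds for [U]. *)
Lemma iid_ae (G : set (space R)) : measurable G ->
  (forall mu : probability (space R) R, uniform_law mu -> Pr mu G = 1) ->
  {ae P, forall w, G (fun j => U j w)}.
Proof.
move=> mG HG; have [mU [uU iU]] := hU.
pose f (w : Omega) : space R := fun j => U j w.
have mf : measurable_fun setT f by apply: measurable_space => j; exact: mU.
have mpre B : measurable B -> measurable (f @^-1` B).
  by move=> mB; rewrite -[X in measurable X]setTI; exact: mf.
pose X : {mfun Omega >-> space R} := HB.pack f (isMeasurableFun.Build _ _ _ _ f mf).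
have law : uniform_law (distribution P X).
  split; first by move=> j a a01; exact: uU.
  move=> s A us mA.
  pose h (i : 'I_(size s)) := tnth (in_tuple s) i.
  have ih : injective h by exact/(tuple_uniqP (in_tuple s)).
  have := iU _ h ih (fun i => A (h i)) (fun i => mA (h i)).
  rewrite -(big_tnth _ _ s predT (fun j => P (U j @^-1` A j))) => <-.
  rewrite /distribution /pushforward; congr (P _); apply/seteqP; split=> w /= H.
    by move=> i _; apply: H; exact: mem_tnth.
  by move=> j /(tnthP (in_tuple s))[i ->]; exact: (H i Logic.I).
have := HG _ law; rewrite /Pr /distribution /pushforward => H.
exact: (Pr1_ae (mpre G mG) H).
Qed.

End Transfer.

Theorem theorem2 (R : realType) (d : measure_display) (Omega : measurableType d)
  (P : probability Omega R) (F theta : nat)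
  (hF : (1 <= F)%N) (htheta : (1 <= theta)%N) (hFtheta : (4 * theta - 1 <= F)%N)
  (U : idx -> Omega -> R) (hU : iid_uniform P U)
  (eta : Omega -> R -> int -> opinion F)
  (heta : {ae P, forall w, deffuant_path F theta (fun j => U j w) (eta w)}) :
  exists eta_inf : Omega -> int -> opinion F,
    (forall x : int, {ae P, forall w, exists t0 : R, forall t : R,
        t0 <= t -> eta w t x = eta_inf w x}) /\
    {ae P, forall w,
        #|[set v : opinion F | `[< exists x : int, eta_inf w x = v >] ]| = (2 ^ F)%N}.
Proof.
pose u w : space R := fun j => U j w.
(* The limit is read off the variables [U], not [eta], and [path_fixed] ties it back to [eta]; the
   default is taken only where [x] does not fixate, a null event. *)
exists (fun w x => xget (xor0 F) [set v | fixed_at theta (u w) x v]).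
have limE w x v : fixed_at theta (u w) x v ->
    xget (xor0 F) [set v | fixed_at theta (u w) x v] = v.
  by move=> Hv; apply: xget_unique => // v' Hv'; exact: fixed_uniq Hv' Hv.
have mall : mP (fun v : space R => forall x, fixates F theta v x).
  by apply: mP_all => x; exact: mP_fixates.
have mlim : mP (fun v : space R => forall z : opinion F, exists x, fixed_at theta v x z).
  by apply: mP_all => z; apply: mP_ex => x; exact: mP_fixed.
have ae_good := iid_ae hU (measurable_good R) (@good_as R).
have ae_fix := iid_ae hU mall (fun mu Hmu => all_fixate Hmu htheta hFtheta).
have ae_lim := iid_ae hU mlim (fun mu Hmu => all_limits Hmu htheta hFtheta).
split.
  move=> x; apply: filterS3 heta ae_good ae_fix => w pw gw /(_ x)[v Hv].
  have [K HK] := Hv; have [t0 Ht0] := path_fixed gw pw HK.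
  by exists t0 => t tt; rewrite (limE _ _ _ Hv) Ht0.
apply: filterS ae_lim => w Hw.
transitivity #|{: opinion F}|; last by rewrite card_ffun card_bool card_ord.
apply: eq_card => v; rewrite [RHS]inE; apply/mem_set/asboolP.
by have [x Hx] := Hw v; exists x; exact: limE.
Qed.
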